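(* Let $d\to\infty$ and let $n=n(d)>d$ be an integer-valued function of $d$ such that $$\gamma:=\lim_{d\to\infty}\frac{\log n(d)}{d}\in[0,+\infty].$$ Then, for every fixed $k\in\mathbb{N}$, $$\lim_{d\to\infty}\frac{\mathbb{E}f_{k-1}(C_{n-1,d})}{\binom nk}=\begin{cases}1,&\text{if }\gamma<1/k,\\0,&\text{if }\gamma>1/k.\end{cases}$$ Moreover, in the critical case when $\gamma=1/k$, more precisely if $\log n(d)=\frac1k(d+c\sqrt d+o(\sqrt d))$ for some fixed $k\in\mathbb{N}$ and some constant $c\in\mathbb{R}$, then $$\lim_{d\to\infty}\frac{\mathbb{E}f_{k-1}(C_{n-1,d})}{\binom nk}=\frac{1}{\sqrt{2\pi}}\int_{-\infty}^{-c}e^{-x^2/2}\,dx.$$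
   Context: For each $d$, let $\xi_1,\ldots,\xi_{n-1}$ (with $n=n(d)$, $n-1\geq d$) be random vectors in $\mathbb{R}^d$ (possibly dependent, with joint law allowed to depend on $d$), and let $S_0=0$, $S_i=\xi_1+\cdots+\xi_i$, $1\leq i\leq n-1$. Standing assumptions: (Exchangeability) for every permutation $\sigma$ of $\{1,\ldots,n-1\}$, $(\xi_{\sigma(1)},\ldots,\xi_{\sigma(n-1)})$ has the same distribution as $(\xi_1,\ldots,\xi_{n-1})$; (General position) for every $1\leq i_1<\cdots<i_d\leq n-1$ the probability that $S_{i_1},\ldots,S_{i_d}$ are linearly dependent is $0$. Let $C_{n-1,d}:=\operatorname{conv}(S_0,S_1,\ldots,S_{n-1})\subset\mathbb{R}^d$, the convex hull of $n$ points, and let $f_\ell(C_{n-1,d})$ be the number of $\ell$-dimensional faces of this polytope. *)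

(* Defs.v *)
From HB Require Import structures.
From mathcomp Require Export all_boot all_order all_algebra all_fingroup.
From mathcomp Require Export finmap.
From mathcomp Require Export all_classical all_reals all_analysis.

Set Implicit Arguments.
Unset Strict Implicit.
Unset Printing Implicit Defensive.

Import Order.TTheory GRing.Theory Num.Theory.
Import numFieldNormedType.Exports.
Local Open Scope classical_set_scope.
Local Open Scope ring_scope.

Definition conv_hull (R : realType) (d : nat) (A : set 'rV[R]_d) :
    set 'rV[R]_d :=
  [set x | exists (m : nat) (a : 'I_m -> R) (y : 'I_m -> 'rV[R]_d),
     [/\ forall i, A (y i), forall i, 0 <= a i, \sum_i a i = 1
       & x = \sum_i a i *: y i] ].

Definition aff_hull (R : realType) (d : nat) (A : set 'rV[R]_d) :
    set 'rV[R]_d :=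
  [set x | exists (m : nat) (a : 'I_m -> R) (y : 'I_m -> 'rV[R]_d),
     [/\ forall i, A (y i), \sum_i a i = 1 & x = \sum_i a i *: y i] ].

(* The empty set has no dimension in this sense. *)
Definition has_dim (R : realType) (d : nat) (A : set 'rV[R]_d) (l : nat) :
    Prop :=
  exists (x0 : 'rV[R]_d) (V : {vspace 'rV[R]_d}),
    \dim V = l /\ aff_hull A = [set x | x - x0 \in V].

(* Intersections with supporting hyperplanes; [u = 0] gives [C] itself and the
   empty set. *)
Definition is_face (R : realType) (d : nat) (C F : set 'rV[R]_d) : Prop :=
  exists (u : 'rV[R]_d) (b : R),
    (forall x, C x -> \sum_j u 0 j * x 0 j <= b) /\
    F = C `&` [set x | \sum_j u 0 j * x 0 j = b].

(* [fset_set] is only meaningful on finite sets: [C] is meant to be a polytope,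
   which has finitely many faces. *)
Definition num_faces (R : realType) (d l : nat) (C : set 'rV[R]_d) : nat :=
  #|` fset_set [set F | is_face C F /\ has_dim F l] |%fset.

(* A walk with [m] steps in dimension [d]: the step called xi_(i+1) on paper is
   [xi i], for [i : 'I_m]. *)
Definition partial_sum (R : realType) (T : Type) (m d : nat)
    (xi : 'I_m -> T -> 'rV[R]_d) (i : nat) (w : T) : 'rV[R]_d :=
  \sum_(j < m | (j < i)%N) xi j w.

Definition walk_hull (R : realType) (T : Type) (m d : nat)
    (xi : 'I_m -> T -> 'rV[R]_d) (w : T) : set 'rV[R]_d :=
  conv_hull [set partial_sum xi i w | i in [set i | (i <= m)%N]].

Definition random_vectors (R : realType) (disp : measure_display)
    (T : measurableType disp) (m d : nat) (xi : 'I_m -> T -> 'rV[R]_d) : Prop :=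
  forall (i : 'I_m) (j : 'I_d), measurable_fun [set: T] (fun w => xi i w 0 j).

(* Row vectors carry no sigma-algebra in the library; the joint law lives on
   the product sigma-algebra of tuples of tuples of reals. *)
Definition joint (R : realType) (T : Type) (m d : nat)
    (xi : 'I_m -> T -> 'rV[R]_d) (w : T) : m.-tuple (d.-tuple R) :=
  [tuple [tuple xi i w 0 j | j < d] | i < m].

Definition exchangeable (R : realType) (disp : measure_display)
    (T : measurableType disp) (P : probability T R) (m d : nat)
    (xi : 'I_m -> T -> 'rV[R]_d) : Prop :=
  forall (s : 'S_m) (A : set (m.-tuple (d.-tuple R))), measurable A ->
    pushforward P (joint (fun i => xi (s i))) A = pushforward P (joint xi) A.

Definition general_position (R : realType) (disp : measure_display)
    (T : measurableType disp) (P : probability T R) (m d : nat)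
    (xi : 'I_m -> T -> 'rV[R]_d) : Prop :=
  forall i : 'I_d -> nat,
    (forall j, (1 <= i j <= m)%N) ->
    (forall j j' : 'I_d, (j < j')%N -> (i j < i j')%N) ->
    P [set w | ~~ free [seq partial_sum xi (i j) w | j : 'I_d] ] = 0%E.

Definition expected_faces (R : realType) (disp : measure_display)
    (T : measurableType disp) (P : probability T R) (m d : nat)
    (xi : 'I_m -> T -> 'rV[R]_d) (l : nat) : \bar R :=
  ('E_P[fun w => (num_faces l (walk_hull xi w))%:R])%E.

(* Main.v *)
Require Import Defs.
From mathcomp Require Import measurable_realfun ftc normal_distribution.
From mathcomp Require Import ring lra zify.

(** The expected number of faces has an exact expression in terms of sums of
    independent Bernoulli variables, to which Chebyshev's inequality and a central
    limit theorem apply.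

    Geometry.  In general position the faces of dimension [k - 1] are simplices
    on sets [I] of [k] among the [n] points such that some supporting hyperplane
    touches exactly the points of [I] ([num_faces_hull]).  By Farkas' lemma a set
    [I] fails to be a face exactly when the points satisfy an affine relation with
    nonnegative coefficients off [I], not all zero.  Close the walk by one more
    step, so that the steps are arranged on a circle.  Summation by parts turns such
    an affine relation into a linear relation [y] between the steps that decreases
    along the arcs into which [I] cuts the circle; the decrease can be made strict,
    by general position ([descends_face]).

    Counting.  By exchangeability the expectation may be averaged over all orders
    of the steps, so that one counts pairs of an order and a set [I] that is not a
    face.  Rotating the circle so that an element of [I] comes last, one counts the
    arrangements of the [n] steps into [k] consecutive blocks such that some linear
    relation decreases along each block ([sum_descends]).  For a given
    distribution [f] of the steps into blocks, these are the regions which the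
    hyperplanes [y a = y b], with [a] and [b] in the same block, cut on the space of
    linear relations ([card_listings]), and Whitney's theorem ([whitney]) counts
    them in terms of the dimensions of intersections of the hyperplanes.  In general
    position a dimension depends only on the number of components of the graph that
    the hyperplanes form ([rank_cap_flow]).  Hence the count is the same for all
    walks, namely a linear functional of the sum over [f] of the chromatic
    polynomials of the graphs that join steps of the same block.  This sum is an
    alternating sum, over sets of [i] out of the [k] blocks, of the polynomials
    [\prod_(l < n) (i 'X - l)] ([sum_surj_chrom]), which up to signs and
    normalization are the generating functions of sums of independent trials with
    success probabilities [i / (i + l)].  The trial [l = i] is a fair coin, which
    absorbs the signs ([bexp_parity]).  The outcome ([expected_faces_formula],
    [expected_ratio]) is that the ratio of the expected number of faces to the
    binomial coefficient is one minus an alternating sum, over the same sets, of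
    the probabilities that the number of successes [N_i] in the trials [l < n],
    [l <> i], exceeds [d], with explicit coefficients.

    Asymptotics.  The coefficient for [i = k] tends to one and those for [i < k]
    tend to zero, so the ratio behaves as the probability of [N_k <= d]
    ([face_ratio_cvg]).  Mean and variance of [N_k] are both [k ln n + O(1)]
    ([mean_var_log]).  When [ln n] is away from [d / k], Chebyshev's inequality
    gives the limits [1] and [0].  In the critical case [N_k] is asymptotically
    Gaussian ([clt]), which is proved by Stein's method. *)

Set Implicit Arguments.
Unset Strict Implicit.
Unset Printing Implicit Defensive.

Import Order.TTheory GRing.Theory Num.Theory.
Import numFieldNormedType.Exports.
Local Open Scope ring_scope.

(** * Gordan's alternative *)

Section Dot.
Variables (R : realFieldType) (d : nat).
Implicit Types u v w : 'rV[R]_d.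

Definition dot u v : R := \sum_j u 0 j * v 0 j.

Lemma dotC u v : dot u v = dot v u.
Proof. by apply: eq_bigr => j _; rewrite mulrC. Qed.

Lemma dotDl u v w : dot (u + v) w = dot u w + dot v w.
Proof. by rewrite -big_split; apply: eq_bigr => j _; rewrite mxE mulrDl. Qed.

Lemma dotZl a u v : dot (a *: u) v = a * dot u v.
Proof. by rewrite mulr_sumr; apply: eq_bigr => j _; rewrite mxE mulrA. Qed.

Lemma dotNl u v : dot (- u) v = - dot u v.
Proof. by rewrite -scaleN1r dotZl mulN1r. Qed.

Lemma dotBl u v w : dot (u - v) w = dot u w - dot v w.
Proof. by rewrite dotDl dotNl. Qed.

Lemma dot0l v : dot 0 v = 0.
Proof. by rewrite -(scale0r v) dotZl mul0r. Qed.

Lemma dotDr u v w : dot w (u + v) = dot w u + dot w v.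
Proof. by rewrite dotC dotDl !(dotC w). Qed.

Lemma dotZr a u v : dot u (a *: v) = a * dot u v.
Proof. by rewrite dotC dotZl dotC. Qed.

Lemma dotNr u v : dot u (- v) = - dot u v.
Proof. by rewrite dotC dotNl dotC. Qed.

Lemma dotBr u v w : dot w (u - v) = dot w u - dot w v.
Proof. by rewrite dotDr dotNr. Qed.

Lemma dot0r u : dot u 0 = 0.
Proof. by rewrite dotC dot0l. Qed.

Lemma dot_sumr I (s : seq I) (P : pred I) (F : I -> 'rV[R]_d) u :
  dot u (\sum_(i <- s | P i) F i) = \sum_(i <- s | P i) dot u (F i).
Proof. by elim/big_rec2: _ => [|i y x _ <-]; rewrite ?dot0r ?dotDr. Qed.

Lemma dot_mulmx u v : dot u v = (u *m v^T) 0 0.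
Proof. by rewrite mxE; apply: eq_bigr => j _; rewrite mxE. Qed.

Lemma dotvv_gt0 u : u != 0 -> 0 < dot u u.
Proof.
move=> u0; have /existsP[j uj] : [exists j, u 0 j != 0].
  apply: contraNT u0; rewrite negb_exists => /forallP u0.
  by apply/eqP/rowP => j; rewrite mxE; apply/eqP; rewrite -[_ == _]negbK u0.
rewrite /dot (bigD1 j) //= ltr_pwDl // ?sumr_ge0 // => [|i _].
  by rewrite -expr2 lt0r sqr_ge0 sqrf_eq0 uj.
by rewrite -expr2 sqr_ge0.
Qed.

End Dot.

(** Finitely many strict inequalities survive a small perturbation; where an
    inequality is only weak, the perturbation itself has to be positive. *)
Lemma small_multiple (R : realFieldType) (T : eqType) (s : seq T)
    (a b : T -> R) :
    (forall i, i \in s -> 0 < a i \/ (0 <= a i /\ 0 < b i)) ->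
  exists2 e, 0 < e & forall e', 0 < e' <= e ->
    forall i, i \in s -> 0 < a i + e' * b i.
Proof.
elim: s => [_|i s IH pa]; first by exists 1.
have [e e0 He] := IH (fun j js => pa j (mem_behead (s := i :: s) js)).
have [e1 e10 He1] : exists2 e1, 0 < e1 &
    forall e', 0 < e' <= e1 -> 0 < a i + e' * b i.
  have [ai|[ai bi]] := pa i (mem_head _ _); last first.
    by exists 1 => // e' /andP[e'0 _]; rewrite ltr_wpDl // mulr_gt0.
  have bi : 0 < 1 + `|b i| by rewrite ltr_pwDl.
  exists (a i / (1 + `|b i|)) => [|e' /andP[e'0]]; first by rewrite divr_gt0.
  rewrite ler_pdivlMr // => H.
  have : - (e' * `|b i|) <= e' * b i.
    rewrite -mulrN; apply: ler_wpM2l; first exact: ltW.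
    by rewrite lerNl -normrN ler_norm.
  lra.
exists (Num.min e e1) => [|e']; first by rewrite lt_min e0.
rewrite le_min => /and3P[e'0 le1 le2] j; rewrite inE => /predU1P[->|js].
  by apply: He1; rewrite e'0.
by apply: He => //; rewrite e'0.
Qed.

(** Induction on the vectors: if [w] is the new one, solve the problem for the
    projections of the others to the hyperplane orthogonal to [w].  A solution
    [u] there, made orthogonal to [w], stays a solution after adding a small
    multiple of [w].  A relation between the projections says that some
    nonnegative combination of the others is a multiple [t w]: for [t <= 0] this
    is a relation including [w], and for [t > 0] a solution for the others is
    automatically positive on [w]. *)
Lemma gordan (R : realFieldType) (d : nat) (T : eqType) (s : seq T)
    (v : T -> 'rV[R]_d) : uniq s ->
  (exists u, forall i, i \in s -> 0 < dot u (v i)) \/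
  (exists l : T -> R, [/\ forall i, i \in s -> 0 <= l i,
     exists2 i, i \in s & 0 < l i & \sum_(i <- s) l i *: v i = 0]).
Proof.
elim: s v => [|a s IH] v /=; first by left; exists 0.
case/andP=> ans us; set w := v a.
have ext (b : R) (l : T -> R) : \sum_(i <- a :: s)
    (if i == a then b else l i) *: v i = b *: w + \sum_(i <- s) l i *: v i.
  rewrite big_cons eqxx; congr (_ + _); apply: eq_big_seq => i si.
  by rewrite (negPf (memPn ans i si)).
have [w0|w0] := eqVneq w 0.
  right; exists (fun i => if i == a then 1 else 0); split.
  - by move=> i _; case: ifP.
  - by exists a; rewrite ?mem_head // eqxx.
  - by rewrite ext w0 scaler0 add0r big1 // => i _; rewrite scale0r.
have ww := dotvv_gt0 w0.
have [[u Hu]|[l [l0 [i0 si0 li0] Hl]]] := IH v us; last first.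
  right; exists (fun i => if i == a then 0 else l i); split.
  - by move=> i; rewrite inE; case: ifP => //= _ /l0.
  - by exists i0; rewrite ?inE ?si0 ?orbT // (negPf (memPn ans i0 si0)).
  - by rewrite ext scale0r add0r.
(* the projections, scaled by [dot w w] to stay free of divisions *)
pose v' i := dot w w *: v i - dot (v i) w *: w.
have [[u' Hu']|[l [l0 [i0 si0 li0] Hl]]] := IH v' us.
  pose u2 := dot w w *: u' - dot u' w *: w.
  have u2w : dot u2 w = 0 by rewrite dotBl !dotZl mulrC subrr.
  have u2v i : dot u2 (v i) = dot u' (v' i).
    by rewrite dotBl dotBr !dotZl !dotZr (dotC w (v i)); ring.
  have [|e e0 He] := @small_multiple R T (a :: s) (fun i => dot u2 (v i))
    (fun i => dot w (v i)).
    move=> i; rewrite inE => /predU1P[->|si]; first by right; rewrite u2w.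
    by left; rewrite u2v Hu'.
  left; exists (u2 + e *: w) => i si; rewrite dotDl dotZl.
  by apply: He => //; rewrite e0 lexx.
have eqs : dot w w *: (\sum_(i <- s) l i *: v i) =
    (\sum_(i <- s) l i * dot (v i) w) *: w.
  apply/eqP; rewrite -subr_eq0; apply/eqP.
  rewrite -[RHS]Hl scaler_sumr scaler_suml -sumrB; apply: eq_bigr => i _.
  by rewrite scalerBr !scalerA (mulrC (dot w w)).
have [b0|b0] := lerP (\sum_(i <- s) l i * dot (v i) w) 0.
  right; exists (fun i => if i == a then - (\sum_(i <- s) l i * dot (v i) w)
                          else dot w w * l i); split.
  - move=> i; rewrite inE; case: ifP => [_ _|_ /= si]; first by rewrite oppr_ge0.
    by rewrite mulr_ge0 ?l0 // ltW.
  - exists i0; rewrite ?inE ?si0 ?orbT // (negPf (memPn ans i0 si0)).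
    by rewrite mulr_gt0.
  - rewrite ext scaleNr -eqs scaler_sumr addrC; apply/eqP; rewrite subr_eq0.
    by apply/eqP/eq_bigr => i _; rewrite scalerA.
left; exists u => i; rewrite inE => /predU1P[->|]; last exact: Hu.
have : 0 < dot u (dot w w *: (\sum_(i <- s) l i *: v i)).
  rewrite dotZr mulr_gt0 // dot_sumr (perm_big _ (perm_to_rem si0)) big_cons /=.
  rewrite ltr_wpDr ?dotZr ?mulr_gt0 ?Hu //.
  rewrite big_seq sumr_ge0 // => j /mem_rem sj.
  by rewrite dotZr mulr_ge0 ?l0 // ltW // Hu.
by rewrite eqs dotZr pmulr_rgt0.
Qed.

(** Gordan's alternative in the quotient by the row space of [A], where the
    equality constraints become vacuous: [cokermx A] is the quotient map. *)
Lemma mixed_gordan (R : realFieldType) (d p : nat) (T : eqType) (s : seq T)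
    (v : T -> 'rV[R]_d) (A : 'M[R]_(p, d)) : uniq s ->
  (exists2 u, forall x : 'rV[R]_d, (x <= A)%MS -> dot u x = 0 &
     forall i, i \in s -> 0 < dot u (v i)) \/
  (exists l : T -> R, [/\ forall i, i \in s -> 0 <= l i,
     exists2 i, i \in s & 0 < l i & ((\sum_(i <- s) l i *: v i)%R <= A)%MS]).
Proof.
move=> us.
have [[z Hz]|[l [l0 li Hl]]] := gordan (fun i : T => v i *m cokermx A : 'rV_d) us.
  left; exists (z *m (cokermx A)^T) => [x|i si].
    by rewrite submxE => /eqP xA; rewrite dotC dot_mulmx trmx_mul trmxK mulmxA
      xA mul0mx mxE.
  by rewrite dotC dot_mulmx trmx_mul trmxK mulmxA -dot_mulmx dotC Hz.
right; exists l; split=> //; rewrite submxE mulmx_suml; apply/eqP.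
rewrite -[RHS]Hl; apply: eq_bigr => i _; by rewrite -scalemxAl.
Qed.

(** * Whitney's theorem *)

Fixpoint subseqs (T : Type) (s : seq T) : seq (seq T) :=
  if s is x :: s' then subseqs s' ++ [seq x :: B | B <- subseqs s'] else [:: [::]].

Fixpoint all_signs (n : nat) : seq (seq bool) :=
  if n is n'.+1 then [seq true :: t | t <- all_signs n'] ++
                     [seq false :: t | t <- all_signs n'] else [:: [::]].

Lemma big_subseqs_cons (V : nmodType) (T : Type) (x : T) s (F : seq T -> V) :
  \sum_(B <- subseqs (x :: s)) F B =
  \sum_(B <- subseqs s) F B + \sum_(B <- subseqs s) F (x :: B).
Proof. by rewrite big_cat big_map. Qed.

(** Whitney's theorem for the arrangement that a list of linear forms cuts on a
    subspace.  Subspaces are row spaces, and linear forms are column vectors, so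
    that [kermx f] is the hyperplane [f = 0]. *)
Section Whitney.
Variables (R : realFieldType) (n : nat).
Implicit Types (V W : 'M[R]_n) (y z : 'rV[R]_n) (f : 'cV[R]_n).

Definition form f y : R := (y *m f) 0 0.

Lemma formD f y z : form f (y + z) = form f y + form f z.
Proof. by rewrite /form mulmxDl mxE. Qed.

Lemma formZ f a y : form f (a *: y) = a * form f y.
Proof. by rewrite /form -scalemxAl mxE. Qed.

Lemma form_kerP f y : reflect (form f y = 0) (y <= kermx f)%MS.
Proof.
apply: (iffP sub_kermxP) => [|H]; first by rewrite /form => ->; rewrite mxE.
by apply/matrixP => i j; rewrite !ord1 [LHS]H mxE.
Qed.

Definition has_sign (b : bool) (x : R) := if b then 0 < x else x < 0.

Definition signs_ok y (s : seq 'cV[R]_n) (t : seq bool) :=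
  all2 (fun f b => has_sign b (form f y)) s t.

Definition realizable V s t := exists2 y, (y <= V)%MS & signs_ok y s t.

Definition num_realizable V s :=
  count (fun t => `[< realizable V s t >]) (all_signs (size s)).

Definition cap_kernels V (B : seq 'cV[R]_n) := foldl (fun W f => W :&: kermx f)%MS V B.

Lemma has_signD b x x' : has_sign b x -> has_sign b x' -> has_sign b (x + x').
Proof. by case: b => /=; lra. Qed.

Lemma has_signM b a x : 0 < a -> has_sign b (a * x) = has_sign b x.
Proof. by case: b => /= a0; rewrite ?pmulr_rgt0 ?pmulr_rlt0. Qed.

Lemma signs_ok_open y z s t : signs_ok y s t ->
  exists2 e, 0 < e & forall e', 0 < e' <= e -> signs_ok (y + e' *: z) s t.
Proof.
elim: s t => [|f s IH] [|b t] //=; first by exists 1.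
case/andP=> fb /IH[e e0 He].
have [|e1 e10 He1] := @small_multiple R unit [:: tt]
  (fun _ => (-1) ^+ (~~ b) * form f y) (fun _ => (-1) ^+ (~~ b) * form f z).
  by move=> i _; left; case: b fb => /=; lra.
exists (Num.min e e1) => [|e']; first by rewrite lt_min e0.
rewrite le_min => /and3P[e'0 le1 le2]; rewrite He ?e'0 // andbT.
have /He1/(_ tt (mem_head _ _)) : 0 < e' <= e1 by rewrite e'0.
by rewrite formD formZ; case: (b) => /=; lra.
Qed.

Lemma signs_ok_comb y z s t a b : 0 < a -> 0 < b ->
  signs_ok y s t -> signs_ok z s t -> signs_ok (a *: y + b *: z) s t.
Proof.
move=> a0 b0; elim: s t => [|f s IH] [|c t] //= /andP[fy sy] /andP[fz sz].
by rewrite IH // andbT formD !formZ has_signD // has_signM.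
Qed.

Lemma cap_kernels_sub V B : (cap_kernels V B <= V)%MS.
Proof.
elim: B V => [|f B IH] V /=; first exact: submx_refl.
exact: submx_trans (IH _) (capmxSl _ _).
Qed.

Lemma cap_kernelsS V W B : (V <= W)%MS -> (cap_kernels V B <= cap_kernels W B)%MS.
Proof. by elim: B V W => //= f B IH V W VW; apply/IH/capmxS. Qed.

Lemma sub_cap_kernelsP V B y : reflect ((y <= V)%MS /\ forall f, f \in B -> form f y = 0)
  (y <= cap_kernels V B)%MS.
Proof.
apply: (iffP idP).
  elim: B V => [|f B IH] V /= yV; first by split.
  have [/[!sub_capmx]/andP[yV' /form_kerP yf] HB] := IH _ yV.
  by split=> // g; rewrite inE => /predU1P[->|/HB].
elim: B V => [|f B IH] V [yV HB] //=; apply: IH; split.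
  by rewrite sub_capmx yV; apply/form_kerP/HB/mem_head.
by move=> g gB; apply: HB; rewrite inE gB orbT.
Qed.

(** The value at [-1] of the characteristic polynomial of the arrangement, up to
    sign.  The subtraction is exact, as [cap_kernels V B] lies in [V]. *)
Definition whitney_sum V s : int :=
  \sum_(B <- subseqs s) (-1) ^+ (size B + (\rank V - \rank (cap_kernels V B))).

Lemma count_all_signs (P : pred (seq bool)) m :
  count P (all_signs m.+1) =
  (count (fun t => P (true :: t) || P (false :: t)) (all_signs m) +
   count (fun t => P (true :: t) && P (false :: t)) (all_signs m))%N.
Proof. by rewrite /= count_cat !count_map -count_predUI. Qed.

(** Deletion and restriction of the first form [f].  If [f] vanishes on [V]
    there are no strict sign vectors, and the subsets with and without [f] cancel
    in pairs.  Otherwise a sign vector of the other forms extends in at least one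
    way, and in two ways exactly when it is realized on the hyperplane [f = 0]:
    between two points of opposite signs there is one where [f] vanishes, and
    from there both sides are reached by small steps. *)
Theorem whitney V s : (num_realizable V s)%:R = whitney_sum V s.
Proof.
elim: s V => [|f s IH] V.
  rewrite /whitney_sum /num_realizable /= big_seq1 subnn expr0 addn0.
  by rewrite (_ : `[< _ >] = true) //; apply/asboolP; exists 0; rewrite ?sub0mx.
rewrite /whitney_sum big_subseqs_cons /= /num_realizable count_all_signs.
have [Vf|] := boolP (V <= kermx f)%MS.
  rewrite -big_split big1 /= => [|B _].
    rewrite !(@eq_count _ _ pred0) ?count_pred0 // => t /=; apply/negbTE.
      rewrite negb_and; apply/orP; left; apply/asboolPn => -[y yV /= /andP[]].
      by have /form_kerP -> := submx_trans yV Vf; rewrite ltxx.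
    rewrite negb_or; apply/andP; split; apply/asboolPn => -[y yV /= /andP[]];
    by have /form_kerP -> := submx_trans yV Vf; rewrite ltxx.
  rewrite addSn exprS mulN1r; apply/eqP; rewrite addr_eq0 opprK; apply/eqP.
  suff -> : \rank (cap_kernels V B) = \rank (cap_kernels (V :&: kermx f)%MS B) by [].
  apply/eqP; rewrite eqn_leq !mxrankS ?cap_kernelsS ?capmxSl //.
  by rewrite sub_capmx submx_refl.
move=> Vf.
(* a direction inside [V] in which [f] increases *)
have [z zV fz] : exists2 z, (z <= V)%MS & 0 < form f z.
  have /row_subPn[i] := Vf => Hi.
  have [fi|fi|/esym/form_kerP] := ltrgtP 0 (form f (row i V)); last by rewrite (negPf Hi).
    by exists (row i V) => //; exact: row_sub.
  exists ((-1) *: row i V); first by rewrite scalemx_sub ?row_sub.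
  by rewrite formZ mulN1r oppr_gt0.
have rV : \rank V = (\rank (V :&: kermx f)%MS).+1.
  rewrite -(mxrank_mul_ker V f) -[RHS]add1n; congr (_ + _)%N.
  apply/eqP; rewrite eqn_leq rank_leq_col lt0n mxrank_eq0.
  by apply: contra Vf => /eqP Vf; apply/sub_kermxP.
rewrite -/(whitney_sum V s) -IH natrD; congr (_ + _).
  congr (_%:R); apply: eq_count => t /=; apply/orP/asboolP.
    by move=> [|] /asboolP[y yV /= /andP[_ ys]]; exists y.
  move=> [y yV ys].
  have [fy|fy|fy] := ltrgtP 0 (form f y).
  - by left; apply/asboolP; exists y; rewrite //= fy.
  - by right; apply/asboolP; exists y; rewrite //= fy.
  - have [e e0 He] := signs_ok_open z ys.
    left; apply/asboolP; exists (y + e *: z); first by rewrite addmx_sub ?scalemx_sub.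
    by rewrite /= He ?e0 ?lexx // andbT formD -fy add0r formZ mulr_gt0.
have -> : \sum_(B <- subseqs s) (-1) ^+
    ((size B).+1 + (\rank V - \rank (cap_kernels (V :&: kermx f)%MS B))) =
    whitney_sum (V :&: kermx f)%MS s.
  apply: eq_bigr => B _; rewrite rV subSn ?mxrankS ?cap_kernels_sub //.
  by rewrite addnS addSn !exprS !mulN1r opprK.
rewrite -IH; congr (_%:R); apply: eq_count => t /=; apply/andP/asboolP.
  move=> [/asboolP[y yV /= /andP[fy ys]] /asboolP[x xV /= /andP[fx xs]]].
  exists (- form f x *: y + form f y *: x).
    rewrite sub_capmx addmx_sub ?scalemx_sub //=.
    by apply/form_kerP; rewrite formD !formZ mulNr mulrC addNr.
  by rewrite signs_ok_comb // oppr_gt0.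
move=> [y]; rewrite sub_capmx => /andP[yV /form_kerP yf] ys.
have [e e0 He] := signs_ok_open z ys.
have [e' e'0 He'] := signs_ok_open (- z) ys.
split; apply/asboolP.
  exists (y + e *: z); first by rewrite addmx_sub ?scalemx_sub.
  by rewrite /= He ?e0 ?lexx // andbT formD yf add0r formZ mulr_gt0.
exists (y + e' *: - z); first by rewrite addmx_sub ?scalemx_sub ?eqmx_opp.
rewrite /= He' ?e'0 ?lexx // andbT formD yf add0r formZ -scaleN1r formZ.
by rewrite mulN1r mulrN oppr_lt0 mulr_gt0.
Qed.

End Whitney.

(** * Chromatic polynomials of colour classes *)

Section Graph.
Variable n : nat.
Implicit Types (B s : seq ('I_n.+1 * 'I_n.+1)).

Definition edge_rel B : rel 'I_n.+1 := [rel a b | ((a, b) \in B) || ((b, a) \in B)].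

Definition num_components B := #|[set a | a \in fingraph.roots (edge_rel B)]|.

Lemma edge_rel_sym B : connect_sym (edge_rel B).
Proof. by apply: sym_connect_sym => a b; rewrite /edge_rel /= orbC. Qed.

(** A single labelling [kappa] of the components serves for colours in any type:
    for finite sets of colours it counts colourings, and for colours in a field it
    computes ranks. *)
Lemma num_componentsP B : exists2 kappa : 'I_n.+1 -> 'I_(num_components B),
  (forall i, exists a, kappa a = i) &
  forall (T : Type) (y : 'I_n.+1 -> T),
    (forall e, e \in B -> y e.1 = y e.2) <->
    (forall a b, kappa a = kappa b -> y a = y b).
Proof.
have rootP a : fingraph.root (edge_rel B) a \in [set a | a \in fingraph.roots (edge_rel B)].
  by rewrite inE; exact: (roots_root (edge_rel_sym B)).
exists (fun a => enum_rank_in (rootP ord0) (fingraph.root (edge_rel B) a)) => [i|T y].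
  exists (enum_val i); rewrite -[RHS](enum_valK_in (rootP ord0)); congr enum_rank_in.
  by have := enum_valP i; rewrite inE => /eqP.
split=> [yB a b|H e eB].
  move/(enum_rank_in_inj (rootP a) (rootP b))/(fingraph.rootP (edge_rel_sym B)) => /connectP[p].
  elim: p a => [|x p IH] a /= => [_ -> //|/andP[/orP[ax|xa] xp] eb].
    by rewrite (yB _ ax) /=; exact: IH.
  by rewrite -(yB _ xa) /=; exact: IH.
apply: H; congr enum_rank_in; apply/(fingraph.rootP (edge_rel_sym B)).
by apply: connect1; rewrite /edge_rel /=; case: e eB => a b /= ->.
Qed.

Lemma card_const_colorings B q :
  #|[set z : {ffun 'I_n.+1 -> 'I_q} | all (fun e => z e.1 == z e.2) B]| =
  (q ^ num_components B)%N.
Proof.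
have [kappa ksurj kP] := num_componentsP B.
rewrite -[in RHS](card_ord q) -{1}(card_ord (num_components B)) -card_ffun -cardsT.
have inj : injective (fun z : {ffun 'I_(num_components B) -> 'I_q} =>
    [ffun a => z (kappa a)]).
  move=> z z' /ffunP H; apply/ffunP => i; have [a <-] := ksurj i.
  by have := H a; rewrite !ffunE.
rewrite -(card_imset _ inj); apply: eq_card => z; rewrite inE.
apply/allP/imsetP => [H|[z' _ ->] e eB].
  have Hz := (kP _ z).1 (fun e eB => eqP (H e eB)).
  have sel i : {a | kappa a = i} by apply: cid; exact: ksurj.
  exists [ffun i => z (sval (sel i))]; rewrite ?inE //.
  by apply/ffunP => a; rewrite !ffunE; apply: Hz; case: sel.
apply/eqP; apply: (kP _ [ffun a => z' (kappa a)]).2 => // a b ab.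
by rewrite !ffunE ab.
Qed.

End Graph.

(** Inclusion-exclusion over the edges that are allowed to fail. *)
Lemma sum_subseqs_prod (K : comNzRingType) (T : eqType) (s : seq T) (x : T -> K) :
  \sum_(B <- subseqs s) (-1) ^+ size B * \prod_(e <- B) x e =
  \prod_(e <- s) (1 - x e).
Proof.
elim: s => [|e s IH]; first by rewrite /= big_seq1 !big_nil mulr1.
rewrite big_subseqs_cons big_cons -IH mulrBl mul1r; congr (_ + _).
rewrite mulr_sumr -sumrN; apply: eq_bigr => B _.
by rewrite big_cons exprS /=; ring.
Qed.

Lemma ffact_prod_field (R : numFieldType) N n :
  (N ^_ n)%:R = \prod_(l < n) (N%:R - l%:R) :> R.
Proof.
have [nN|Nn] := leqP n N.
  rewrite ffact_prod natr_prod; apply: eq_bigr => i _.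
  by rewrite natrB // ltnW // (leq_trans (ltn_ord i)).
by rewrite ffact_small // (bigD1 (Ordinal Nn)) //= subrr mul0r.
Qed.

Section Chromatic.
Variables (R : realFieldType) (n k : nat).
Implicit Types (f : {ffun 'I_n.+1 -> 'I_k}).

Definition mono_edges f : seq ('I_n.+1 * 'I_n.+1) :=
  [seq e : 'I_n.+1 * 'I_n.+1 <- enum {: 'I_n.+1 * 'I_n.+1} |
     (e.1 < e.2)%N && (f e.1 == f e.2)].

Definition surjectiveb f := [forall j, [exists a, f a == j]].

(** The chromatic polynomial of the graph [mono_edges f], a disjoint union of
    cliques, in its expansion over edge sets. *)
Definition chrom f : {poly R} :=
  \sum_(B <- subseqs (mono_edges f)) (-1) ^+ size B *: 'X^(num_components B).

Definition proper_colorings f q := [set z : {ffun 'I_n.+1 -> 'I_q} |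
   all (fun e => z e.1 != z e.2) (mono_edges f)].

Lemma horner_chrom f q : (chrom f).[q%:R] = #|proper_colorings f q|%:R.
Proof.
rewrite /chrom horner_sum.
under eq_bigr => B _ do rewrite hornerZ hornerXn -natrX -card_const_colorings
  -sum1_card natr_sum big_mkcond mulr_sumr.
rewrite exchange_big /= -sum1_card natr_sum [RHS]big_mkcond /=.
apply: eq_bigr => z _.
transitivity (\sum_(B <- subseqs (mono_edges f))
   (-1) ^+ size B * \prod_(e <- B) (z e.1 == z e.2)%:R : R).
  apply: eq_bigr => B _; congr (_ * _); rewrite inE.
  elim: B => [|e B IH] /=; first by rewrite big_nil.
  by rewrite big_cons -IH; case: eqP => _ /=; rewrite ?mul0r ?mul1r.
rewrite sum_subseqs_prod inE.
elim: (mono_edges f) => [|e B IH] /=; first by rewrite big_nil.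
by rewrite big_cons IH; case: eqP => _ /=; rewrite ?subrr ?mul0r ?subr0 ?mul1r.
Qed.

(** The graph of [f] joins any two vertices of equal colour, so a colouring is
    proper exactly when together with [f] it separates all vertices. *)
Lemma proper_injE f q (z : {ffun 'I_n.+1 -> 'I_q}) :
  (z \in proper_colorings f q) = injectiveb [ffun a => (f a, z a)].
Proof.
rewrite inE; apply/allP/injectiveP => [H a b|H e].
  rewrite !ffunE => -[fab zab]; have [ab|ab|ab] := ltngtP a b.
  - have := H (a, b); rewrite mem_filter /= mem_enum inE ab fab zab !eqxx.
    by move/(_ isT).
  - have := H (b, a); rewrite mem_filter /= mem_enum inE ab fab zab !eqxx.
    by move/(_ isT).
  - exact: val_inj.
rewrite mem_filter => /andP[/andP[e12 /eqP fe] _]; apply/eqP => ze.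
have := H e.1 e.2; rewrite !ffunE fe ze => /(_ erefl) e12'.
by rewrite e12' ltnn in e12.
Qed.

Lemma card_pairs_into (A : {set 'I_k}) q :
  (\sum_(f : {ffun 'I_n.+1 -> 'I_k} | [forall a, f a \in A]) #|proper_colorings f q|)%N =
  ((#|A| * q) ^_ n.+1)%N.
Proof.
rewrite -[in RHS](card_ord n.+1) -[q in RHS]card_ord -cardsT -cardsX.
rewrite -(card_inj_ffuns_on _ (mem (finset.setX A [set: 'I_q]))). rewrite -[RHS]sum1dep_card.
rewrite -(eq_bigr _ (fun f _ => sum1_card (mem (proper_colorings f q)))) pair_big_dep /=.
pose h (p : {ffun 'I_n.+1 -> 'I_k} * {ffun 'I_n.+1 -> 'I_q}) :
  {ffun 'I_n.+1 -> 'I_k * 'I_q} := [ffun a => (p.1 a, p.2 a)].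
pose g (w : {ffun 'I_n.+1 -> 'I_k * 'I_q}) :=
  ([ffun a => (w a).1] : {ffun 'I_n.+1 -> 'I_k},
   [ffun a => (w a).2] : {ffun 'I_n.+1 -> 'I_q}).
rewrite [RHS](reindex h) /=; last first.
  exists g => [[f z] _|w _]; rewrite /h /g /=.
    by congr pair; apply/ffunP => a; rewrite !ffunE.
  by apply/ffunP => a; rewrite !ffunE -surjective_pairing.
apply: eq_bigl => -[f z]; rewrite /= (_ : z \in _ = (z \in proper_colorings f q)) // proper_injE.
congr (_ && _).
apply/forallP/ffun_onP => H a; have := H a; rewrite ?ffunE !inE ?andbT //.
Qed.

(** Pairs ([f], proper colouring) are injections, which are easy to count when
    [f] takes values in a given set [A]; surjectivity of [f] is restored by
    inclusion-exclusion over [A]. *)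
Lemma sum_surj_proper q :
  (\sum_(f | surjectiveb f) #|proper_colorings f q|%:R : R) =
  \sum_(A : {set 'I_k}) (-1) ^+ (k - #|A|) * ((#|A| * q) ^_ n.+1)%:R.
Proof.
have prodb (P b : pred 'I_k) :
    \prod_(j | P j) (b j)%:R = [forall (j | P j), b j]%:R :> R.
  case: forallP => [H|/forallP].
    by rewrite big1 // => j Pj; have := H j; rewrite Pj => /= ->.
  rewrite negb_forall => /existsP[j]; rewrite negb_imply => /andP[Pj bj].
  by rewrite (bigD1 j) //= (negPf bj) mul0r.
transitivity (\sum_(f : {ffun 'I_n.+1 -> 'I_k}) \sum_(A : {set 'I_k})
   (-1) ^+ (k - #|A|) * [forall a, f a \in A]%:R * #|proper_colorings f q|%:R : R).
  rewrite big_mkcond; apply: eq_bigr => f _; rewrite -mulr_suml.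
  have -> : \sum_(A : {set 'I_k}) (-1) ^+ (k - #|A|) *
      [forall a, f a \in A]%:R = (surjectiveb f)%:R :> R.
    transitivity (\prod_(j < k) (1 - [forall a, f a != j]%:R) : R).
      rewrite bigA_distr; apply: eq_bigr => A _.
      rewrite [RHS](bigID (mem A)) /=.
      under eq_bigr => j jA do rewrite jA.
      under [X in _ = _ * X]eq_bigr => j jA do rewrite (negPf jA).
      rewrite big1_eq mul1r prodrN prodb; congr (_ ^+ _ * _%:R).
        rewrite -[k in (k - _)%N]card_ord -cardsT -cardsDS ?finset.subsetT // finset.setTD.
        by apply: eq_card => j; rewrite !inE.
      congr nat_of_bool; apply/forallP/forallP => [H j|H a].
        by apply/implyP => jA; apply/forallP => a; apply: contraNneq jA => <-.
      rewrite -[_ \in _]negbK; apply/negP => faA; have /implyP := H (f a).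
      by move=> /(_ faA)/forallP/(_ a)/eqP.
    rewrite -(prodb xpredT (fun j => [exists a, f a == j])).
    apply: eq_bigr => j _; rewrite -negb_exists.
    by case: ([exists a, f a == j]); rewrite ?subr0 ?subrr.
  by case: ifP; rewrite ?mul1r ?mul0r.
rewrite exchange_big; apply: eq_bigr => A _.
rewrite -card_pairs_into natr_sum mulr_sumr [RHS]big_mkcond.
by apply: eq_bigr => f _; case: ifP; rewrite ?mulr1 ?mulr0 ?mul0r.
Qed.

(** Both sides are polynomials that agree at all natural numbers. *)
Lemma sum_surj_chrom :
  \sum_(f | surjectiveb f) chrom f =
  \sum_(A : {set 'I_k}) (-1) ^+ (k - #|A|) *:
     \prod_(l < n.+1) (#|A|%:R *: 'X - l%:R%:P).
Proof.
apply/eqP; rewrite -subr_eq0; set p := _ - _.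
apply: contraT => p0.
have : all (root p) [seq i%:R | i <- iota 0 (size p)].
  apply/allP => x /mapP[q _ ->]; rewrite rootE /p hornerD hornerN !horner_sum.
  under eq_bigr => f _ do rewrite horner_chrom.
  rewrite sum_surj_proper subr_eq0; apply/eqP; apply: eq_bigr => A _.
  rewrite hornerZ ffact_prod_field horner_prod; congr (_ * _).
  by apply: eq_bigr => l _; rewrite !hornerE natrM.
move=> /(max_poly_roots p0); rewrite size_map size_iota ltnn; apply.
rewrite map_inj_uniq ?iota_uniq // => i j /eqP.
by rewrite eqr_nat => /eqP.
Qed.

End Chromatic.

(** * Listings as regions of an arrangement *)

(** The rank of an element is the number of elements below it. *)
Lemma perm_of_order n (lt : rel 'I_n) : irreflexive lt -> transitive lt ->
  (forall a b, a != b -> lt a b || lt b a) ->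
  exists rho : 'S_n, forall a b, (rho a < rho b)%N = lt a b.
Proof.
move=> irr tr tot; pose pos a := #|[set b | lt b a]|.
have posP a b : lt a b -> (pos a < pos b)%N.
  move=> ab; apply/proper_card/fintype.properP; split.
    by apply/fintype.subsetP => c; rewrite !inE => /tr; apply.
  by exists a; rewrite !inE ?irr.
have pos_lt a : (pos a < n)%N.
  rewrite -[X in (_ < X)%N]card_ord -cardsT; apply/proper_card/fintype.properP.
  split; first by apply/fintype.subsetP => c; rewrite inE.
  by exists a; rewrite !inE ?irr.
have posE a b : (pos a < pos b)%N = lt a b.
  apply/idP/idP => [|/posP//] ab; have [eab|/tot/orP[//|/posP]] := eqVneq a b.
    by rewrite eab ltnn in ab.
  by rewrite ltnNge (ltnW ab).
have inj : injective (fun a => Ordinal (pos_lt a)).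
  move=> a b /(congr1 val) /= ab; apply/eqP; apply: contraT => /tot.
  by rewrite -!posE ab ltnn.
by exists (perm inj) => a b; rewrite !permE /= posE.
Qed.

Lemma card_perm_before n (s : 'S_n) a : #|[set b | (s b < s a)%N]| = s a.
Proof.
rewrite -(card_imset _ (@perm_inj _ s)).
have -> : [set s x | x in [set b | (s b < s a)%N]] = [set i : 'I_n | (i < s a)%N].
  apply/setP => i; rewrite inE; apply/imsetP/idP => [[b]|ia].
    by rewrite inE => ? ->.
  by exists ((s^-1)%g i); rewrite ?inE permKV.
rewrite -sum1dep_card (big_ord_narrow (ltnW (ltn_ord _))) sum1_card.
by rewrite card_ord.
Qed.

Lemma perm_order_inj n (rho rho' : 'S_n) :
  (forall a b, (rho a < rho b)%N = (rho' a < rho' b)%N) -> rho = rho'.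
Proof.
move=> H; apply/permP => a; apply: val_inj => /=.
by rewrite -(card_perm_before rho) -(card_perm_before rho'); apply: eq_card => b; rewrite !inE H.
Qed.

Lemma mem_all_signs N t : (t \in all_signs N) = (size t == N).
Proof.
elim: N t => [|N IH] [|b t] //=.
  by rewrite mem_cat; apply/negbTE; rewrite negb_or; apply/andP; split;
    apply/mapP => -[].
rewrite eqSS -IH mem_cat; case: b.
  rewrite mem_map => [|x y [] //]; rewrite orbC.
  by rewrite (_ : _ \in _ = false) //; apply/mapP => -[].
rewrite orbC mem_map => [|x y [] //]; rewrite orbC.
by rewrite (_ : _ \in _ = false) //; apply/mapP => -[].
Qed.

Lemma uniq_all_signs N : uniq (all_signs N).
Proof.
elim: N => //= N IH; rewrite cat_uniq !map_inj_uniq ?IH => [|x y []|x y []] //.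
rewrite andbT; apply/hasPn => x /mapP[t _ ->].
by apply/mapP => -[].
Qed.

Section Regions.
Variables (R : realFieldType) (n k : nat).
Implicit Types (f : {ffun 'I_n.+1 -> 'I_k}) (pi : 'S_n.+1) (M : 'M[R]_n.+1).

Definition edge_form (e : 'I_n.+1 * 'I_n.+1) : 'cV[R]_n.+1 :=
  delta_mx e.1 0 - delta_mx e.2 0.

Lemma form_edge e y : form (edge_form e) y = y 0 e.1 - y 0 e.2.
Proof.
by rewrite /form /edge_form mulmxBr mxE [in X in _ + X]mxE -!colE !mxE.
Qed.

(** The cyclic successor: [succ ord_max = ord0]. *)
Definition succ (i : 'I_n.+1) : 'I_n.+1 := inZp i.+1.

Lemma val_succ (i : 'I_n.+1) : (i < n)%N -> val (succ i) = i.+1.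
Proof. by move=> i_n; rewrite /= modn_small. Qed.

(** The orders in which all the indices can be listed so that the colour classes
    of [f] come one after another and some vector of [M] decreases along each
    class.  They are the regions that the hyperplanes [y a = y b], for [a] and [b]
    of equal colour, cut on [M]. *)
Definition listings M f : {set 'S_n.+1} :=
  [set pi : 'S_n.+1 | [forall i : 'I_n.+1, forall j : 'I_n.+1,
               (i <= j)%N ==> (f (pi i) <= f (pi j))%N] &
     `[< exists2 y : 'rV[R]_n.+1, (y <= M)%MS & forall i : 'I_n.+1, (i < n)%N ->
          f (pi i) = f (pi (succ i)) -> y 0 (pi (succ i)) < y 0 (pi i) >] ].

(** The order can be read off from the inverse permutation, with comparisons of
    arbitrary elements in place of consecutive ones. *)
Lemma listingsP M f pi : reflect
  ((forall a b, (f a < f b)%N -> ((pi^-1)%g a < (pi^-1)%g b)%N) /\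
   exists2 y : 'rV[R]_n.+1, (y <= M)%MS &
     forall a b, f a = f b -> ((pi^-1)%g a < (pi^-1)%g b)%N -> y 0 b < y 0 a)
  (pi \in listings M f).
Proof.
rewrite inE; apply: (iffP andP) => [[/forallP mono /asboolP[y yM Hy]]|].
  have mono' (i j : 'I_n.+1) : (i <= j)%N -> (f (pi i) <= f (pi j))%N.
    by have /forallP/(_ j)/implyP := mono i.
  split=> [a b|].
    rewrite ltnNge; apply: contraR; rewrite -leqNgt => /mono'.
    by rewrite !permKV.
  exists y => // a b; rewrite -{1 3}(permKV pi a) -{1 3}(permKV pi b).
  move: ((pi^-1)%g a) ((pi^-1)%g b) => i j fij.
  rewrite -subn_gt0; move E: (j - i)%N => [//|g] _.
  elim: g j fij E => [|g IH] j fij E; have jn := ltn_ord j.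
    have ej : j = succ i by apply: val_inj; rewrite val_succ /=; lia.
    by rewrite ej; apply: Hy; rewrite -?ej //; lia.
  have j1n : (j.-1 < n.+1)%N by lia.
  have sj : succ (Ordinal j1n) = j by apply: val_inj; rewrite val_succ /=; lia.
  have fj : f (pi i) = f (pi (Ordinal j1n)).
    apply/val_inj/eqP; rewrite eqn_leq mono' /=; last lia.
    by rewrite fij mono' //=; lia.
  apply: lt_trans (IH (Ordinal j1n) fj _); last by rewrite /=; lia.
  by rewrite -{1}sj; apply: Hy; rewrite ?sj -?fj //=; lia.
move=> [mono [y yM Hy]]; split.
  apply/forallP => i; apply/forallP => j; apply/implyP; apply: contraLR.
  by rewrite -!ltnNge => /mono; rewrite !permK.
apply/asboolP; exists y => // i i_n fi; apply: Hy => //.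
by rewrite !permK val_succ.
Qed.

Definition order_signs f pi : seq bool :=
  [seq ((pi^-1)%g e.1 < (pi^-1)%g e.2)%N | e <- mono_edges f].

Lemma mono_edgesP f (e : 'I_n.+1 * 'I_n.+1) :
  (e \in mono_edges f) = (e.1 < e.2)%N && (f e.1 == f e.2).
Proof. by rewrite mem_filter mem_enum andbT. Qed.

Lemma uniq_mono_edges f : uniq (mono_edges f).
Proof. by rewrite filter_uniq // enum_uniq. Qed.

Lemma signs_ok_map y s (b : 'I_n.+1 * 'I_n.+1 -> bool) :
  signs_ok y (map edge_form s) (map b s) =
  all (fun e => has_sign (b e) (y 0 e.1 - y 0 e.2)) s.
Proof. by elim: s => //= e s <-; rewrite form_edge. Qed.

(** The relative order of elements of different colours is forced, and that of
    elements of equal colour is the sign of the corresponding edge. *)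
Lemma order_signs_inj M f : {in listings M f &, injective (order_signs f)}.
Proof.
move=> pi pi' /listingsP[mono _] /listingsP[mono' _] /eq_in_map H.
suff E : (pi^-1 = pi'^-1)%g by apply: invg_inj.
apply: perm_order_inj => a b.
have [fab|fab|fab] := ltngtP (f a) (f b); first by rewrite mono ?mono'.
  by have := mono _ _ fab; have := mono' _ _ fab; lia.
have {}fab : f a == f b by apply/eqP/val_inj.
have [ab|ab|/val_inj ->] := ltngtP a b; last by rewrite !ltnn.
  by apply: (H (a, b)); rewrite mono_edgesP /= ab.
have : (b, a) \in mono_edges f by rewrite mono_edgesP /= ab eq_sym.
move/H => /= E.
have ne (s : 'S_n.+1) : s a != s b by rewrite (inj_eq perm_inj) neq_ltn ab orbT.
have [] := (ne (pi^-1)%g, ne (pi'^-1)%g); rewrite -!val_eqE /= !neq_ltn.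
by move: E; lia.
Qed.

(** A realized sign vector comes from some [y], and sorting by colour and then
    by decreasing [y] gives the only listing with these signs. *)
Lemma card_listings M f :
  #|listings M f| = num_realizable M (map edge_form (mono_edges f)).
Proof.
rewrite /num_realizable -size_filter cardE -(size_map (order_signs f)).
apply/perm_size/uniq_perm; first 1 last.
- exact/filter_uniq/uniq_all_signs.
- move=> t; rewrite mem_filter mem_all_signs size_map.
  apply/mapP/andP => [[pi pi_f ->]|[/asboolP[y yM ys] /eqP st]].
    rewrite mem_enum in pi_f; rewrite size_map; split=> //; apply/asboolP.
    have [_ [y yM Hy]] := listingsP _ _ _ pi_f; exists y => //.
    rewrite signs_ok_map; apply/allP => e; rewrite mono_edgesP => /andP[e12 /eqP fe].
    rewrite /has_sign; case: ifP => /= H; rewrite ?subr_gt0 ?subr_lt0; first exact: Hy.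
    apply: Hy => //; move/negbT: H; rewrite -leqNgt leq_eqVlt => /orP[|//].
    by move=> /eqP/val_inj/perm_inj e21; rewrite e21 ltnn in e12.
  pose b e := nth false t (index e (mono_edges f)).
  have tE : t = map b (mono_edges f).
    apply: (@eq_from_nth _ false) => [|i it]; first by rewrite size_map.
    rewrite (nth_map (ord0, ord0)) -?st // /b index_uniq -?st //.
    exact: uniq_mono_edges.
  move: ys; rewrite tE signs_ok_map => /allP ys.
  (* colours increase, and inside a colour [y] decreases *)
  pose lt a c := (f a < f c)%N || (f a == f c) && (y 0 c < y 0 a).
  have irr : irreflexive lt by move=> a; rewrite /lt ltnn eqxx ltxx.
  have tr : transitive lt.
    move=> a c e /orP[h1|/andP[/eqP h1 h1']] /orP[h2|/andP[/eqP h2 h2']]; apply/orP.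
    - by left; exact: ltn_trans h1 h2.
    - by left; rewrite -h2.
    - by left; rewrite h1.
    - by right; rewrite h1 h2 eqxx (lt_trans h2').
  have ne (a c : 'I_n.+1) : (a < c)%N -> f a = f c -> y 0 a != y 0 c.
    move=> ac fac; have := ys (a, c); rewrite mono_edgesP /= ac fac eqxx.
    move=> /(_ isT); rewrite neq_lt; case: (b _) => /=.
      by rewrite subr_gt0 => ->; rewrite orbT.
    by rewrite subr_lt0 => ->.
  have tot (a c : 'I_n.+1) : a != c -> lt a c || lt c a.
    rewrite /lt => ac; have [_|_|/val_inj fac] := ltngtP (f a) (f c);
      rewrite ?orbT //.
    rewrite fac eqxx /=; rewrite -val_eqE neq_ltn in ac; case/orP: ac => ac.
      by have := ne _ _ ac fac; rewrite neq_lt orbC.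
    by have := ne _ _ ac (esym fac); rewrite neq_lt.
  have [rho rhoP] := perm_of_order irr tr tot.
  exists (rho^-1)%g.
    rewrite mem_enum; apply/listingsP; rewrite invgK; split=> [a c ac|].
      by rewrite rhoP /lt ac.
    exists y => // a c fac; rewrite rhoP /lt fac ltnn eqxx //.
  apply/esym/eq_in_map => e e_f; rewrite invgK rhoP /lt.
  move: (e_f); rewrite mono_edgesP => /andP[_ /eqP ->]; rewrite ltnn eqxx /=.
  have := ys e e_f; case: (b e) => /=; first by rewrite subr_gt0.
  by rewrite subr_lt0 => /ltW; rewrite leNgt => /negbTE.
- rewrite map_inj_in_uniq ?enum_uniq // => pi pi'; rewrite !mem_enum.
  exact: order_signs_inj.
Qed.

End Regions.

(** * Ranks in general position *)

(** A down-closed set of an order is an initial segment, so its size tells which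
    elements it contains. *)
Lemma perm_downset n (s : 'S_n) (D : {set 'I_n}) a :
  (forall b c, c \in D -> (s b < s c)%N -> b \in D) -> (s a < #|D|)%N = (a \in D).
Proof.
move=> down; apply/idP/idP => [|aD].
  apply: contraLR => aD; rewrite -leqNgt -card_perm_before.
  apply/subset_leq_card/fintype.subsetP => b bD; rewrite inE ltn_neqAle.
  rewrite leqNgt (contra (down _ _ bD) aD) andbT.
  by apply: contraNneq aD => /val_inj/perm_inj <-.
rewrite -card_perm_before; apply/proper_card/fintype.properP; split.
  by apply/fintype.subsetP => b; rewrite inE; exact: down.
by exists a; rewrite ?inE ?ltnn.
Qed.

Lemma subset_of_card (T : finType) (B : {set T}) r : (r <= #|B|)%N ->
  exists2 A : {set T}, A \subset B & #|A| = r.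
Proof.
move=> rB; exists [set x in take r (enum B)].
  by apply/fintype.subsetP => x; rewrite inE => /mem_take; rewrite mem_enum.
rewrite cardsE; move/card_uniqP: (take_uniq r (enum_uniq (mem B))) => ->.
by rewrite size_takel // -cardE.
Qed.

(** A set of size [d] comparable with [T] for inclusion. *)
Lemma comparable_subset n (T : {set 'I_n}) d : (d <= n)%N ->
  exists2 T' : {set 'I_n}, #|T'| = d & #|T :&: T'| = minn #|T| d.
Proof.
move=> dn; have [dT|Td] := leqP d #|T|.
  have [A AT A_d] := subset_of_card dT; exists A => //.
  by rewrite (finset.setIidPr AT) A_d; lia.
have [|A AT A_d] := @subset_of_card _ (~: T) (d - #|T|).
  by have := cardsC T; rewrite card_ord; lia.
exists (T :|: A).
  rewrite cardsU A_d (_ : T :&: A = finset.set0) ?cards0; first by lia.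
  by apply/eqP; rewrite -finset.subset0 -(finset.setICr T) finset.setIS.
by rewrite finset.setIUr finset.setIid (finset.setUidPl (finset.subsetIl _ _)); lia.
Qed.

Lemma enum_increasing n (A : {set 'I_n}) (x0 : 'I_n) i j : (i < j < #|A|)%N ->
  (nth x0 (enum A) i < nth x0 (enum A) j)%N.
Proof.
case/andP=> ij jA.
have srt : sorted ltn [seq val i | i <- enum A].
  rewrite sorted_map /enum_mem; apply: sorted_filter => [a b c /= |]; first exact: ltn_trans.
  by rewrite -sorted_map -enumT val_enum_ord iota_ltn_sorted.
have nthE l : (l < #|A|)%N -> val (nth x0 (enum A) l) = nth 0 [seq val i | i <- enum A] l.
  by move=> lA; rewrite (nth_map x0) // -cardE.
rewrite -[X in (X < _)%N]/(val _) -[X in (_ < X)%N]/(val _) !nthE ?(ltn_trans ij) //.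
by apply: (sorted_ltn_nth ltn_trans) => //; rewrite ?inE size_map -cardE // (ltn_trans ij).
Qed.

Section Generic.
Variables (R : realFieldType) (m d : nat).
Variable (xi : 'I_m -> 'rV[R]_d).

Definition psum (s : 'S_m) (i : nat) : 'rV[R]_d := \sum_(j < m | (j < i)%N) xi (s j).

Definition generic := forall (s : 'S_m) (i : 'I_d -> nat),
  (forall j, (1 <= i j <= m)%N) ->
  (forall j j' : 'I_d, (j < j')%N -> (i j < i j')%N) ->
  free [seq psum s (i j) | j : 'I_d].

(** The steps, preceded by the step that closes the walk: a cyclic sequence
    with sum zero, on which rotations act. *)
Definition closed_mx : 'M[R]_(m.+1, d) :=
  \matrix_(a < m.+1) (if unlift ord0 a is Some j then xi j else - \sum_j xi j).

Lemma closed_mx0 : row ord0 closed_mx = - \sum_j xi j.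
Proof. by rewrite rowK unlift_none. Qed.

Lemma closed_mx_lift j : row (lift ord0 j) closed_mx = xi j.
Proof. by rewrite rowK liftK. Qed.

Lemma sum_closed_mx : \sum_a row a closed_mx = 0.
Proof.
rewrite big_ord_recl closed_mx0; apply/eqP; rewrite addrC subr_eq0; apply/eqP.
by apply: eq_bigr => j _; rewrite closed_mx_lift.
Qed.

Hypotheses (gen : generic) (dm : (d <= m)%N).

(** Any [d] partial sums of the same order are independent, hence so are fewer,
    and more of them span the whole space.  To see both at once, [T] is compared
    with a set [T'] of exactly [d] times. *)
Lemma rank_psums (s : 'S_m) p (Y : 'M[R]_(p, d)) (T : {set 'I_m}) :
  (forall t : 'I_m, t \in T -> (psum s t.+1 <= Y)%MS) ->
  (minn #|T| d <= \rank Y)%N.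
Proof.
move=> TY.
have [->|T0] := eqVneq T finset.set0; first by rewrite cards0 min0n.
have [t0 _] := finset.set0Pn _ T0.
have [T' T'd <-] := comparable_subset T dm.
pose i (j : 'I_d) := (nth t0 (enum T') j).
pose Z : 'M[R]_d := \matrix_j psum s (i j).+1.
have Zfree : row_free Z.
  have := @gen s (fun j => (i j).+1).
  move=> /(_ (fun j => ltn_ord _)) /(_ _)/[dup] /(_ _) F _.
  have {}F : free [seq psum s (i j).+1 | j : 'I_d].
    by apply: F => j j' jj'; rewrite ltnS enum_increasing // jj' T'd ltn_ord.
  apply: inj_row_free => v vZ.
  have sz : size [seq psum s (i j).+1 | j : 'I_d] == d.
    by rewrite size_map -cardE card_ord.
  have /freeP/(_ (fun j => v 0 j)) H : free (Tuple sz) by [].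
  apply/rowP => j; rewrite mxE; apply: H; rewrite -[RHS]vZ mulmx_sum_row.
  apply: eq_bigr => l _; rewrite rowK /= (nth_map l) -?cardE ?card_ord //.
  by rewrite nth_ord_enum.
pose J := [set j : 'I_d | i j \in T].
have <- : #|J| = #|T :&: T'|.
  have inj : injective i.
    move=> j j' /eqP; rewrite /i nth_uniq -?cardE ?T'd ?enum_uniq //.
    by move/eqP/val_inj.
  rewrite -(card_imset _ inj); apply: eq_card => t; rewrite inE.
  apply/imsetP/andP => [[j]|[tT tT']].
    rewrite inE => jT ->; split => //.
    by rewrite -mem_enum mem_nth // -cardE T'd.
  have tl : (index t (enum T') < d)%N by rewrite -T'd cardE index_mem mem_enum.
  have ti : t = i (Ordinal tl) by rewrite /i nth_index ?mem_enum.
  by exists (Ordinal tl); rewrite ?inE -?ti.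
pose Pm : 'M[R]_(#|J|, d) := \matrix_(a, j) (enum_val a == j)%:R.
have Pfree : row_free Pm.
  apply/row_freeP; exists Pm^T; apply/matrixP => a b; rewrite !mxE.
  rewrite (bigD1 (enum_val a)) //= !mxE eqxx mul1r big1 => [|j /negPf aj].
    by rewrite addr0 (inj_eq enum_val_inj) eq_sym.
  by rewrite !mxE eq_sym aj mul0r.
rewrite -(eqP Pfree) -(mxrankMfree Pm Zfree); apply/mxrankS/row_subP => a.
rewrite row_mul.
have -> : row a Pm = delta_mx 0 (enum_val a).
  by apply/rowP => j; rewrite !mxE eq_sym eqxx.
rewrite -rowE rowK; apply: TY.
by have := enum_valP a; rewrite inE.
Qed.

(** Left multiplication by this matrix adds up the rows of each class. *)
Definition class_mx c (kappa : 'I_m.+1 -> 'I_c) : 'M[R]_(c, m.+1) :=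
  \matrix_(i, a) (kappa a == i)%:R.

Lemma class_sum c (kappa : 'I_m.+1 -> 'I_c) i :
  row i (class_mx kappa *m closed_mx) =
  \sum_(a | kappa a == i) row a closed_mx.
Proof.
rewrite row_mul mulmx_sum_row [RHS]big_mkcond; apply: eq_bigr => a _.
by rewrite !mxE; case: eqP => _; rewrite ?scale1r ?scale0r.
Qed.

(** The sums over the classes have sum zero, which bounds the rank by [c - 1].
    For the lower bound, order the steps so that classes come one after another,
    the class of the closing step last: then the sums over the first classes are
    partial sums of the walk in this order. *)
Lemma rank_class_sums c (kappa : 'I_m.+1 -> 'I_c) :
  (forall i, exists a, kappa a = i) ->
  \rank (class_mx kappa *m closed_mx) = minn c.-1 d.
Proof.
move=> surj; set Y := _ *m _; set i0 := kappa ord0.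
have c0 : (0 < c)%N by apply: leq_ltn_trans (ltn_ord i0).
apply/eqP; rewrite eqn_leq leq_min rank_leq_col andbT; apply/andP; split.
  rewrite -ltnS prednK // ltn_neqAle rank_leq_row andbT.
  apply: contraTneq (ltr01 : (0 : R) < 1) => /eqP Yfree.
  have : (const_mx 1 : 'rV[R]_c) *m Y == 0.
    rewrite mulmx_sum_row -[X in _ == X]sum_closed_mx; apply/eqP.
    rewrite [RHS](partition_big kappa xpredT) //=; apply: eq_bigr => i _.
    by rewrite mxE scale1r class_sum.
  by rewrite mulmx_free_eq0 // => /eqP/rowP/(_ i0); rewrite !mxE => ->; rewrite ltxx.
(* the class of the closing step gets the largest key *)
pose key (j : 'I_m) : nat := if kappa (lift ord0 j) == i0 then c
                             else kappa (lift ord0 j).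
pose lt j j' := (key j < key j')%N || (key j == key j') && (j < j')%N.
have irr : irreflexive lt by move=> a; rewrite /lt ltnn eqxx ltnn.
have tr : transitive lt by move=> a b e; rewrite /lt; lia.
have tot a b : a != b -> lt a b || lt b a.
  by rewrite -val_eqE /lt /=; lia.
have [rho rhoP] := perm_of_order irr tr tot.
(* the steps in the classes up to [i], an initial segment of the order *)
pose D (i : 'I_c) := [set j | (key j <= i)%N].
have rhoD i a : (rho a < #|D i|)%N = (a \in D i).
  apply: perm_downset => b e; rewrite !inE rhoP /lt; lia.
have keyi j (i : 'I_c) : i != i0 -> (key j == i) = (kappa (lift ord0 j) == i).
  move=> ii0; rewrite /key; case: (kappa _ =P i0) => [k0|_] //.
  by rewrite k0 (eq_sym i0) (negPf ii0); have := ltn_ord i; lia.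
have DE i : psum (rho^-1)%g #|D i| = \sum_(j in D i) xi j.
  rewrite /psum (reindex_inj (@perm_inj _ rho)) /=.
  by apply: eq_big => j; rewrite ?rhoD ?permK.
have DY i : (psum (rho^-1)%g #|D i| <= Y)%MS.
  rewrite DE (partition_big (fun j => kappa (lift ord0 j)) xpredT) //=.
  apply: summx_sub => i' _.
  have [->|i'0] := eqVneq i' i0.
    rewrite big_pred0 ?sub0mx // => j; rewrite inE /key; case: (kappa _ =P i0) => [_|]; last by rewrite andbF.
    by have := ltn_ord i; lia.
  have [i'i|ii'] := leqP i' i.
    apply: submx_trans (row_sub i' _); rewrite class_sum [X in (_ <= X)%MS]big_mkcond big_ord_recl.
    rewrite /= -/i0 (eq_sym i0) (negPf i'0) add0r -big_mkcond /= (eq_bigl (fun j => kappa (lift ord0 j) == i')).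
      rewrite (eq_bigr (fun j => row (lift ord0 j) closed_mx)) // => j _.
      by rewrite closed_mx_lift.
    move=> j; rewrite inE -(keyi j i' i'0).
    by case: eqP => [->|]; rewrite ?andbF ?i'i.
  rewrite big_pred0 ?sub0mx // => j; rewrite inE -(keyi j i' i'0).
  by case: eqP => [->|]; rewrite ?andbF // leqNgt ii'.
have Dgt0 i : i != i0 -> (0 < #|D i|)%N.
  move=> ii0; have [a ai] := surj i; rewrite card_gt0; apply/finset.set0Pn.
  case: (unliftP ord0 a) ai => [j ->|-> ai]; last by rewrite -ai eqxx in ii0.
  by move/eqP; rewrite -keyi // => /eqP kj; exists j; rewrite inE kj.
have Dlt i : i != i0 -> (#|D i|.-1 < m)%N.
  by move=> /Dgt0; have := max_card (D i); rewrite card_ord; lia.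
have Dmono (i i' : 'I_c) : i' != i0 -> (i < i')%N -> (#|D i| < #|D i'|)%N.
  move=> i'0 ii'; apply/proper_card/fintype.properP; split.
    by apply/fintype.subsetP => j; rewrite !inE => /leq_trans; apply; exact: ltnW.
  have [a ai] := surj i'.
  case: (unliftP ord0 a) ai => [j ->|-> ai]; last by rewrite -ai eqxx in i'0.
  move/eqP; rewrite -keyi // => /eqP kj; exists j; rewrite inE kj //.
  by rewrite -ltnNge.
have m0 : forall i : 'I_c, i != i0 -> (0 < m)%N.
  by move=> i /Dlt; lia.
have [c1|c1] := leqP c 1.
  by rewrite (_ : c.-1 = 0)%N ?min0n //; lia.
have [i1 i1n] : exists i1 : 'I_c, i1 != i0.
  have [->|] := eqVneq i0 (Ordinal c0); first by exists (Ordinal c1).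
  by exists (Ordinal c0); rewrite eq_sym.
pose t (i : 'I_c) := insubd (Ordinal (Dlt _ i1n)) #|D i|.-1.
have tE i : i != i0 -> (t i).+1 = #|D i|.
  by move=> ii0; rewrite val_insubd Dlt // prednK // Dgt0.
pose T := [set t i | i in [set~ i0]].
have <- : #|T| = c.-1.
  rewrite card_in_imset ?cardsC1 ?card_ord // => i i'; rewrite !inE => ii0 i'0 tt.
  have : #|D i| = #|D i'| by rewrite -!tE // tt.
  by case: (ltngtP i i') => [/(Dmono _ _ i'0)|/(Dmono _ _ ii0)|/val_inj //]; lia.
apply: (@rank_psums (rho^-1)%g) => _ /imsetP[i ii0 ->].
by rewrite !inE in ii0; rewrite tE.
Qed.

(** The linear relations between the steps of the closed walk. *)
Definition flow : 'M[R]_m.+1 := kermx closed_mx.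

Lemma flowP (y : 'rV[R]_m.+1) :
  (y <= flow)%MS <-> \sum_a y 0 a *: row a closed_mx = 0.
Proof.
rewrite -mulmx_sum_row; split=> [/sub_kermxP //|H]; exact/sub_kermxP.
Qed.

(** A vector that is constant on the classes is a relation between the steps
    exactly when its values form a relation between the class sums. *)
Lemma cap_flow_class c (kappa : 'I_m.+1 -> 'I_c) (B : seq ('I_m.+1 * 'I_m.+1)) :
  (forall i, exists a, kappa a = i) ->
  (forall y : 'I_m.+1 -> R, (forall e, e \in B -> y e.1 = y e.2) <->
    (forall a b, kappa a = kappa b -> y a = y b)) ->
  (cap_kernels flow (map (@edge_form R m) B) :=: kermx (class_mx kappa *m closed_mx) *m class_mx kappa)%MS.
Proof.
move=> surj kB; apply/eqmxP/rV_eqP => y; apply/sub_cap_kernelsP/idP => [[yM yB]|].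
  have yk : forall a b, kappa a = kappa b -> y 0 a = y 0 b.
    apply: (kB (fun a => y 0 a)).1 => e eB; apply/eqP; rewrite -subr_eq0 -form_edge.
    by apply/eqP/yB/map_f.
  have sel i : {a | kappa a = i} by apply: cid; exact: surj.
  have yE : y = (\row_i y 0 (sval (sel i))) *m class_mx kappa.
    apply/rowP => a; rewrite !mxE (bigD1 (kappa a)) //= !mxE eqxx mulr1 big1.
      by rewrite addr0; apply: yk; case: sel.
    by move=> i /negPf ia; rewrite !mxE eq_sym ia mulr0.
  rewrite yE submxMr //; apply/sub_kermxP; rewrite mulmxA -yE.
  exact/sub_kermxP.
case/submxP => z ->; rewrite mulmxA; set w := z *m _.
have wk : w *m (class_mx kappa *m closed_mx) = 0.
  by rewrite -mulmxA mulmx_ker mulmx0.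
split; first by apply/sub_kermxP; rewrite -mulmxA.
move=> _ /mapP[e eB ->]; rewrite form_edge; apply/eqP; rewrite subr_eq0; apply/eqP.
apply: (kB (fun a => (w *m class_mx kappa) 0 a)).2 e eB => a b ab.
by rewrite !mxE; apply: eq_bigr => i _; rewrite !mxE ab.
Qed.

Lemma class_mx_free c (kappa : 'I_m.+1 -> 'I_c) :
  (forall i, exists a, kappa a = i) -> row_free (class_mx kappa).
Proof.
move=> surj; apply: inj_row_free => v vK; apply/rowP => i.
have [a <-] := surj i; move/rowP/(_ a): vK; rewrite !mxE (bigD1 (kappa a)) //=.
rewrite !mxE eqxx mulr1 big1 ?addr0 // => i' /negPf ia.
by rewrite !mxE eq_sym ia mulr0.
Qed.

(** The class sums span a space of dimension [min (c - 1, d)], where [c] is the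
    number of components: only the number of components of [B] matters. *)
Lemma rank_cap_flow (B : seq ('I_m.+1 * 'I_m.+1)) :
  \rank (cap_kernels flow (map (@edge_form R m) B)) = maxn 1 (num_components B - d).
Proof.
have [kappa surj kB] := num_componentsP B.
rewrite (cap_flow_class surj (kB R)) mxrankMfree ?class_mx_free //.
rewrite mxrank_ker rank_class_sums //.
have := ltn_ord (kappa ord0); lia.
Qed.

Lemma rank_flow : \rank flow = (m.+1 - d)%N.
Proof.
rewrite mxrank_ker -(mul1mx closed_mx).
have := @rank_class_sums m.+1 id (fun i => ex_intro _ i erefl).
rewrite (_ : class_mx id = 1%:M) ?mul1mx => [->|]; first by rewrite /=; lia.
by apply/matrixP => i j; rewrite !mxE eq_sym.
Qed.

End Generic.

(** * Cutting and rotating the closed walk *)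

Section Arcs.
Variable n : nat.
Implicit Types (I : {set 'I_n.+1}) (i j : 'I_n.+1).

Lemma succ_max : succ (ord_max : 'I_n.+1) = ord0.
Proof. by apply: val_inj; rewrite /= modnn. Qed.

Lemma succ_add i : succ i = i + inZp 1.
Proof. by apply: val_inj; rewrite /= modnDmr addn1. Qed.

Lemma succ_inj : injective (@succ n).
Proof. by move=> i j; rewrite !succ_add => /addIr. Qed.

Lemma ltn_max i : (i != ord_max) = (i < n)%N.
Proof. by rewrite -val_eqE /= ltn_neqAle -ltnS ltn_ord andbT. Qed.

(** Cutting the sequence [0, ..., n] behind each element of [I] produces arcs;
    this is the number of the arc that contains [j]. *)
Definition arc_index I (j : nat) : nat := #|[set i in I | (i < j)%N]|.

Lemma arc_indexS I j : arc_index I j.+1 = (arc_index I j + (j \in I))%N.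
Proof.
rewrite /arc_index.
have -> : [set i in I | (i < j.+1)%N] =
    [set i in I | (i < j)%N] :|: (if j \in I then [set j] else finset.set0).
  apply/setP => i; rewrite !inE ltnS leq_eqVlt; case: ifP => jI; rewrite !inE.
    by rewrite val_eqE; case: eqP => [->|_]; rewrite ?jI ?orbT ?orbF ?ltnn.
  rewrite orbF; case: eqP => [/val_inj ->|//]; by rewrite jI.
rewrite cardsU; have -> : [set i in I | (i < j)%N] :&:
    (if j \in I then [set j] else finset.set0) = finset.set0.
  apply/setP => i; rewrite !inE; case: ifP => _; rewrite !inE ?andbF //.
  by case: eqP => [->|_]; rewrite ?ltnn ?andbF.
by rewrite cards0 subn0; case: ifP; rewrite ?cards1 ?cards0.
Qed.

Lemma arc_index0 I : arc_index I 0 = 0%N.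
Proof. by apply: eq_card0 => i; rewrite !inE andbF. Qed.

Lemma arc_index_homo I (i j : nat) : (i <= j)%N -> (arc_index I i <= arc_index I j)%N.
Proof.
move=> ij; apply/subset_leq_card/fintype.subsetP => l; rewrite !inE.
by case/andP=> -> /leq_trans; apply.
Qed.

Lemma arc_index_lt I i : i \in I -> (arc_index I i < #|I|)%N.
Proof.
move=> iI; apply/proper_card/fintype.properP; split.
  by apply/fintype.subsetP => j; rewrite inE => /andP[].
by exists i; rewrite ?inE ?ltnn ?andbF.
Qed.

Lemma arc_index_inj I : {in I &, injective (fun i => arc_index I i)}.
Proof.
have H (i j : 'I_n.+1) : i \in I -> (i < j)%N -> (arc_index I i < arc_index I j)%N.
  move=> iI ij; apply: leq_trans (arc_index_homo I ij).
  by rewrite arc_indexS iI addn1.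
move=> i j iI jI e; have [ij|ji|/val_inj //] := ltngtP i j.
  by have := H _ _ iI ij; rewrite e ltnn.
by have := H _ _ jI ji; rewrite e ltnn.
Qed.

Lemma arc_index_surj I (v : 'I_#|I|) : exists2 i, i \in I & arc_index I i = v.
Proof.
pose g i : 'I_#|I| := insubd v (arc_index I i).
have gE i : i \in I -> val (g i) = arc_index I i.
  by move=> iI; rewrite val_insubd arc_index_lt.
have ginj : {in I &, injective g}.
  by move=> i j iI jI /(congr1 val); rewrite !gE //; exact: arc_index_inj.
have /eqP gT : g @: I == [set: 'I_#|I|].
  by rewrite eqEcard finset.subsetT card_in_imset // cardsT card_ord leqnn.
have : v \in g @: I by rewrite gT inE.
by case/imsetP => i iI ->; exists i; rewrite ?gE.
Qed.

Lemma arc_index_full I : arc_index I n.+1 = #|I|.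
Proof. by apply: eq_card => i; rewrite !inE ltn_ord andbT. Qed.

(** Around the circle the piece behind the last cut and the piece before the
    first one form a single arc, so that there are [#|I|] of them. *)
Lemma cyclic_arcs I : I != finset.set0 ->
  exists2 c : 'I_n.+1 -> 'I_#|I|, (forall v, exists j, c j = v) &
    forall j, j \notin I -> c (succ j) = c j.
Proof.
rewrite -card_gt0 => I0.
exists (fun j => Ordinal (ltn_pmod (arc_index I j) I0)) => [v|j jI].
  have [i iI iv] := arc_index_surj v; exists i.
  by apply: val_inj; rewrite /= iv modn_small.
apply: val_inj => /=; have [jm|jm] := eqVneq j ord_max.
  have := arc_indexS I ord_max; rewrite arc_index_full -jm (negPf jI) addn0 => <-.
  by rewrite jm modnn arc_index0 mod0n modnn.
rewrite (@modn_small j.+1) ?arc_indexS ?(negPf jI) ?addn0 //.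
by rewrite ltnS -ltn_max.
Qed.

Section Linear.
Variable k : nat.
Implicit Types c : 'I_n.+1 -> 'I_k.

Definition mono_surj c := (forall i j, (i <= j)%N -> (c i <= c j)%N) /\
  (forall v, exists j, c j = v).

(** The ends of the runs on which [c] is constant. *)
Definition cuts c := [set i | (i == ord_max) || (c i != c (succ i))].

(** A monotone surjection increases by one behind each cut and nowhere else. *)
Lemma mono_surj_index c : mono_surj c -> forall j, c j = arc_index (cuts c) j :> nat.
Proof.
case=> mono surj [j jn]; elim: j jn => [|j IH] jn.
  rewrite arc_index0; apply/eqP; rewrite -leqn0.
  have k0 : (0 < k)%N by apply: leq_ltn_trans (ltn_ord (c ord0)).
  have [a ca] := surj (Ordinal k0).
  by rewrite -[X in (_ <= X)%N]/(val (Ordinal k0)) -ca mono.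
have jn' : (j < n.+1)%N by apply: ltn_trans jn.
have sj : succ (Ordinal jn') = Ordinal jn by apply: val_inj; rewrite /= modn_small.
have /= -> := arc_indexS (cuts c) (Ordinal jn'); rewrite -(IH jn') inE sj.
rewrite (negPf (_ : Ordinal jn' != ord_max)) ?ltn_max //=.
have le := mono (Ordinal jn') (Ordinal jn) (leqnSn _).
case: eqP => [->|ne]; first by rewrite addn0.
rewrite addn1; apply/eqP; rewrite eqn_leq andbC; apply/andP; split.
  by rewrite ltn_neqAle le andbT; apply/eqP => /val_inj.
rewrite leqNgt; apply/negP => lt2.
have vk : ((c (Ordinal jn')).+1 < k)%N by apply: ltn_trans lt2 _.
have [a ca] := surj (Ordinal vk); have {}ca := congr1 val ca; rewrite /= in ca.
have [aj|ja] := leqP a j.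
  by have := mono a (Ordinal jn') aj; rewrite ca ltnn.
by have := mono (Ordinal jn) a ja; rewrite ca leqNgt lt2.
Qed.

Lemma cuts_max c : ord_max \in cuts c.
Proof. by rewrite inE eqxx. Qed.

Lemma card_cuts c : mono_surj c -> #|cuts c| = k.
Proof.
move=> cms; rewrite -arc_index_full; have /= -> := arc_indexS (cuts c) ord_max.
rewrite cuts_max addn1 -[n]/(val (@ord_max n)) -mono_surj_index //.
case: cms => mono surj; have k0 : (0 < k)%N by apply: leq_ltn_trans (ltn_ord (c ord0)).
have k1 : (k.-1 < k)%N by rewrite prednK.
have [a ca] := surj (Ordinal k1); have {}ca := congr1 val ca; rewrite /= in ca.
by have := mono a ord_max (leq_ord _); have := ltn_ord (c ord_max); lia.
Qed.

Lemma cuts_inj c c' : mono_surj c -> mono_surj c' -> cuts c = cuts c' -> c =1 c'.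
Proof.
by move=> cms cms' e j; apply: val_inj; rewrite /= !mono_surj_index // e.
Qed.

End Linear.

Lemma cuts_onto k I : ord_max \in I -> #|I| = k ->
  exists2 c : 'I_n.+1 -> 'I_k, mono_surj c & cuts c = I.
Proof.
move=> mI <-.
have lt j : (arc_index I j < #|I|)%N.
  by apply: leq_ltn_trans (arc_index_lt mI); apply/arc_index_homo/leq_ord.
exists (fun j => Ordinal (lt j)); first split=> [i j ij|v].
- exact: arc_index_homo.
- by have [i _ iv] := arc_index_surj v; exists i; apply: val_inj.
apply/setP => i; rewrite inE; have [->|im] := eqVneq i ord_max => //=.
rewrite -val_eqE /= (@modn_small i.+1) ?arc_indexS; last by rewrite ltnS -ltn_max.
by case: (i \in I); rewrite ?addn0 ?eqxx // addn1 neq_ltn ltnSn.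
Qed.

End Arcs.

Section Count.
Variables (R : realFieldType) (n k : nat) (M : 'M[R]_n.+1).
Implicit Types (pi : 'S_n.+1) (I : {set 'I_n.+1}).

(** Some vector of [M], read along [pi] around the circle, decreases at every
    step that does not start in [I]. *)
Definition descends pi I := `[< exists2 y : 'rV[R]_n.+1, (y <= M)%MS &
   forall i, i \notin I -> y 0 (pi (succ i)) < y 0 (pi i) >].

(** Monotone surjections correspond to sets of cuts containing the last index,
    so a colouring together with a listing is an order with a set of cuts. *)
Lemma sum_listings :
  (\sum_(f : {ffun 'I_n.+1 -> 'I_k} | surjectiveb f) #|listings M f| =
   \sum_pi \sum_(I : {set 'I_n.+1} | (ord_max \in I) && (#|I| == k)) descends pi I)%N.
Proof.
rewrite (eq_bigr _ (fun f _ => esym (sum1_card (mem (listings M f))))).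
under eq_bigr do rewrite big_mkcond.
rewrite exchange_big /=; apply: eq_bigr => pi _.
rewrite -!big_mkcondr !sum1dep_card /=.
pose h (f : {ffun 'I_n.+1 -> 'I_k}) := cuts (fun i => f (pi i)).
have msP (f : {ffun 'I_n.+1 -> 'I_k}) : surjectiveb f -> pi \in listings M f ->
    mono_surj (fun i => f (pi i)).
  rewrite inE => /forallP surj /andP[/forallP mono _]; split=> [i j|v].
    by have /forallP/(_ j)/implyP := mono i.
  by have /existsP[a /eqP <-] := surj v; exists ((pi^-1)%g a); rewrite permKV.
have hinj : {in [set f | surjectiveb f & pi \in listings M f] &, injective h}.
  move=> f f'; rewrite !inE => /andP[s1 l1] /andP[s2 l2].
  move=> /(cuts_inj (msP _ s1 _) (msP _ s2 _)); rewrite !inE => /(_ l1 l2) H.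
  by apply/ffunP => a; have := H ((pi^-1)%g a); rewrite permKV.
have descP (f : {ffun 'I_n.+1 -> 'I_k}) (y : 'rV[R]_n.+1) :
    (forall i : 'I_n.+1, (i < n)%N ->
          f (pi i) = f (pi (succ i)) -> y 0 (pi (succ i)) < y 0 (pi i)) <->
    (forall i, i \notin h f -> y 0 (pi (succ i)) < y 0 (pi i)).
  split=> H i; last first.
    move=> i_n fi; apply: H; rewrite inE negb_or ltn_max i_n /=.
    by rewrite negbK fi.
  by rewrite inE negb_or ltn_max negbK => /andP[i_n /eqP]; exact: H.
rewrite -(card_in_imset hinj); apply: eq_card => I; rewrite !inE.
apply/imsetP/andP => [[f]|[/andP[mI /eqP Ik] /asboolP[y yM Hy]]].
  rewrite inE => /andP[sf lf ->].
  rewrite cuts_max card_cuts ?eqxx; last exact: msP.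
  split=> //; move: lf; rewrite inE => /andP[_ /asboolP[y yM Hy]].
  by apply/asboolP; exists y => //; apply/descP.
have [c [mono surj] cI] := cuts_onto mI Ik.
exists [ffun a => c ((pi^-1)%g a)]; last first.
  by rewrite -cI; apply/setP => i; rewrite !inE !ffunE !permK.
have sf : surjectiveb [ffun a => c ((pi^-1)%g a)].
  apply/forallP => v; have [j <-] := surj v; apply/existsP; exists (pi j).
  by rewrite ffunE permK.
rewrite !inE sf /=; apply/andP; split.
  apply/forallP => i; apply/forallP => j; apply/implyP => ij.
  by rewrite !ffunE !permK mono.
apply/asboolP; exists y => //; apply/descP => i iI; apply: Hy.
by apply: contra iI; rewrite -cI !inE !ffunE !permK.
Qed.

(** The rotation of the circle that takes [ord_max] to [i]. *)
Definition rotation (i : 'I_n.+1) : 'S_n.+1 := perm (addIr (succ i)).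

Lemma rotationE i x : rotation i x = x + succ i.
Proof. by rewrite permE. Qed.

Lemma descends_rotation i pi I :
  descends (rotation i * pi)%g I = descends pi (rotation i @: I).
Proof.
have ss x : rotation i (succ x) = succ (rotation i x).
  by rewrite !rotationE !succ_add addrAC.
apply/asboolP/asboolP => -[y yM Hy]; exists y => // x.
  have -> : x = rotation i ((rotation i)^-1%g x) by rewrite permKV.
  rewrite mem_imset; last exact: perm_inj.
  by move/Hy; rewrite !permM ss.
move=> xI; rewrite !permM ss; apply: Hy.
by rewrite mem_imset //; exact: perm_inj.
Qed.

(** Each permutation is, in a unique way, a rotation followed by a permutation
    that fixes [ord0]. *)
Lemma rotation_sum (F : 'S_n.+1 -> nat) :
  (\sum_pi F pi = \sum_i \sum_(pi : 'S_n.+1 | pi ord0 == ord0) F (rotation i * pi)%g)%N.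
Proof.
have r0 i (p : 'I_n.+1) : (rotation i p == ord0) = (i == - p - inZp 1).
  rewrite rotationE succ_add addrA -[X in _ == X]/(0 : 'I_n.+1).
  apply/eqP/eqP => [/eqP|->]; last first.
    by rewrite addrA addrN sub0r addNr.
  by rewrite -addrA addrCA addr_eq0 => /eqP ->; rewrite opprD.
rewrite (partition_big (fun pi => - (pi^-1)%g ord0 - inZp 1) xpredT) //=.
apply: eq_bigr => i _; rewrite (reindex_inj (mulgI (rotation i))) /=.
apply: eq_bigl => pi; rewrite eq_sym -r0 invMg permM permKV.
by rewrite -[RHS](inj_eq (@perm_inj _ pi^-1%g)) permK eq_sym.
Qed.

(** Double counting of rotations: a set [I] of size [k] has [k] rotations that
    bring one of its elements to [ord_max], and [descends] is invariant under
    rotating the order and the set at the same time. *)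
Lemma sum_rotations :
  (k * \sum_(pi : 'S_n.+1 | pi ord0 == ord0)
         \sum_(I : {set 'I_n.+1} | #|I| == k) descends pi I =
   \sum_pi \sum_(I : {set 'I_n.+1} | (ord_max \in I) && (#|I| == k)) descends pi I)%N.
Proof.
rewrite rotation_sum [RHS]exchange_big /= big_distrr /=; apply: eq_bigr => pi _.
rewrite big_distrr /=.
transitivity (\sum_(I : {set 'I_n.+1} | #|I| == k) \sum_(i in I) descends pi I)%N.
  by apply: eq_bigr => I /eqP Ik; rewrite sum_nat_const Ik.
rewrite (exchange_big_dep xpredT) //=; apply: eq_bigr => i _.
rewrite [LHS](reindex (fun I : {set 'I_n.+1} => rotation i @: I)) /=; last first.
  exists (fun I => rotation i @^-1: I) => I _.
    by apply/setP => x; rewrite inE mem_imset //; exact: perm_inj.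
  apply/setP => x; have -> : x = rotation i ((rotation i)^-1%g x) by rewrite permKV.
  by rewrite mem_imset ?inE //; exact: perm_inj.
have ri : i = rotation i ord_max.
  by rewrite rotationE addrC succ_add -addrA [inZp 1 + _]addrC -succ_add succ_max addr0.
apply: eq_big => I; last by rewrite descends_rotation.
rewrite andbC card_imset; last exact: perm_inj.
by rewrite [X in X \in _]ri mem_imset //; exact: perm_inj.
Qed.

Definition unlift0_fun (pi : 'S_n.+1) : {ffun 'I_n -> 'I_n} :=
  [ffun j : 'I_n => odflt j (unlift ord0 (pi (lift ord0 j)))].

Lemma unlift0_funE pi : pi ord0 == ord0 ->
  forall j, lift ord0 (unlift0_fun pi j) = pi (lift ord0 j).
Proof.
move=> /eqP p0 j; rewrite ffunE.
case: (unliftP ord0 (pi (lift ord0 j))) => [j' -> //|e].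
have : pi (lift ord0 j) = pi ord0 by rewrite p0.
by move/perm_inj => /eqP; rewrite eq_sym (negPf (neq_lift _ _)).
Qed.

(** Permutations of the closed walk that fix the closing step are permutations
    of the steps. *)
Lemma reindex_lift0 (F : 'S_n.+1 -> nat) :
  (\sum_(pi : 'S_n.+1 | pi ord0 == ord0) F pi =
   \sum_(s : 'S_n) F (lift_perm ord0 ord0 s))%N.
Proof.
rewrite (reindex_onto (fun s : 'S_n => lift_perm ord0 ord0 s)
  (fun pi : 'S_n.+1 => insubd (1%g : 'S_n) (unlift0_fun pi))) /=.
  apply: eq_bigl => s; rewrite lift_perm_id eqxx /=; apply/eqP.
  have -> : unlift0_fun (lift_perm ord0 ord0 s) = val s.
    apply/ffunP => l; apply: (@lift_inj _ ord0).
    by rewrite unlift0_funE ?lift_perm_id // lift_perm_lift /= pvalE.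
  by rewrite valKd.
move=> pi p0; set s := insubd _ _.
have sE j : lift ord0 (s j) = pi (lift ord0 j).
  have inj : injectiveb (unlift0_fun pi).
    apply/injectiveP => a b e; apply: (@lift_inj _ ord0); apply: (@perm_inj _ pi).
    by rewrite -!unlift0_funE // e.
  by rewrite -pvalE -[pval s]/(val s) val_insubd inj unlift0_funE.
apply/permP => a; case: (unliftP ord0 a) => [j ->|->].
  by rewrite lift_perm_lift sE.
by rewrite lift_perm_id (eqP p0).
Qed.

Lemma sum_descends :
  (k * \sum_(s : 'S_n) \sum_(I : {set 'I_n.+1} | #|I| == k)
          descends (lift_perm ord0 ord0 s) I =
   \sum_(f : {ffun 'I_n.+1 -> 'I_k} | surjectiveb f) #|listings M f|)%N.
Proof. by rewrite sum_listings -sum_rotations reindex_lift0. Qed.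

End Count.

(** * Faces and decreasing relations *)

(** A hyperplane supports the points [p] and touches exactly those of [I]. *)
Definition face_at (R : realFieldType) (d n : nat) (p : 'I_n -> 'rV[R]_d)
    (I : {set 'I_n}) :=
  exists (u : 'rV[R]_d) (b : R),
    (forall i, i \in I -> dot u (p i) = b) /\
    (forall i, i \notin I -> dot u (p i) < b).

(** Farkas' alternative: otherwise the points satisfy an affine relation whose
    coefficients outside [I] are nonnegative and not all zero.  Affine relations
    are linear relations between the vectors [(1, p i)]. *)
Lemma face_at_or (R : realFieldType) (d n : nat) (p : 'I_n -> 'rV[R]_d)
    (I : {set 'I_n}) :
  face_at p I \/
  exists c : 'I_n -> R, [/\ \sum_i c i = 0, \sum_i c i *: p i = 0,
    forall i, i \notin I -> 0 <= c i & exists2 i, i \notin I & 0 < c i].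
Proof.
pose v i : 'rV[R]_(1 + d) := row_mx 1%:M (p i).
pose A : 'M[R]_(n, 1 + d) := \matrix_i (if i \in I then v i else 0).
have dot_row (z : 'rV[R]_(1 + d)) i : dot z (v i) = z 0 (lshift d 0) + dot (rsubmx z) (p i).
  rewrite /dot big_split_ord big_ord1 /=; congr (_ + _).
    by rewrite /v row_mxEl mxE mulr1.
  by apply: eq_bigr => j _; rewrite /v row_mxEr mxE.
have [[z z0 zpos]|[l [l0 [i1 i1I li1] /submxP[mu Hmu]]]] :=
    mixed_gordan v A (enum_uniq (mem (~: I))).
  left; exists (- rsubmx z), (z 0 (lshift d 0)); split=> i iI.
    have := z0 (v i); rewrite dot_row dotNl => H.
    apply/eqP; rewrite eq_sym -subr_eq0 opprK H //.
    by have := row_sub i A; rewrite rowK iI.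
  have := zpos i; rewrite mem_enum inE => /(_ iI).
  by rewrite dot_row dotNl; lra.
right; exists (fun i => if i \in I then - mu 0 i else l i).
have sum0 : \sum_i (if i \in I then - mu 0 i else l i) *: v i = 0.
  rewrite (bigID (mem I)) /=; apply/eqP; rewrite addrC addr_eq0; apply/eqP.
  transitivity (\sum_(i <- enum (~: I)) l i *: v i).
    rewrite big_enum /=; apply: eq_big => i; first by rewrite inE.
    by move=> /negPf ->.
  rewrite Hmu mulmx_sum_row [LHS](bigID (mem I)) /= [X in _ + X]big1 ?addr0.
    rewrite -sumrN; apply: eq_bigr => i iI.
    by rewrite rowK iI scaleNr opprK.
  by move=> i /negPf iI; rewrite rowK iI scaler0.
split.
- move/(congr1 (fun w : 'rV_(1 + d) => w 0 (lshift d 0))): sum0.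
  rewrite summxE mxE => H; rewrite -[RHS]H; apply: eq_bigr => i _.
  by rewrite mxE /v row_mxEl mxE mulr1.
- apply/rowP => j; move/(congr1 (fun w : 'rV_(1 + d) => w 0 (rshift 1 j))): sum0.
  rewrite !summxE !mxE => H; rewrite -[RHS]H; apply: eq_bigr => i _.
  by rewrite [LHS]mxE [RHS]mxE /v row_mxEr.
- by move=> i iI; rewrite (negPf iI) l0 // mem_enum inE.
- by move: i1I; rewrite mem_enum inE => i1I; exists i1; rewrite ?(negPf i1I).
Qed.

Section Walk.
Variables (R : realFieldType) (m d : nat) (xi : 'I_m -> 'rV[R]_d) (s : 'S_m).
Implicit Types (i : 'I_m.+1) (I : {set 'I_m.+1}).

Let p i := psum xi s i.
Let pi := lift_perm ord0 ord0 s.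

Lemma walk_step i : row (pi (succ i)) (closed_mx xi) = p (succ i) - p i.
Proof.
have [->|im] := eqVneq i ord_max.
  have p0 : p ord0 = 0 by rewrite /p /psum big_pred0.
  rewrite succ_max lift_perm_id closed_mx0 p0 sub0r.
  congr (- _); rewrite (reindex_inj (@perm_inj _ s)).
  by apply: eq_bigl => j; rewrite ltn_ord.
rewrite ltn_max in im.
have -> : succ i = lift ord0 (Ordinal im).
  by apply: val_inj; rewrite val_succ //= lift0.
rewrite lift_perm_lift closed_mx_lift /p /psum lift0 /=.
rewrite (bigD1 (Ordinal im)) //= (eq_bigl (fun j : 'I_m => (j < i)%N)) ?addrK //.
by move=> j; rewrite -val_eqE /= ltnS ltn_neqAle andbC.
Qed.

(** Summation by parts around the circle: a combination of the steps with
    coefficients [y] is the combination of the points with the differences of [y]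
    as coefficients. *)
Lemma abel_walk (y : 'I_m.+1 -> R) :
  \sum_a y a *: row a (closed_mx xi) =
  \sum_i (y (pi i) - y (pi (succ i))) *: p i.
Proof.
rewrite (reindex_inj (@perm_inj _ pi)) (reindex_inj (@succ_inj m)) /=.
under eq_bigr do rewrite walk_step scalerBr.
have E : \sum_i y (pi (succ i)) *: p (succ i) = \sum_i y (pi i) *: p i.
  by rewrite [RHS](reindex_inj (@succ_inj m)).
by rewrite sumrB E -sumrB; apply: eq_bigr => i _; rewrite scalerBl.
Qed.

Lemma sum_cyclic_diff (y : 'I_m.+1 -> R) :
  \sum_i (y (pi i) - y (pi (succ i))) = 0.
Proof.
rewrite sumrB [X in _ - X](_ : _ = \sum_i y (pi i)) ?subrr //.
by rewrite [RHS](reindex_inj (@succ_inj m)).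
Qed.

(** A relation between the steps that decreases outside [I] gives an affine
    relation with positive coefficients there, and the supporting hyperplane of a
    face forbids it. *)
Lemma face_not_descends I : I != [set: 'I_m.+1] ->
  face_at p I -> ~~ descends (flow xi) pi I.
Proof.
move=> IT [u [b [Ib nIb]]]; apply/asboolPn => -[y yM Hy].
have [i0 i0I] : exists i, i \notin I.
  by apply/existsP; rewrite -negb_forall; apply: contra IT => /forallP H;
    rewrite -finset.subTset; apply/fintype.subsetP.
have /eqP : \sum_i (y 0 (pi i) - y 0 (pi (succ i))) * (b - dot u (p i)) = 0.
  under eq_bigr do rewrite mulrBr.
  rewrite sumrB -mulr_suml (sum_cyclic_diff (fun a => y 0 a)) mul0r.
  under eq_bigr do rewrite -dotZr.
  rewrite -dot_sumr -(abel_walk (fun a => y 0 a)).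
  by move/flowP: yM => ->; rewrite dot0r subrr.
have ge0 i : 0 <= (y 0 (pi i) - y 0 (pi (succ i))) * (b - dot u (p i)).
  have [iI|iI] := boolP (i \in I); first by rewrite Ib // subrr mulr0.
  by rewrite mulr_ge0 // subr_ge0 ltW ?Hy ?nIb.
rewrite psumr_eq0 // => /allP/(_ i0 (mem_index_enum _)) /=.
by rewrite mulf_eq0 !subr_eq0 (gt_eqF (Hy _ i0I)) (gt_eqF (nIb _ i0I)).
Qed.

(** The height at a place of the circle is the sum of the differences from
    there up to [ord_max]; the total being zero closes the circle. *)
Lemma cyclic_primitive (c : 'I_m.+1 -> R) : \sum_i c i = 0 ->
  exists y : 'rV[R]_m.+1, forall i, y 0 (pi i) - y 0 (pi (succ i)) = c i.
Proof.
move=> c0; exists (\row_a \sum_(j : 'I_m.+1 | ((pi^-1)%g a <= j)%N) c j) => i.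
rewrite !mxE !permK; have [->|im] := eqVneq i ord_max.
  rewrite succ_max [X in _ - X](eq_bigl xpredT) // c0 subr0.
  rewrite (big_pred1 ord_max) // => j.
  by rewrite /= -val_eqE /= eqn_leq leq_ord.
rewrite ltn_max in im; rewrite val_succ // (bigD1 i) //= -addrA.
rewrite [X in X - _](eq_bigl (fun j : 'I_m.+1 => (i.+1 <= j)%N)) ?subrr ?addr0 //.
by move=> j; rewrite -val_eqE /= [RHS]ltn_neqAle andbC eq_sym.
Qed.

Hypotheses (gen : generic xi) (dm : (d <= m)%N).

(** The heights [y] of the given affine relation decrease weakly outside [I],
    and have to be perturbed so as to decrease strictly.  Let [B] be the edges
    where [y] is stationary.  As [y] is a relation between the steps that is
    constant on the components of [B], but not constant, the components are so many
    that in general position the component sums span the whole space.  So any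
    strictly decreasing [z] can be turned into a relation [z - w] by some [w] that
    is constant on the components and combines the steps to the same vector as
    [z], and [y + e (z - w)] works for small [e]. *)
Lemma descends_of_relation (I : {set 'I_m.+1}) (c : 'I_m.+1 -> R) i0 : i0 \in I ->
  \sum_i c i = 0 -> \sum_i c i *: p i = 0 ->
  (forall i, i \notin I -> 0 <= c i) -> (exists2 i, i \notin I & 0 < c i) ->
  descends (flow xi) pi I.
Proof.
move=> i0I c0 cp0 cge0 [i1 i1I ci1].
have [y yc] := cyclic_primitive c0.
have yM : (y <= flow xi)%MS.
  apply/flowP; rewrite (abel_walk (fun a => y 0 a)) -[RHS]cp0.
  by apply: eq_bigr => i _; rewrite yc.
pose B := [seq (pi i, pi (succ i)) | i <- enum (~: I) & c i == 0].
have BP i : i \notin I -> c i = 0 -> (pi i, pi (succ i)) \in B.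
  by move=> iI ci; apply: map_f; rewrite mem_filter ci eqxx mem_enum inE.
have yB : (y <= cap_kernels (flow xi) (map (@edge_form R m) B))%MS.
  apply/sub_cap_kernelsP; split=> // _ /mapP[_ /mapP[i + ->] ->].
  by rewrite mem_filter => /andP[/eqP ci _]; rewrite form_edge /= yc.
have oneB : ((const_mx 1 : 'rV[R]_m.+1) <= cap_kernels (flow xi) (map (@edge_form R m) B))%MS.
  apply/sub_cap_kernelsP; split; last first.
    by move=> _ /mapP[e _ ->]; rewrite form_edge !mxE subrr.
  apply/flowP; rewrite -[RHS](sum_closed_mx xi); apply: eq_bigr => a _.
  by rewrite mxE scale1r.
(* [y] and the constants are two independent vectors *)
have rank2 : (1 < \rank (cap_kernels (flow xi) (map (@edge_form R m) B)))%N.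
  have yfree : row_free (col_mx y (const_mx 1 : 'rV[R]_m.+1)).
    apply: inj_row_free => w.
    rewrite -[w]hsubmxK mul_row_col; move: (lsubmx w) (rsubmx w) => a b.
    rewrite {1}[a]mx11_scalar {1}[b]mx11_scalar !mul_scalar_mx => H.
    have Ha j : a 0 0 * y 0 j + b 0 0 = 0.
      have := congr1 (fun z : 'rV_m.+1 => z 0 j) H.
      by rewrite !mxE mulr1.
    have a0 : a 0 0 = 0.
      have : a 0 0 * (y 0 (pi i1) - y 0 (pi (succ i1))) == 0.
        apply/eqP; rewrite mulrBr.
        by have := Ha (pi i1); have := Ha (pi (succ i1)); lra.
      by rewrite yc mulf_eq0 (gt_eqF ci1) orbF => /eqP.
    have b0 : b 0 0 = 0 by have := Ha ord0; rewrite a0 mul0r add0r.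
    have -> : a = 0 by apply/rowP => j; rewrite ord1 a0 mxE.
    have -> : b = 0 by apply/rowP => j; rewrite ord1 b0 mxE.
    by rewrite row_mx0.
  rewrite -[X in (X <= _)%N](eqP yfree) mxrankS // col_mx_sub.
  by rewrite yB oneB.
have [kappa surj kB] := num_componentsP B.
have full : row_full (class_mx R kappa *m closed_mx xi).
  rewrite /row_full rank_class_sums //; move: rank2; rewrite rank_cap_flow //.
  by lia.
(* minus the position, counted around the circle from the cut [i0] *)
pose z : 'rV[R]_m.+1 := \row_a - (((pi^-1)%g a - succ i0)%R : nat)%:R.
have zi i : i \notin I -> z 0 (pi (succ i)) < z 0 (pi i).
  move=> iI; have ii0 : i != i0 by apply: contraNneq iI => ->.
  rewrite !mxE !permK ltrN2 ltr_nat.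
  have -> : succ i - succ i0 = succ (i - succ i0) by rewrite !(succ_add i) !(succ_add (i - _)) addrAC.
  rewrite val_succ // -ltn_max; apply: contra ii0 => /eqP ei.
  by rewrite -(inj_eq (@succ_inj m)) -subr_eq0 -[X in _ == X](succ_max m) -ei; apply/eqP;
   rewrite !(succ_add i) !(succ_add (i - _)) addrAC.
have /row_fullP[F FK] := full.
pose w := (z *m closed_mx xi *m F) *m class_mx R kappa.
have wz : w *m closed_mx xi = z *m closed_mx xi.
  by rewrite /w -(mulmxA _ (class_mx R kappa)) -mulmxA FK mulmx1.
have wB e : e \in B -> w 0 e.1 = w 0 e.2.
  apply: (kB _ (fun a => w 0 a)).2 => a b ab.
  by rewrite !mxE; apply: eq_bigr => i _; rewrite !mxE ab.
pose y2 := z - w.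
have y2M : (y2 <= flow xi)%MS.
  by apply/sub_kermxP; rewrite mulmxBl wz subrr.
have [|e e0 He] := @small_multiple R _ (enum (~: I)) c
    (fun i => y2 0 (pi i) - y2 0 (pi (succ i))).
  move=> i; rewrite mem_enum inE => iI.
  have /orP[/eqP/esym ci|] : (0 == c i) || (0 < c i) by rewrite -le_eqVlt cge0.
    2: by left.
  right; split; first by rewrite ci.
  rewrite !mxE.
  have /= := wB _ (BP i iI ci); rewrite !mxE => ->.
  by have := zi i iI; rewrite !mxE; lra.
apply/asboolP; exists (y + e *: y2); first by rewrite addmx_sub ?scalemx_sub.
move=> i iI; have := He e; rewrite e0 lexx => /(_ isT i).
rewrite mem_enum inE => /(_ iI); rewrite -yc [in X in _ -> X]mxE [in X in _ -> _ < X]mxE.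
by rewrite [(e *: y2) 0 _]mxE [X in _ -> _ < _ + X]mxE; lra.
Qed.

Lemma descends_face I : I != finset.set0 -> I != [set: 'I_m.+1] ->
  descends (flow xi) pi I = ~~ `[< face_at p I >].
Proof.
move=> /finset.set0Pn[i0 i0I] IT; apply/idP/idP => [|/asboolPn nf].
  by apply: contraL => /asboolP; exact: face_not_descends.
have [//|[c [c0 cp cge cgt]]] := face_at_or p I.
exact: (descends_of_relation i0I c0 cp).
Qed.

(** The direction of the affine span of the points of [I]. *)
Definition dirs I i0 : {vspace 'rV[R]_d} := <<[seq p i - p i0 | i in I]>>%VS.

Lemma rank_le_dim q (Y : 'M[R]_(q, d)) (V : {vspace 'rV[R]_d}) :
  (forall i : 'I_q, row i Y \in V) -> (\rank Y <= \dim V)%N.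
Proof.
move=> YV; pose b : 'M[R]_(\dim V, d) := \matrix_j (vbasis V)`_j.
apply: leq_trans (rank_leq_row b); apply/mxrankS/row_subP => i.
rewrite (coord_vbasis (YV i)) summx_sub // => j _.
apply: scalemx_sub; have -> : (vbasis V)`_j = row j b by rewrite rowK.
exact: row_sub.
Qed.

(** Cut the circle at [I]: the sum of the steps over an arc is the difference of
    two points of [I], and by general position the [#|I|] arc sums have the largest
    rank that their relation and the space allow. *)
Lemma dim_dirs I i0 : i0 \in I -> \dim (dirs I i0) = minn #|I|.-1 d.
Proof.
move=> i0I; apply/eqP; rewrite eqn_leq; apply/andP; split.
  rewrite leq_min; apply/andP; split; last first.
    by apply: leq_trans (dimvS (subvf _)) _; rewrite dimvf dim_matrix mul1r.
  have -> : dirs I i0 = <<[seq p i - p i0 | i in I :\ i0]>>%VS.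
    apply/eqP; rewrite eqEsubv; apply/andP; split; apply/span_subvP => v /fintype.imageP[i iI ->].
      have [->|ii0] := eqVneq i i0; first by rewrite subrr mem0v.
      by apply/memv_span/fintype.imageP; exists i; rewrite ?inE ?ii0.
    apply/memv_span/fintype.imageP; exists i => //; by move: iI; rewrite !inE => /andP[].
  apply: leq_trans (dim_span _) _; rewrite size_map -cardE.
  by rewrite (cardsD1 i0 I) i0I.
have I0 : I != finset.set0 by apply/finset.set0Pn; exists i0.
have [c csurj cI] := cyclic_arcs I0.
pose kappa a := c ((pi^-1)%g a).
have ksurj v : exists a, kappa a = v.
  by have [j <-] := csurj v; exists (pi j); rewrite /kappa permK.
rewrite -(rank_class_sums gen dm ksurj); apply: rank_le_dim => v.
rewrite row_mul mulmx_sum_row.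
pose g a := row v (class_mx R kappa) 0 a; pose w i := g (pi i) - g (pi (succ i)).
have wE i : w i = (c i == v)%:R - (c (succ i) == v)%:R.
  by rewrite /w /g !mxE /kappa !permK.
rewrite (abel_walk g) -/w.
have -> : \sum_i w i *: p i = \sum_(i in I) w i *: (p i - p i0).
  have w0 : \sum_i w i = 0 by exact: sum_cyclic_diff.
  have -> : \sum_i w i *: p i = \sum_i w i *: (p i - p i0).
    under [RHS]eq_bigr do rewrite scalerBr.
    by rewrite sumrB -scaler_suml w0 scale0r subr0.
  rewrite [RHS]big_mkcond /=; apply: eq_bigr => i _; case: ifPn => // iI.
  by rewrite wE cI // subrr scale0r.
apply: rpred_sum => i iI; apply/rpredZ/memv_span/fintype.imageP; by exists i.
Qed.

End Walk.

(** * Polynomials as generating functions of Bernoulli sums *)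

Lemma big_iota_ord (T : Type) (idx : T) (op : Monoid.law idx) n (F : nat -> T) :
  \big[op/idx]_(l <- iota 0 n) F l = \big[op/idx]_(l < n) F l.
Proof. by rewrite -(big_mkord xpredT) /index_iota subn0. Qed.

Section Bexp.
Variable R : realFieldType.
Implicit Types (s : seq R) (F G : nat -> R) (q : {poly R}).

(** The linear functional on polynomials with ['X^j] going to [F j]: applied to
    the generating function of a random integer, it is the mean of [F]. *)
Definition coef_sum q F : R := \sum_(j < size q) q`_j * F j.

Lemma coef_sum_widen q F N : (size q <= N)%N ->
  coef_sum q F = \sum_(j < N) q`_j * F j.
Proof.
move=> qN; rewrite /coef_sum (big_ord_widen_cond _ xpredT (fun j => q`_j * F j) qN) /=.
rewrite big_mkcond; apply: eq_bigr => j _; case: ltnP => //= jq.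
by rewrite nth_default ?mul0r.
Qed.

Lemma coef_sumD q q' F : coef_sum (q + q') F = coef_sum q F + coef_sum q' F.
Proof.
rewrite !(@coef_sum_widen _ _ (maxn (size q) (size q'))) ?size_polyD //;
  rewrite ?leq_max ?leqnn ?orbT //.
by rewrite -big_split; apply: eq_bigr => j _; rewrite coefD mulrDl.
Qed.

Lemma coef_sumZ a q F : coef_sum (a *: q) F = a * coef_sum q F.
Proof.
rewrite !(@coef_sum_widen _ _ (size q)) ?size_scale_leq // mulr_sumr.
by apply: eq_bigr => j _; rewrite coefZ mulrA.
Qed.

Lemma coef_sum0 F : coef_sum 0 F = 0.
Proof. by rewrite -[X in coef_sum X](scale0r 0) coef_sumZ mul0r. Qed.

Lemma coef_sum_sum (J : Type) (r : seq J) (P : pred J) (Q : J -> {poly R}) F :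
  coef_sum (\sum_(j <- r | P j) Q j) F = \sum_(j <- r | P j) coef_sum (Q j) F.
Proof.
by elim/big_rec2: _ => [|j y x _ <-]; rewrite ?coef_sum0 ?coef_sumD.
Qed.

Lemma coef_sumXn c F : coef_sum 'X^c F = F c.
Proof.
rewrite /coef_sum size_polyXn big_ord_recr /= coefXn eqxx mul1r big1 ?add0r // => j _.
by rewrite coefXn ltn_eqF ?mul0r.
Qed.

Lemma coef_sum1 F : coef_sum 1 F = F 0%N.
Proof. by rewrite -(expr0 'X) coef_sumXn. Qed.

Lemma coef_sumXM q F : coef_sum ('X * q) F = coef_sum q (fun j => F j.+1).
Proof.
rewrite !(@coef_sum_widen _ _ (size q).+1) // ?(leq_trans (size_polyMleq _ _)) ?size_polyX //.
rewrite big_ord_recl coefXM mul0r add0r [RHS](big_ord_recr (size q)) /=.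
rewrite [X in _ + X * _]nth_default // mul0r addr0.
by apply: eq_bigr => j _; rewrite coefXM.
Qed.

Lemma coef_sum_lin a b q F :
  coef_sum ((a *: 'X + b%:P) * q) F = b * coef_sum q F + a * coef_sum q (fun j => F j.+1).
Proof.
by rewrite mulrDl coef_sumD -scalerAl coef_sumZ coef_sumXM mul_polyC coef_sumZ addrC.
Qed.

Lemma coef_sum_oppF q F : coef_sum q (fun j => - F j) = - coef_sum q F.
Proof. by rewrite -sumrN; apply: eq_bigr => j _; rewrite mulrN. Qed.

Lemma eq_coef_sum q F G : F =1 G -> coef_sum q F = coef_sum q G.
Proof. by move=> FG; apply: eq_bigr => j _; rewrite FG. Qed.

(** Substitution of [- 'X]. *)
Lemma coef_sum_reflect (s : seq R) a F :
  coef_sum (\prod_(b <- s) (a *: 'X - b%:P)) F =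
  (-1) ^+ size s * coef_sum (\prod_(b <- s) (a *: 'X + b%:P)) (fun j => (-1) ^+ j * F j).
Proof.
elim: s F => [|b s IH] F.
  by rewrite !big_nil !coef_sum1 /= !mul1r.
rewrite !big_cons -polyCN !coef_sum_lin !IH /=.
have -> : coef_sum (\prod_(b0 <- s) (a *: 'X + b0%:P)) (fun j => (-1) ^+ j.+1 * F j.+1)
   = - coef_sum (\prod_(b0 <- s) (a *: 'X + b0%:P)) (fun j => (-1) ^+ j * F j.+1).
  by rewrite -coef_sum_oppF; apply: eq_coef_sum => j; rewrite exprS; ring.
by rewrite exprS; ring.
Qed.

(** The mean of [F] at the number of successes in independent trials with success
    probabilities [s], conditioning on the first trial. *)
Fixpoint bexp s F : R :=
  if s is p :: s' then (1 - p) * bexp s' F + p * bexp s' (fun j => F j.+1) else F 0%N.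

Lemma eq_bexp s F G : F =1 G -> bexp s F = bexp s G.
Proof.
elim: s F G => [|p s IH] F G FG /=; first exact: FG.
by rewrite (IH F G) // (IH (fun j => F j.+1) (fun j => G j.+1)).
Qed.

Lemma bexpD s F G : bexp s (fun j => F j + G j) = bexp s F + bexp s G.
Proof. by elim: s F G => [|p s IH] F G //=; rewrite !IH; ring. Qed.

Lemma bexpZ s a F : bexp s (fun j => a * F j) = a * bexp s F.
Proof. by elim: s F => [|p s IH] F //=; rewrite !IH; ring. Qed.

Lemma bexp_cst s a : bexp s (fun=> a) = a.
Proof. by elim: s => [|p s IH] //=; rewrite !IH; ring. Qed.

Lemma bexpE s F : bexp s F = coef_sum (\prod_(p <- s) (p *: 'X + (1 - p)%:P)) F.
Proof.
elim: s F => [|p s IH] F; first by rewrite big_nil coef_sum1.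
by rewrite big_cons coef_sum_lin /= !IH.
Qed.

Lemma perm_bexp s s' F : perm_eq s s' -> bexp s F = bexp s' F.
Proof. by move=> ss'; rewrite !bexpE (perm_big _ ss'). Qed.

(** The weight that arises in counting listings: a tail indicator, except for
    alternating signs up to [d]. *)
Definition parity_weight (d j : nat) : R :=
  if (d < j)%N then 1 else (-1) ^+ (j + d).+1.

(** A fair coin averages the weights of consecutive integers, so that the
    alternating signs cancel and the tail indicator remains. *)
Lemma bexp_parity d s :
  bexp (2^-1 :: s) (parity_weight d) = bexp s (fun j => (d < j)%N%:R).
Proof.
rewrite /= -!bexpZ -bexpD; apply: eq_bexp => j; rewrite /parity_weight.
have -> : 1 - 2^-1 = 2^-1 :> R by field.
rewrite -mulrDr; case: (ltngtP d j) => [dj|jd|<-].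
- by rewrite ltnS (ltnW dj) /=; field.
- rewrite ltnS leqNgt jd /= addSn [in X in _ + X]exprS.
  by ring.
- by rewrite ltnSn addnn -mul2n exprS exprM sqrrN !expr1n /=; field.
Qed.

(** The trial [l = i] is a fair coin and left out, being used up by the
    alternating signs. *)
Definition success_probs (i n : nat) : seq R :=
  [seq i%:R / (i + l)%:R | l <- iota 0 n & l != i].

Definition tail_prob (i n d : nat) : R :=
  bexp (success_probs i n) (fun j => (d < j)%N%:R).

Lemma coef_sum_rising i n F : (0 < i)%N ->
  coef_sum (\prod_(l < n) (i%:R *: 'X + l%:R%:P)) F =
  (\prod_(l < n) (i + l)%N%:R) * bexp [seq i%:R / (i + l)%:R | l <- iota 0 n] F.
Proof.
move=> i0; rewrite bexpE big_map big_iota_ord -coef_sumZ.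
congr coef_sum; rewrite -(mul_polyC (\prod_(l < n) _)) rmorph_prod -big_split /=.
apply: eq_bigr => l _.
have nz : (i + l)%:R != 0 :> R by rewrite pnatr_eq0; lia.
rewrite mulrDr -!mul_polyC mulrA -!rmorphM /= mulrCA divff // mulr1.
by rewrite mulrBr mulr1 mulrCA divff // mulr1 natrD addrAC subrr add0r.
Qed.

Lemma coef_sum_falling_weight i n d (w : nat -> R) :
  (i < n)%N -> (forall j, (-1) ^+ n * (-1) ^+ j * w j = parity_weight d j) ->
  coef_sum (\prod_(l < n) (i%:R *: 'X - l%:R%:P)) w =
  (\prod_(l < n) (i + l)%N%:R) * tail_prob i n d.
Proof.
move=> i_n ww; have [->|i0] := posnP i.
  have n0 : (0 < n)%N by lia.
  rewrite (bigD1 (Ordinal n0)) //= scale0r subr0 mul0r coef_sum0.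
  by rewrite (bigD1 (Ordinal n0)) //= add0n !mul0r.
transitivity (coef_sum (\prod_(b <- [seq l%:R | l <- iota 0 n]) (i%:R *: 'X - b%:P)) w).
  by rewrite big_map big_iota_ord.
rewrite coef_sum_reflect size_map size_iota.
rewrite big_map big_iota_ord coef_sum_rising // mulrCA.
congr (_ * _); rewrite -bexpZ (eq_bexp _ (G := parity_weight d)); last first.
  by move=> j; rewrite mulrA ww.
rewrite /tail_prob -bexp_parity; apply: perm_bexp.
have i_in : i \in iota 0 n by rewrite mem_iota.
have -> : 2^-1 = i%:R / (i + i)%:R :> R.
  have : i%:R != 0 :> R by rewrite pnatr_eq0 -lt0n.
  by move=> nz; rewrite addnn -mul2n natrM invfM mulrCA divff // mulr1.
rewrite /success_probs -(rem_filter _ (iota_uniq 0 n)).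
rewrite -[_ :: _]/(map (fun l => i%:R / (i + l)%:R) (i :: rem i (iota 0 n))).
exact/perm_map/perm_to_rem.
Qed.

End Bexp.

(** * Moments and Stein's identity for Bernoulli sums *)

Section Stein.
Variable R : realFieldType.
Implicit Types (s : seq R) (F D G : nat -> R).

Definition probs s := all (fun p => 0 <= p <= 1) s.

Lemma le_bexp s F G : probs s -> (forall j, F j <= G j) -> bexp s F <= bexp s G.
Proof.
elim: s F G => [|p s IH] F G /=; first by move=> _; apply.
move=> /andP[/andP[p0 p1] ps] FG; apply: lerD; apply: ler_wpM2l => //.
- by rewrite subr_ge0.
- exact: IH.
- exact: IH.
Qed.

Lemma bexp_ge0 s F : probs s -> (forall j, 0 <= F j) -> 0 <= bexp s F.
Proof. by move=> ps F0; rewrite -(bexp_cst s 0); exact: le_bexp. Qed.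

Lemma bexp_norm_le s F e : probs s -> (forall j, `|F j| <= e) -> `|bexp s F| <= e.
Proof.
move=> ps Fe; rewrite ler_norml; apply/andP; split.
  rewrite -(bexp_cst s (- e)); apply: le_bexp => // j.
  by have := Fe j; rewrite ler_norml => /andP[].
rewrite -[leRHS](bexp_cst s); apply: le_bexp => // j.
by have := Fe j; rewrite ler_norml => /andP[].
Qed.

Definition mean s := \sum_(p <- s) p.
Definition var s := \sum_(p <- s) p * (1 - p).

Lemma var_ge0 s : probs s -> 0 <= var s.
Proof.
move=> /allP ps; rewrite /var big_seq sumr_ge0 // => p /ps /andP[p0 p1].
by rewrite mulr_ge0 // subr_ge0.
Qed.

(** Stein's identity for a sum [N] of independent trials: the covariance of [N]
    and [F N] is the variance times the mean of the derivative of [F], up to an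
    error measured by comparing a difference quotient of [F] with its derivative [D]
    at the two ends.  By induction on the trials, absorbing the first one into [F]
    and [D]. *)
Lemma stein_bernoulli s F D e : probs s ->
  (forall j, `|F j.+1 - F j - D j| <= e) ->
  (forall j, `|F j.+1 - F j - D j.+1| <= e) ->
  `|bexp s (fun j => (j%:R - mean s) * F j) - var s * bexp s D| <= var s * e.
Proof.
rewrite /mean /var; elim: s F D => [|p s IH] F D.
  by move=> *; rewrite !big_nil /= subr0 !mul0r subr0 normr0.
move=> /= /andP[/andP[p0 p1] ps] H0 H1; rewrite !big_cons /=.
set M := \sum_(q <- s) q; set V := \sum_(q <- s) q * (1 - q).
pose Fp j := (1 - p) * F j + p * F j.+1.
pose Dp j := (1 - p) * D j + p * D j.+1.
have p1' : 0 <= 1 - p by rewrite subr_ge0.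
have comb (x y : R) : `|x| <= e -> `|y| <= e -> `|(1 - p) * x + p * y| <= e.
  rewrite !ler_norml => /andP[x1 x2] /andP[y1 y2]; apply/andP; split; nra.
have /IH : forall j, `|Fp j.+1 - Fp j - Dp j| <= e.
  move=> j; have := comb _ _ (H0 j) (H0 j.+1); congr (`|_| <= e); rewrite /Fp /Dp; ring.
move=> /(_ ps) {}IH.
have {}IH : `|bexp s (fun j => (j%:R - M) * Fp j) - V * bexp s Dp| <= V * e.
  apply: IH => j; have := comb _ _ (H1 j) (H1 j.+1).
  by congr (`|_| <= e); rewrite /Fp /Dp; ring.
have H2 : `|bexp s (fun j => (F j.+1 - F j) - Dp j)| <= e.
  apply: bexp_norm_le => // j; have := comb _ _ (H0 j) (H1 j).
  by congr (`|_| <= e); rewrite /Dp; ring.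
have E1 : (1 - p) * bexp s (fun j => (j%:R - (p + M)) * F j) +
    p * bexp s (fun j => (j.+1%:R - (p + M)) * F j.+1) =
    bexp s (fun j => (j%:R - M) * Fp j) + p * (1 - p) * bexp s (fun j => F j.+1 - F j).
  rewrite -!bexpZ -!bexpD; apply: eq_bexp => j; rewrite /Fp -natr1; ring.
have E2 : (1 - p) * bexp s D + p * bexp s (fun j => D j.+1) = bexp s Dp.
  by rewrite -!bexpZ -bexpD.
have E3 : bexp s (fun j => (F j.+1 - F j) - Dp j) =
    bexp s (fun j => F j.+1 - F j) - bexp s Dp.
  rewrite -[in RHS]mulN1r -bexpZ -bexpD; apply: eq_bexp => j; ring.
rewrite E1 E2; rewrite E3 in H2.
have -> : bexp s (fun j => (j%:R - M) * Fp j) + p * (1 - p) * bexp s (fun j => F j.+1 - F j) -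
   (p * (1 - p) + V) * bexp s Dp =
   (bexp s (fun j => (j%:R - M) * Fp j) - V * bexp s Dp) +
   p * (1 - p) * (bexp s (fun j => F j.+1 - F j) - bexp s Dp) by ring.
apply: le_trans (ler_normD _ _) _; rewrite mulrDl addrC lerD //.
have pp : 0 <= p * (1 - p) by rewrite mulr_ge0.
by rewrite normrM ger0_norm // ler_wpM2l.
Qed.

(** Stein's identity for a linear function, which has no error. *)
Lemma bexp_variance s : probs s -> bexp s (fun j => (j%:R - mean s) ^+ 2) = var s.
Proof.
move=> ps; have := @stein_bernoulli s (fun j => j%:R - mean s) (fun=> 1) 0 ps.
rewrite bexp_cst mulr1 mulr0 => H.
apply/eqP; rewrite -subr_eq0 -normr_le0; apply: H => j;
rewrite normr_le0 /= -(natr1 j); apply/eqP; move: (mean s) => M; ring.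
Qed.

Lemma bexp_mean s : bexp s (fun j => j%:R) = mean s.
Proof.
rewrite /mean; elim: s => [|p s IH] /=; first by rewrite big_nil.
rewrite big_cons IH (eq_bexp s (G := fun j => j%:R + 1)) => [|j]; last by rewrite natr1.
by rewrite bexpD bexp_cst IH; ring.
Qed.

Lemma bexp_second_moment s a : probs s ->
  bexp s (fun j => (j%:R - a) ^+ 2) = var s + (mean s - a) ^+ 2.
Proof.
move=> ps; rewrite -(bexp_variance ps).
rewrite (eq_bexp s (G := fun j => (j%:R - mean s) ^+ 2 +
  (2 * (mean s - a) * j%:R + (- 2 * (mean s - a) * mean s + (mean s - a) ^+ 2)))).
  rewrite bexpD (bexpD s (fun j => 2 * (mean s - a) * j%:R)) bexpZ bexp_mean bexp_cst.
  by ring.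
by move=> j; ring.
Qed.

Lemma bexp_chebyshev s a t (E : pred nat) : probs s -> 0 < t ->
  (forall j, E j -> t ^+ 2 <= (j%:R - a) ^+ 2) ->
  bexp s (fun j => (E j)%:R) <= (var s + (mean s - a) ^+ 2) / t ^+ 2.
Proof.
move=> ps t0 HE; rewrite -bexp_second_moment // mulrC -bexpZ; apply: le_bexp => // j.
have t2 : 0 < t ^+ 2 by rewrite exprn_gt0.
rewrite mulrC; case: (boolP (E j)) => Ej /=.
  by rewrite ler_pdivlMr // mul1r HE.
by rewrite divr_ge0 ?sqr_ge0 // ltW.
Qed.

End Stein.

Local Open Scope classical_set_scope.
Local Open Scope ring_scope.

(** * Faces of a polytope as simplices *)

Lemma affine_comb_sub (R : pzRingType) (V : lmodType R) (J : finType) (a : J -> R)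
    (y : J -> V) (q : V) :
  \sum_j a j = 1 -> \sum_j a j *: y j - q = \sum_j a j *: (y j - q).
Proof.
move=> a1; under [RHS]eq_bigr do rewrite scalerBr.
by rewrite sumrB -scaler_suml a1 scale1r.
Qed.

Section Hull.
Variables (R : realType) (d n : nat) (p : 'I_n.+1 -> 'rV[R]_d).
Implicit Types (I : {set 'I_n.+1}) (u x : 'rV[R]_d).

Let hull := conv_hull [set p i | i in [set: 'I_n.+1]].

Definition simplex I : set 'rV[R]_d :=
  [set x | exists c : 'I_n.+1 -> R, [/\ forall i, 0 <= c i,
     forall i, i \notin I -> c i = 0, \sum_i c i = 1 & x = \sum_i c i *: p i] ].

Lemma hullP x : hull x <-> simplex [set: 'I_n.+1]%SET x.
Proof.
split=> [[q [a [y [yA a0 a1 ->]]]]|[c [c0 _ c1 ->]]]; last first.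
  by exists n.+1, c, p; split=> // i; exists i.
have sel j : {i | p i = y j} by apply: cid; have [i _ <-] := yA j; exists i.
pose idx j := sval (sel j).
exists (fun i => \sum_(j | idx j == i) a j); split.
- by move=> i; apply: sumr_ge0.
- by move=> i; rewrite inE.
- by rewrite -a1 [RHS](partition_big idx xpredT).
- rewrite (partition_big idx xpredT) //=; apply: eq_bigr => i _.
  rewrite scaler_suml; apply: eq_bigr => j /eqP <-.
  by rewrite /idx; case: (sel j) => /= i' ->.
Qed.

Lemma simplex_vertex I i : i \in I -> simplex I (p i).
Proof.
move=> iI; exists (fun j => (j == i)%:R); split.
- by move=> j; rewrite ler0n.
- by move=> j jI; case: eqP => // ji; rewrite ji iI in jI.
- by rewrite (bigD1 i) //= eqxx big1 ?addr0 // => j /negPf ->.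
- rewrite (bigD1 i) //= eqxx scale1r big1 ?addr0 // => j /negPf ->.
  by rewrite scale0r.
Qed.

Lemma dot_simplex I u b x : (forall i, i \in I -> dot u (p i) = b) ->
  simplex I x -> dot u x = b.
Proof.
move=> Ib [c [c0 cI c1 ->]]; rewrite dot_sumr.
rewrite -[RHS]mul1r -c1 mulr_suml; apply: eq_bigr => i _; rewrite dotZr.
by have [iI|iI] := boolP (i \in I); [rewrite Ib|rewrite cI // !mul0r].
Qed.

(** Equality in [dot u x <= b] forces the weights of the points below the
    hyperplane to vanish. *)
Lemma supporting_simplex I u b : (forall i, i \in I -> dot u (p i) = b) ->
  (forall i, i \notin I -> dot u (p i) < b) ->
  (forall x, hull x -> dot u x <= b) /\
  hull `&` [set x | dot u x = b] = simplex I.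
Proof.
move=> Ib nIb.
have ple i : dot u (p i) <= b.
  by have [iI|iI] := boolP (i \in I); [rewrite Ib|apply/ltW/nIb].
split=> [x /hullP[c [c0 _ c1 ->]]|].
  rewrite dot_sumr -[leRHS]mul1r -c1 mulr_suml; apply: ler_sum => i _.
  by rewrite dotZr ler_wpM2l.
apply/seteqP; split=> x; last first.
  move=> xI; split; last exact: dot_simplex xI.
  by apply/hullP; have [c [c0 cI c1 ->]] := xI; exists c; split=> // i; rewrite inE.
case=> /hullP[c [c0 _ c1 ->]]; rewrite /= dot_sumr => ub.
exists c; split=> // i iI.
have : \sum_i c i * (b - dot u (p i)) = 0.
  under eq_bigr do rewrite mulrBr.
  rewrite sumrB -mulr_suml c1 mul1r -[X in X - _]ub.
  by under eq_bigr do rewrite dotZr; rewrite subrr.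
move/eqP; rewrite psumr_eq0 => [|j _]; last by rewrite mulr_ge0 // subr_ge0.
move=> /allP/(_ i (mem_index_enum _)) /=; rewrite mulf_eq0 subr_eq0.
by rewrite (gt_eqF (nIb _ iI)) orbF => /eqP.
Qed.

Lemma aff_simplex I i0 : i0 \in I ->
  aff_hull (simplex I) =
  [set x | x - p i0 \in <<[seq (p i - p i0)%R | i in I]>>%VS].
Proof.
move=> i0I; apply/seteqP; split=> [x [q [a [y [yS a1 ->]]]]|x] /=.
  rewrite affine_comb_sub //; apply: rpred_sum => j _.
  apply: rpredZ; have [c [c0 cI c1 ->]] := yS j.
  rewrite affine_comb_sub //; apply: rpred_sum => i _.
  have [iI|iI] := boolP (i \in I); last by rewrite cI // scale0r mem0v.
  by apply/rpredZ/memv_span/fintype.imageP; exists i.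
have sz : size [seq (p i - p i0)%R | i in I] == #|I| by rewrite size_map -cardE.
rewrite -[[seq _ | _ in _]]/(tval (Tuple sz)) => /coord_span; set X := Tuple sz => xE.
pose co j := coord X j (x - p i0).
exists #|I|.+1, (fun i => if unlift ord0 i is Some j then co j else 1 - \sum_j co j),
  (fun i => if unlift ord0 i is Some j then p (enum_val j) else p i0); split.
- move=> i; case: (unlift ord0 i) => [j|]; apply: simplex_vertex => //.
  exact: enum_valP.
- rewrite big_ord_recl unlift_none; under [X in _ + X]eq_bigr do rewrite liftK.
  by rewrite subrK.
- rewrite big_ord_recl unlift_none; under [X in _ + X]eq_bigr do rewrite liftK.
  have E : \sum_(i < #|I|) coord X i (x - p i0) *: X`_i =
    \sum_(i < #|I|) co i *: p (enum_val i) - (\sum_(i < #|I|) co i) *: p i0.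
    rewrite scaler_suml -sumrB; apply: eq_bigr => j _; rewrite -scalerBr.
    congr (_ *: _); rewrite /X /= (nth_map i0) -?cardE //.
    by rewrite -(enum_val_nth i0).
  rewrite -[LHS](subrK (p i0)) xE E scalerBl scale1r addrAC [RHS]addrAC.
  by rewrite [_ + p i0]addrC.
Qed.

Definition face_sets k : {set {set 'I_n.+1}} :=
  [set I : {set 'I_n.+1} | (#|I| == k) && `[< face_at p I >] ]%SET.

(** A face is spanned by the points of its supporting hyperplane.  Under the
    assumption on dimensions there are [k] of them, as larger sets have larger
    dimension when [k <= d]. *)
Lemma num_faces_hull k : (0 < k)%N -> (k <= d)%N ->
  (forall I i0, i0 \in I ->
    \dim <<[seq (p i - p i0)%R | i in I]>> = minn #|I|.-1 d) ->
  num_faces k.-1 hull = #|face_sets k|.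
Proof.
move=> k0 kd dimE.
have inj : {in face_sets k &, injective simplex}.
  have sub I J : I \in face_sets k -> J \in face_sets k ->
      simplex I = simplex J -> J \subset I.
    rewrite !inE => /andP[_ /asboolP[u [b [Ib nIb]]]] _ IJ.
    apply/fintype.subsetP => j jJ; apply: contraT => jI.
    have : simplex I (p j) by rewrite IJ; exact: simplex_vertex.
    by move/(dot_simplex Ib) => E; have := nIb j jI; rewrite E ltxx.
  by move=> I J I1 J1 IJ; apply/eqP; rewrite finset.eqEsubset !sub.
rewrite /num_faces.
pose faces := [fset F in map simplex (enum (face_sets k))]%fset.
suff -> : [set F | is_face hull F /\ has_dim F k.-1] = [set` faces].
  rewrite set_fsetK card_fseq undup_id ?size_map -?cardE //.
  by rewrite map_inj_in_uniq ?enum_uniq // => I J; rewrite !mem_enum; exact: inj.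
apply/seteqP; split=> [F [[u [b [ub FE]]] [x0 [V [dV affE]]]]|F /=]; last first.
  rewrite inE => /mapP[I]; rewrite mem_enum inE => /andP[/eqP Ik /asboolP[u [b [Ib nIb]]]] ->.
  have [ub sE] := supporting_simplex Ib nIb; split; first by exists u, b.
  have [i0 i0I] : exists i0, i0 \in I by apply/card_gt0P; rewrite Ik.
  exists (p i0), <<[seq (p i - p i0)%R | i in I]>>%VS; split; last exact: aff_simplex.
  by rewrite dimE // Ik; lia.
pose I := [set i | dot u (p i) == b]%SET.
have Ib i : i \in I -> dot u (p i) = b by rewrite inE => /eqP.
have nIb i : i \notin I -> dot u (p i) < b.
  rewrite inE lt_neqAle => ->; apply: ub; apply/hullP/simplex_vertex.
  by rewrite inE.
have FS : F = simplex I by rewrite FE; exact: (supporting_simplex Ib nIb).2.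
have : aff_hull F x0 by rewrite affE /= subrr mem0v.
case=> q [a [y [yF a1 _]]].
have [j _] : exists j : 'I_q, true.
  case: q a y yF a1 => [|q] a y yF a1; last by exists ord0.
  by move/eqP: a1; rewrite big_ord0 eq_sym oner_eq0.
have [i0 i0I] : exists i0, i0 \in I.
  have := yF j; rewrite FS => -[c [_ cI c1 _]].
  apply/finset.set0Pn; apply/negP => /eqP I0; move/eqP: c1.
  by rewrite big1 => [|i _]; rewrite ?(eq_sym 0) ?oner_eq0 // cI // I0 inE.
have aff2 := aff_simplex i0I; rewrite -FS affE in aff2.
have px : p i0 - x0 \in V.
  by have : [set x | x - x0 \in V] (p i0) by rewrite aff2 /= subrr mem0v.
have VE : V = <<[seq (p i - p i0)%R | i in I]>>%VS.
  apply/vspaceP => v; apply/idP/idP => vV.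
    have : [set x | x - x0 \in V] (p i0 + v) by rewrite /= addrAC rpredD.
    by rewrite aff2 /= addrAC subrr add0r.
  have : [set x | x - x0 \in V] (p i0 + v) by rewrite aff2 /= addrAC subrr add0r.
  by rewrite /= addrAC => H; rewrite -(addKr (p i0 - x0) v) rpredD ?rpredN.
have Ik : #|I| = k.
  have : (0 < #|I|)%N by apply/card_gt0P; exists i0.
  move: dV; rewrite VE (dimE _ _ i0I); move: #|I| => q'; lia.
rewrite /= inE FS; apply/map_f; rewrite mem_enum inE Ik eqxx /=.
by apply/asboolP; exists u, b.
Qed.

End Hull.

(** * Counting faces over all orders of the steps *)

Section Total.
Variables (R : realType) (m d k : nat) (xi : 'I_m -> 'rV[R]_d).
Hypotheses (gen : generic xi) (dm : (d <= m)%N) (k0 : (0 < k)%N) (kd : (k <= d)%N).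

(** The count of listings over all surjective colourings by [k] colours, as a
    combination of tail probabilities. *)
Definition surj_tail (n d k : nat) : R :=
  \sum_(A : {set 'I_k}) (-1) ^+ (k - #|A|) *
    ((\prod_(l < n) (#|A| + l)%N%:R) * tail_prob R #|A| n d).

Lemma eq_signr (a b : nat) : odd a = odd b -> (-1) ^+ a = (-1) ^+ b :> R.
Proof. by move=> ab; rewrite -signr_odd ab signr_odd. Qed.

(** By Whitney's theorem and the ranks in general position, the number of
    listings for a colouring [f] is obtained from its chromatic polynomial by
    reading ['X^c] as a sign depending on [c].  This sign is the parity weight up to
    an alternating factor, and the sum over [f] of the chromatic polynomials is a
    combination of products of linear factors, that is, of generating functions of
    sums of trials. *)
Lemma sum_listings_tail :
  ((\sum_(f : {ffun 'I_m.+1 -> 'I_k} | surjectiveb f) #|listings (flow xi) f|)%N)%:R =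
  surj_tail m.+1 d k.
Proof.
pose w c : R := (-1) ^+ m.+1 * (-1) ^+ c * parity_weight R d c.
have wE c : (c <= m.+1)%N -> (-1) ^+ (m.+1 - d - maxn 1 (c - d)) = w c.
  move=> cm; rewrite /w /parity_weight; case: ltnP => dc; rewrite ?mulr1 -!exprD.
    by apply: eq_signr; lia.
  by apply: eq_signr; lia.
rewrite natr_sum.
transitivity (coef_sum (\sum_(f : {ffun 'I_m.+1 -> 'I_k} | surjectiveb f) chrom R f) w).
  rewrite coef_sum_sum; apply: eq_bigr => f _; rewrite card_listings.
  have /(congr1 (fun z : int => z%:~R : R)) := whitney (flow xi) (map (@edge_form R m) (mono_edges f)).
  rewrite rmorph_nat => ->; rewrite /whitney_sum /chrom coef_sum_sum.
  have -> (s : seq ('I_m.+1 * 'I_m.+1)) : subseqs (map (@edge_form R m) s) =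
      map (map (@edge_form R m)) (subseqs s).
    by elim: s => //= e s ->; rewrite map_cat -!map_comp.
  rewrite big_map rmorph_sum; apply: eq_bigr => B _.
  rewrite coef_sumZ coef_sumXn rmorphXn rmorphN1 exprD size_map.
  rewrite rank_flow // rank_cap_flow // wE //.
  by apply: leq_trans (max_card _) _; rewrite card_ord.
rewrite sum_surj_chrom coef_sum_sum; apply: eq_bigr => A _.
rewrite coef_sumZ (@coef_sum_falling_weight R #|A| m.+1 d) //.
  have := max_card A; rewrite card_ord; lia.
by move=> j; rewrite /w !mulrA -mulrA -!exprD; rewrite mulrA -exprD
  (@eq_signr _ 0) ?mul1r //; lia.
Qed.

(** For each order [s] of the steps and each set [I] of size [k], either [I] is a
    face or [descends] holds. *)
Lemma total_faces :
  k%:R * (\sum_(s : 'S_m) #|face_sets (fun i : 'I_m.+1 => psum xi s i) k|)%N%:R +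
  surj_tail m.+1 d k = (k * (m`! * 'C(m.+1, k)))%N%:R :> R.
Proof.
rewrite -sum_listings_tail -sum_descends -natrM -natrD -mulnDr -big_split /=.
congr ((_ * _)%N%:R); transitivity (\sum_(s : 'S_m) 'C(m.+1, k))%N; last first.
  by rewrite sum_nat_const card_Sn.
apply: eq_bigr => s _.
rewrite -[in RHS](card_ord m.+1) -card_draws -!sum1_card.
rewrite !(big_mkcond (fun i => i \in _)) [X in (_ + X)%N]big_mkcond -big_split /=.
apply: eq_bigr => I _; rewrite !inE; case: eqP => //= Ik.
rewrite (descends_face s gen dm).
- by case: asboolP.
- by rewrite -card_gt0 Ik.
- by apply: contraTneq dm => IT; move: Ik; rewrite IT cardsT card_ord; lia.
Qed.

End Total.

(** * Measurability of the face events *)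

Lemma rat_approx (R : realType) (x e : R) : 0 < e -> exists q : rat, `|ratr q - x| < e.
Proof.
move=> e0; have [|q] := @rat_in_itvoo R (x - e) (x + e); first by lra.
rewrite in_itv /= => /andP[q1 q2]; exists q; rewrite ltr_norml.
by apply/andP; split; lra.
Qed.

(** An approximate supporting hyperplane with rational coefficients, scaled so
    that the points outside [I] are at least one unit away. *)
Definition near_face (R : realType) (d n : nat) (p : 'I_n -> 'rV[R]_d)
    (I : {set 'I_n}) (N : nat) (q : {ffun 'I_d -> rat} * rat) :=
  (forall i, i \in I -> `|\sum_j ratr (q.1 j) * p i 0 j - ratr q.2| < N.+1%:R^-1) /\
  (forall i, i \notin I -> \sum_j ratr (q.1 j) * p i 0 j - ratr q.2 < -1).

(** Exact faces are the sets with arbitrarily good rational approximations.  An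
    exact hyperplane, scaled up, is approximated by rounding.  Conversely, if there
    is no exact hyperplane, the affine relation of the Farkas alternative rules out
    approximations of high precision.  This displays [face_at] as a
    countable combination of linear inequalities, hence as measurable. *)
Lemma face_at_approx (R : realType) (d n : nat) (p : 'I_n -> 'rV[R]_d)
    (I : {set 'I_n}) :
  face_at p I <-> forall N, exists q, near_face p I N q.
Proof.
split=> [[u [b [Ib nIb]]] N|H].
  have [L L0 HL] : exists2 L : R, 0 < L & forall i, i \notin I -> L * (dot u (p i) - b) < -2.
    have [|e e0 He] := @small_multiple R _ (enum (~: I)) (fun i => b - dot u (p i))
      (fun => -2).
      by move=> i; rewrite mem_enum inE => /nIb H; left; rewrite subr_gt0.
    exists e^-1 => [|i iI]; first by rewrite invr_gt0.
    have := He e; rewrite e0 lexx => /(_ isT i); rewrite mem_enum inE => /(_ iI) H.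
    by rewrite mulrC ltr_pdivrMr //; lra.
  pose S := 1 + \sum_i \sum_j `|p i 0 j|.
  have Si i : 1 + \sum_j `|p i 0 j| <= S.
    rewrite /S lerD2l (bigD1 i) //= lerDl sumr_ge0 // => i' _.
    by apply: sumr_ge0.
  have S0 : 0 < S.
    by rewrite /S ltr_pwDl // sumr_ge0 // => i _; apply: sumr_ge0.
  pose eta : R := N.+1%:R^-1 / S / 2.
  have eta0 : 0 < eta by rewrite !divr_gt0 // invr_gt0 ltr0Sn.
  have selq j : {q : rat | `|ratr q - L * u 0 j| < eta} by apply: cid; exact: rat_approx.
  have [qb Hb] := rat_approx (L * b) eta0.
  exists ([ffun j => sval (selq j)], qb).
  have close i : `|\sum_j ratr (sval (selq j)) * p i 0 j - ratr qb - L * (dot u (p i) - b)|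
      < N.+1%:R^-1.
    have -> : \sum_j ratr (sval (selq j)) * p i 0 j - ratr qb - L * (dot u (p i) - b) =
        \sum_j (ratr (sval (selq j)) - L * u 0 j) * p i 0 j - (ratr qb - L * b).
      have -> : \sum_j (ratr (sval (selq j)) - L * u 0 j) * p i 0 j =
          \sum_j ratr (sval (selq j)) * p i 0 j - L * dot u (p i).
        by rewrite mulr_sumr -sumrB; apply: eq_bigr => j _; ring.
      by ring.
    apply: le_lt_trans (ler_normB _ _) _.
    apply: (@le_lt_trans _ _ (eta * S)); last first.
      have : 0 < N.+1%:R^-1 :> R by rewrite invr_gt0 ltr0Sn.
      rewrite /eta mulrAC divfK ?gt_eqF //; move: (_^-1) => a a0; lra.
    apply: le_trans (ler_wpM2l (ltW eta0) (Si i)).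
    rewrite mulrDr mulr1 addrC lerD // ?(ltW Hb) //.
    apply: le_trans (ler_norm_sum _ _ _) _; rewrite mulr_sumr; apply: ler_sum => j _.
    by rewrite normrM ler_wpM2r // ltW //; case: (selq j).
  split=> i iI /=; under eq_bigr do rewrite ffunE; have := close i.
    by rewrite Ib // subrr mulr0 subr0.
  rewrite ltr_norml => /andP[_ H]; have := HL i iI.
  have : N.+1%:R^-1 <= 1 :> R by rewrite invf_le1 ?ler1n ?ltr0Sn.
  by move: (N.+1%:R^-1) H => a; lra.
have [//|[c [c0 cp cge [i1 i1I ci1]]]] := face_at_or p I; exfalso.
pose s1 := \sum_(i | i \notin I) c i; pose s2 := \sum_(i in I) `|c i|.
have s10 : 0 < s1.
  rewrite /s1 (bigD1 i1) //= ltr_pwDl // sumr_ge0 // => i /andP[iI _]; exact: cge.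
have s20 : 0 <= s2 by apply: sumr_ge0.
have [N HN] : exists N : nat, s2 < s1 * N.+1%:R.
  exists (Num.bound (s2 / s1)); rewrite mulrC -ltr_pdivrMr //.
  apply: lt_le_trans (_ : (Num.bound (s2 / s1))%:R <= _).
    by apply: archi_boundP; rewrite divr_ge0 // ltW.
  by rewrite ler_nat.
have [q [q1 q2]] := H N.
pose g i := \sum_j ratr (q.1 j) * p i 0 j - ratr q.2.
have gsum : \sum_i c i * g i = 0.
  under eq_bigr do rewrite mulrBr.
  rewrite sumrB -mulr_suml c0 mul0r subr0.
  under eq_bigr do rewrite mulr_sumr.
  rewrite exchange_big /= big1 // => j _.
  have /(congr1 (fun z : 'rV_d => z 0 j)) := cp; rewrite summxE [RHS]mxE => cpj.
  transitivity (ratr (q.1 j) * \sum_i (c i *: p i) 0 j); last by rewrite cpj mulr0.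
  by rewrite mulr_sumr; apply: eq_bigr => i _; rewrite mxE; ring.
rewrite (bigID (mem I)) /= in gsum.
have h1 : \sum_(i | i \notin I) c i * g i <= - s1.
  rewrite -sumrN; apply: ler_sum => i iI; rewrite -mulrN1.
  by apply: ler_wpM2l; rewrite ?cge // ltW // q2.
have h2 : \sum_(i in I) c i * g i <= s2 * N.+1%:R^-1.
  rewrite mulr_suml; apply: ler_sum => i iI.
  apply: le_trans (ler_norm _) _; rewrite normrM ler_wpM2l // ltW // q1 //.
have : s2 * N.+1%:R^-1 < s1 by rewrite ltr_pdivrMr ?ltr0Sn.
by move: (s2 * _) h2 => a; lra.
Qed.

Section Measurable.
Variables (R : realType) (disp : measure_display) (T : measurableType disp).

Lemma measurable_lt_cst (f : T -> R) c :
  measurable_fun setT f -> measurable [set x | f x < c].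
Proof.
move=> mf; have -> : [set x | f x < c] = setT `&` f @^-1` `]-oo, c[.
  by rewrite setTI; apply/seteqP; split=> x /=; rewrite in_itv.
by apply: mf => //; exact: measurable_itv.
Qed.

Lemma forall_fin_measurable (J : finType) (Q : J -> set T) :
  (forall j, measurable (Q j)) -> measurable [set x | forall j, Q j x].
Proof.
move=> mQ; have -> : [set x | forall j, Q j x] = \bigcap_(j in setT) Q j.
  by apply/seteqP; split=> x Qx j //; apply: Qx.
by apply: fin_bigcap_measurable.
Qed.

Lemma imply_measurable (b : bool) (Q : set T) :
  measurable Q -> measurable [set x | b -> Q x].
Proof.
case: b => mQ.
  by rewrite (_ : [set x | true -> Q x] = Q) //; apply/seteqP; split=> x Qx //; apply: Qx.
by rewrite (_ : [set x | false -> Q x] = setT) //; apply/seteqP; split.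
Qed.

Lemma measurable_face_at (d n : nat) (p : T -> 'I_n -> 'rV[R]_d) (I : {set 'I_n}) :
  (forall i j, measurable_fun setT (fun x => p x i 0 j)) ->
  measurable [set x | face_at (p x) I].
Proof.
move=> mp.
have -> : [set x | face_at (p x) I] = \bigcap_N \bigcup_q [set x | near_face (p x) I N q].
  apply/seteqP; split=> x /=.
    by move=> /face_at_approx H N _; have [q] := H N; exists q.
  by move=> H; apply/face_at_approx => N; have [//|q _] := H N; exists q.
apply: bigcapT_measurable => N; apply: countable_bigcupT_measurable => [|q].
  exact: countableP.
have mlin i : measurable_fun setT (fun x => \sum_j ratr (q.1 j) * p x i 0 j - ratr q.2 : R).
  apply: measurable_funB => //; apply: measurable_sum => j.
  by apply: measurable_funM.
apply: measurableI; apply: forall_fin_measurable => i; apply: imply_measurable.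
  by apply: measurable_lt_cst; apply: measurableT_comp.
exact: measurable_lt_cst.
Qed.

Lemma measurable_det (d : nat) (M : T -> 'M[R]_d) :
  (forall i j, measurable_fun setT (fun x => M x i j)) ->
  measurable_fun setT (fun x => \det (M x)).
Proof.
move=> mM; apply: measurable_sum => s; apply: measurable_funM => //.
exact: measurable_prod.
Qed.

Lemma free_det (d : nat) (v : 'I_d -> 'rV[R]_d) :
  free [seq v j | j : 'I_d] = (\det (\matrix_j v j) != 0).
Proof.
have sz : size [seq v j | j : 'I_d] == d by rewrite size_map -cardE card_ord.
have nthv (i : 'I_d) : (Tuple sz)`_i = v i.
  by rewrite /= (nth_map i) -?cardE ?card_ord // nth_ord_enum.
rewrite -unitfE -[_ \is a _]/(\matrix_j v j \in unitmx) -row_free_unit.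
rewrite -[LHS]/(free (Tuple sz)).
apply/freeP/idP => [H|H k ks i].
  apply: inj_row_free => w wv; apply/rowP => i; rewrite mxE; apply: (H (fun i => w 0 i)).
  rewrite -[RHS]wv mulmx_sum_row; apply: eq_bigr => l _.
  by rewrite nthv rowK.
have : (\row_i k i) *m (\matrix_j v j) == 0.
  rewrite mulmx_sum_row -[X in _ == X]ks; apply/eqP; apply: eq_bigr => l _.
  by rewrite nthv rowK mxE.
by rewrite mulmx_free_eq0 // => /eqP/rowP/(_ i); rewrite !mxE.
Qed.

Lemma measurable_not_free (d : nat) (v : T -> 'I_d -> 'rV[R]_d) :
  (forall i j, measurable_fun setT (fun x => v x i 0 j)) ->
  measurable [set x | ~~ free [seq v x j | j : 'I_d]].
Proof.
move=> mv; have mdet : measurable_fun setT (fun x => \det (\matrix_j v x j)).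
  apply: measurable_det => i j.
  have -> : (fun x => (\matrix_j v x j) i j) = (fun x => v x i 0 j) by apply/funext => x; rewrite mxE.
  exact: mv.
have -> : [set x | ~~ free [seq v x j | j : 'I_d]] =
    setT `&` (fun x => \det (\matrix_j v x j)) @^-1` [set 0].
  by rewrite setTI; apply/seteqP; split=> x /=; rewrite free_det negbK;
    [move/eqP|move=> ->].
by apply: mdet => //; exact: measurable_set1.
Qed.

End Measurable.

(** * The expected number of faces *)

Section NoMeasurability.
Variables (disp : measure_display) (T : measurableType disp) (R : realType).
Variable (mu : {measure set T -> \bar R}).

Import HBNNSimple.

(** This holds without measurability, and serves for the number of faces, which
    agrees with a measurable function only almost everywhere.  The integral of a
    nonnegative function is a supremum over the simple functions below it, and
    these may be cut off on the null set. *)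
Lemma ae_ge0_le_integral (f g : T -> \bar R) :
  (forall x, 0 <= f x)%E -> (forall x, 0 <= g x)%E ->
  {ae mu, forall x, (f x <= g x)%E} -> (\int[mu]_x f x <= \int[mu]_x g x)%E.
Proof.
move=> f0 g0 [N [mN N0 fgN]]; rewrite !ge0_integralTE //.
apply: ge_ereal_sup => _ [h /= hf <-].
have mNC : measurable (~` N) by exact: measurableC.
rewrite -(_ : sintegral mu (proj_nnsfun h mNC) = sintegral mu h).
  apply: ereal_sup_ubound; exists (proj_nnsfun h mNC) => //= x.
  rewrite /proj_nnsfun /= /mindic /indic.
  have [xN|xN] := boolP (x \in ~` N); last by rewrite mulr0 g0.
  rewrite mulr1; apply: le_trans (hf x) _; rewrite inE in xN.
  by apply: contrapT => fg; apply/xN/fgN.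
rewrite -!integralT_nnsfun; apply: ge0_ae_eq_integral => //.
- by apply/measurable_EFinP; exact: measurable_funPT.
- by apply/measurable_EFinP; exact: measurable_funPT.
- by move=> x _; rewrite lee_fin.
- by move=> x _; rewrite lee_fin.
exists N; split=> // x /= H; apply: contrapT => xN; apply: H => _.
by rewrite /proj_nnsfun /= /mindic /indic mem_set // mulr1.
Qed.

Lemma ae_ge0_eq_integral (f g : T -> \bar R) :
  (forall x, 0 <= f x)%E -> (forall x, 0 <= g x)%E ->
  {ae mu, forall x, f x = g x} -> (\int[mu]_x f x = \int[mu]_x g x)%E.
Proof.
move=> f0 g0 fg; apply/eqP; rewrite eq_le !ae_ge0_le_integral //.
  by apply: filterS fg => x ->.
by apply: filterS fg => x ->.
Qed.

End NoMeasurability.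

Section Expected.
Variables (R : realType) (disp : measure_display) (T : measurableType disp).
Variables (P : probability T R) (m d k : nat) (xi : 'I_m -> T -> 'rV[R]_d).
Hypotheses (xi_meas : random_vectors xi) (xi_exch : exchangeable P xi)
  (xi_gp : general_position P xi).
Hypotheses (dm : (d <= m)%N) (k0 : (0 < k)%N) (kd : (k <= d)%N).

Let step (w : T) (j : 'I_m) : 'rV[R]_d := xi j w.

(** The steps as a function of a point of the space of joint values: events about
    the walk become measurable sets of that space, as needed for exchangeability. *)
Definition vecs (x : m.-tuple (d.-tuple R)) (j : 'I_m) : 'rV[R]_d :=
  \row_l tnth (tnth x j) l.

Lemma psum_joint (s : 'S_m) w i :
  psum (vecs (joint (fun j => xi (s j)) w)) 1 i = psum (step w) s i.
Proof.
apply: eq_bigr => j _; rewrite perm1; apply/rowP => l.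
by rewrite mxE !tnth_mktuple.
Qed.

Lemma measurable_psum_vecs (s : 'S_m) i l :
  measurable_fun setT (fun x : m.-tuple (d.-tuple R) => psum (vecs x) s i 0 l).
Proof.
rewrite (_ : (fun x => _) =
  (fun x : m.-tuple (d.-tuple R) => \sum_(j <- index_enum 'I_m | (j < i)%N) tnth (tnth x (s j)) l)).
  under eq_fun do rewrite big_mkcond; apply: measurable_sum => j.
  case: (j < i)%N => //.
  exact: (measurableT_comp (measurable_tnth l) (measurable_tnth (s j))).
by apply/funext => x; rewrite /psum summxE; apply: eq_bigr => j _; rewrite mxE.
Qed.

Lemma measurable_psum_step (s : 'S_m) i l :
  measurable_fun setT (fun w => psum (step w) s i 0 l).
Proof.
rewrite (_ : (fun x => _) =
  (fun w => \sum_(j <- index_enum 'I_m | (j < i)%N) xi (s j) w 0 l)).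
  under eq_fun do rewrite big_mkcond; apply: measurable_sum => j.
  by case: (j < i)%N => //; exact: xi_meas.
by apply/funext => x; rewrite /psum summxE.
Qed.

Definition face_event (s : 'S_m) (I : {set 'I_m.+1}) : set T :=
  [set w | face_at (fun i : 'I_m.+1 => psum (step w) s i) I].

Lemma measurable_face_event s I : measurable (face_event s I).
Proof. by apply: measurable_face_at => i j; exact: measurable_psum_step. Qed.

Lemma exchange_event (s : 'S_m) (A : set (m.-tuple (d.-tuple R))) : measurable A ->
  P [set w | A (joint (fun j => xi (s j)) w)] =
  P [set w | A (joint (fun j => xi ((1%g : 'S_m) j)) w)].
Proof.
move=> mA; have H := xi_exch s mA; have H1 := xi_exch 1%g mA.
by rewrite -[LHS]/(pushforward P _ A) -[RHS]/(pushforward P _ A) H H1.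
Qed.

Lemma prob_face_event s I : P (face_event s I) = P (face_event 1%g I).
Proof.
pose A := [set x : m.-tuple (d.-tuple R) |
  face_at (fun i : 'I_m.+1 => psum (vecs x) 1 i) I].
have mA : measurable A.
  by apply: measurable_face_at => i j; exact: measurable_psum_vecs.
have E s' : face_event s' I = [set w | A (joint (fun j => xi (s' j)) w)].
  apply/funext => w; rewrite /face_event /A /=; congr (face_at _ I).
  by apply/funext => i; rewrite psum_joint.
by rewrite !E exchange_event.
Qed.

Lemma psum_step1 w i : psum (step w) 1 i = partial_sum xi i w.
Proof. by apply: eq_bigr => j _; rewrite perm1. Qed.

(** General position is assumed for the given order of the steps; exchangeability
    carries it over to each of the finitely many orders. *)
Lemma ae_generic : {ae P, forall w, generic (step w)}.
Proof.
pose good (i : {ffun 'I_d -> 'I_m.+1}) := (forall j, (1 <= i j <= m)%N) /\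
  (forall j j' : 'I_d, (j < j')%N -> (i j < i j')%N).
have : {ae P, forall w, forall (s : 'S_m) (i : {ffun 'I_d -> 'I_m.+1}), good i ->
    free [seq psum (step w) s (i j) | j : 'I_d]}.
  apply: filter_forall => s; apply: filter_forall => i.
  have [gi|ngi] := pselect (good i); last by apply: filterE => w /ngi.
  pose D := [set x : m.-tuple (d.-tuple R) |
    ~~ free [seq psum (vecs x) 1 (i j) | j : 'I_d]].
  have mD : measurable D.
    by apply: measurable_not_free => a b; exact: measurable_psum_vecs.
  have E (s' : 'S_m) : [set w | D (joint (fun j => xi (s' j)) w)] =
      [set w | ~~ free [seq psum (step w) s' (i j) | j : 'I_d]].
    apply/funext => w; rewrite /D /=; congr (is_true (~~ free _)).
    by apply: eq_map => j; rewrite psum_joint.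
  exists [set w | ~~ free [seq psum (step w) s (i j) | j : 'I_d]]; split.
  - by apply: measurable_not_free => a b; exact: measurable_psum_step.
  - rewrite -E exchange_event // E -(xi_gp gi.1 gi.2); congr (P _).
    apply/funext => w /=; congr (is_true (~~ free _)).
    by apply: eq_map => j; rewrite psum_step1.
  - by move=> w /= H; apply/negP => fr; apply: H => _.
apply: filterS => w H s i i1 i2.
have iE j : val (inord (i j) : 'I_m.+1) = i j.
  by rewrite /= inordK // ltnS; have /andP[] := i1 j.
have := H s [ffun j => inord (i j)].
have -> : [seq psum (step w) s ([ffun j => inord (i j)] j : 'I_m.+1) | j : 'I_d] =
    [seq psum (step w) s (i j) | j : 'I_d].
  by apply: eq_map => j; rewrite ffunE -[X in psum _ _ X]/(val _) iE.
apply; split=> [j|j j' jj']; rewrite !ffunE -[nat_of_ord _]/(val _) iE //.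
by rewrite -[X in (_ < X)%N]/(val _) iE i2.
Qed.

Definition face_count (s : 'S_m) (w : T) : nat :=
  #|face_sets (fun i : 'I_m.+1 => psum (step w) s i) k|.

Lemma face_countE s w : (face_count s w)%:R =
  \sum_(I : {set 'I_m.+1} | #|I| == k) \1_(face_event s I) w :> R.
Proof.
rewrite /face_count -sum1_card natr_sum [LHS]big_mkcond [RHS]big_mkcond.
apply: eq_bigr => I _; rewrite inE; case: eqP => //= _.
rewrite indicE /face_event; case: asboolP => H; last by rewrite memNset.
by rewrite mem_set.
Qed.

Lemma measurable_face_count s : measurable_fun setT (fun w => (face_count s w)%:R : R).
Proof.
under eq_fun do rewrite face_countE big_mkcond; apply: measurable_sum => I.
case: (#|I| == k) => //; apply: measurable_indic; exact: measurable_face_event.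
Qed.

Lemma integral_face_count s : (\int[P]_w (face_count s w)%:R%:E =
  \sum_(I : {set 'I_m.+1} | #|I| == k) P (face_event s I))%E.
Proof.
under eq_integral do rewrite face_countE -sumEFin big_mkcond.
rewrite ge0_integral_sum //; last 2 first.
- move=> I; case: (#|I| == k) => //; apply/measurable_EFinP.
  apply: measurable_indic; exact: measurable_face_event.
- by move=> I w _; case: (#|I| == k) => //; rewrite lee_fin indicE.
rewrite [RHS]big_mkcond; apply: eq_bigr => I _; case: (#|I| == k).
  by rewrite integral_indic ?setIT //; exact: measurable_face_event.
by rewrite integral0.
Qed.

Lemma walk_hullE w :
  walk_hull xi w = conv_hull [set psum (step w) 1 (i : 'I_m.+1) | i in [set: 'I_m.+1]].
Proof.
rewrite /walk_hull; congr conv_hull; apply/seteqP; split=> x [i im <-].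
  have im' : (i < m.+1)%N by rewrite ltnS.
  by exists (Ordinal im') => //=; rewrite psum_step1.
by exists i => /=; rewrite ?psum_step1 // -ltnS.
Qed.

(** By exchangeability the expected number of faces is the same for all orders of
    the steps, and almost surely the sum over all orders is the constant given by
    [total_faces]. *)
Theorem expected_faces_formula : expected_faces P xi k.-1 =
  (((k * (m`! * 'C(m.+1, k)))%N%:R - surj_tail R m.+1 d k) / (k%:R * m`!%:R))%:E.
Proof.
have -> : expected_faces P xi k.-1 = (\int[P]_w (face_count 1%g w)%:R%:E)%E.
  rewrite /expected_faces unlock; apply: ae_ge0_eq_integral => [w|w|].
  - by rewrite lee_fin.
  - by rewrite lee_fin.
  apply: filterS ae_generic => w gen; rewrite walk_hullE num_faces_hull //.
  by move=> I i0 i0I; exact: dim_dirs.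
set e := (\int[P]_w _)%E.
have eE s : (\int[P]_w (face_count s w)%:R%:E)%E = e.
  rewrite /e !integral_face_count; apply: eq_bigr => I _; exact: prob_face_event.
pose C : R := ((k * (m`! * 'C(m.+1, k)))%N%:R - surj_tail R m.+1 d k) / k%:R.
have k0' : k%:R != 0 :> R by rewrite pnatr_eq0 -lt0n.
have m0' : m`!%:R != 0 :> R by rewrite pnatr_eq0 -lt0n fact_gt0.
have CE w : generic (step w) -> \sum_(s : 'S_m) (face_count s w)%:R = C.
  move=> gen; rewrite -natr_sum /C -(total_faces gen dm k0 kd) addrK.
  by rewrite mulrAC divff // mul1r.
have sumE : (\sum_(s : 'S_m) e)%E = C%:E.
  under eq_bigr => s _ do rewrite -(eE s).
  rewrite -ge0_integral_sum //; last first.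
    by move=> s; apply/measurable_EFinP; exact: measurable_face_count.
  transitivity (\int[P]_w C%:E)%E; last first.
    rewrite integral_cst //; by rewrite -[X in (_ * X)%E]/(P setT) probability_setT mule1.
  apply: ae_eq_integral => //.
    by apply: emeasurable_sum => s; apply/measurable_EFinP; exact: measurable_face_count.
  by apply: filterS ae_generic => w gen _; rewrite sumEFin CE.
have efin : e \is a fin_num.
  rewrite /e integral_face_count; apply/sum_fin_numP => I _ _.
  by apply: fin_num_measure; exact: measurable_face_event.
move: sumE; rewrite -(fineK efin) sumEFin sumr_const card_Sn => -[] fE.
congr EFin; rewrite invfM mulrA -[X in X / _]/(C) -fE.
by rewrite -(mulr_natr (fine e)) mulfK.
Qed.

End Expected.

(** * Stein's equation for the Gaussian law *)

Section Gauss.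
Variable R : realType.
Notation mu := (@lebesgue_measure R).
Implicit Types (f g h : R -> R) (x y z : R).

Definition phi : R -> R := normal_pdf 0 1.

Lemma phiE x : phi x = (Num.sqrt (2 * pi))^-1 * expR (- (x ^+ 2) / 2).
Proof.
rewrite /phi normal_pdfE ?oner_neq0 // /normal_peak /normal_fun subr0 expr1n mul1r.
by rewrite mulr_natl.
Qed.

Lemma phi_gt0 x : 0 < phi x.
Proof.
rewrite phiE mulr_gt0 ?expR_gt0 // invr_gt0 sqrtr_gt0 mulr_gt0 ?ltr0n //.
exact: pi_gt0.
Qed.

Lemma phi_le1 x : phi x <= 1.
Proof.
rewrite phiE -[leRHS]mulr1; apply: ler_pM; rewrite ?invr_ge0 ?sqrtr_ge0 ?expR_ge0 //.
- rewrite invf_le1 ?sqrtr_gt0 ?mulr_gt0 ?pi_gt0 ?ltr0n // -[leLHS]sqrtr1.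
  by rewrite ler_sqrt; have := @pi_ge2 R; lra.
- by rewrite -[leRHS]expR0 ler_expR; have := sqr_ge0 x; lra.
Qed.

Lemma is_derive_phi x : is_derive x 1 phi (- x * phi x).
Proof.
have -> : phi = (fun y => (Num.sqrt (2 * pi))^-1 * expR (- (y ^+ 2) / 2)).
  by apply/funext => y; rewrite phiE.
apply: is_derive_eq. rewrite /= /GRing.scale /= !mulr0 add0r.
by move: (Num.sqrt _)^-1 (expR _) => a b; field.
Qed.

Lemma continuous_phi : continuous phi.
Proof. exact: continuous_normal_pdf. Qed.

Lemma integrable_phi : mu.-integrable setT (EFin \o phi).
Proof. exact: integrable_normal_pdf. Qed.

Lemma Rintegral_phi : \int[mu]_x phi x = 1.
Proof. by rewrite /Rintegral integral_normal_pdf. Qed.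

Definition lip (L : R) f := forall x y, `|f x - f y| <= L * `|x - y|.

Lemma lip_continuous L f : lip L f -> continuous f.
Proof.
move=> fL x; apply/cvgrPdist_le => e e0.
have L1 : 0 < 1 + `|L| by rewrite ltr_pwDl.
near=> y; apply: le_trans (fL _ _) _.
apply: (@le_trans _ _ ((1 + `|L|) * `|x - y|)).
  by apply: ler_wpM2r => //; have := ler_norm L; lra.
rewrite mulrC -ler_pdivlMr //; near: y; apply/nbhs_ballP.
by exists (e / (1 + `|L|)) => [|y /= /ltW //]; rewrite /= divr_gt0.
Unshelve. all: by end_near. Qed.

Lemma integrable_bounded_phi h (K : R) : measurable_fun setT h -> (forall x, `|h x| <= K) ->
  mu.-integrable setT (EFin \o (fun x => h x * phi x)).
Proof.
move=> mh hK; apply: (@le_integrable _ (measurableTypeR R) R mu setT measurableT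
  (EFin \o (fun x => h x * phi x)) (EFin \o (fun x => K * phi x))).
- apply/measurable_EFinP; apply: measurable_funM => //.
  exact: continuous_measurable_fun continuous_phi.
- move=> x _ /=; rewrite lee_fin !normrM ler_wpM2r //.
  by apply: le_trans (hK x) _; exact: ler_norm.
- have -> : EFin \o (fun x => K * phi x) = (fun x => K%:E * (EFin \o phi) x)%E.
    by apply/funext => x /=; rewrite EFinM.
  apply: integrableZl => //; exact: integrable_phi.
Qed.

Lemma compact_support_bounded f (B : R) : 0 < B -> continuous f ->
  (forall x, B <= `|x| -> f x = 0) -> exists2 K : R, 0 < K & forall x, `|f x| <= K.
Proof.
move=> B0 cf f0.
have BB : - B <= B by lra.
have cnf : {within `[- B, B], continuous (fun x => `|f x|)}.
  apply: continuous_subspaceT => x; apply: cvg_norm; exact: cf.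
have [c _ Hc] := EVT_max BB cnf.
exists (1 + `|f c|) => [|x]; first by rewrite ltr_pwDl.
have [xB|xB] := lerP B `|x|; first by rewrite f0 // normr0 addr_ge0.
have := Hc x; rewrite in_itv /= => H; apply: le_trans (H _) _; last by rewrite lerDr.
by move: xB; rewrite ltr_norml => /andP[/ltW -> /ltW ->].
Qed.

(** The solution of Stein's equation [f' = x f + g] for a test function [g] of
    Gaussian mean zero is [f = F / phi], where [F] is the primitive of [g phi].
    Outside a segment containing the support of [g] both [F] and [f] vanish, so
    that all quantities are bounded. *)
Lemma stein_solution g (L B : R) : 0 < B -> lip L g -> (forall x, B <= `|x| -> g x = 0) ->
  \int[mu]_x (g x * phi x) = 0 ->
  exists (f f1 : R -> R) (K : R), [/\ 0 < K,
    forall x, is_derive x 1 f (f1 x), forall x, f1 x = x * f x + g x,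
    forall x, `|f x| <= K /\ `|f1 x| <= K & lip K f1].
Proof.
move=> B0 gL gB g0.
have cg := lip_continuous gL.
have [Kg Kg0 HKg] := compact_support_bounded B0 cg gB.
pose w x := g x * phi x.
have iw : mu.-integrable setT (EFin \o w) 
  by apply: integrable_bounded_phi HKg; exact: continuous_measurable_fun.
have cw : continuous w.
  by move=> x; apply: cvgM; [exact: cg|exact: continuous_phi].
pose F y := \int[mu]_(t in `]-oo, y]) w t.
have dF x : is_derive x 1 F (w x).
  have xx : x < x + 1 by rewrite ltrDl.
  have ix : mu.-integrable [set` Interval -oo%O (BRight (x + 1))] (EFin \o w).
    apply: (@integrableS _ _ _ mu setT _ _ measurableT); [exact: measurable_itv|by []|exact: iw].
  have [dF F'] := continuous_FTC1 xx ix (ltNyr _) (cw x).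
  by split=> //; rewrite -derive1E.
have wB x : B <= `|x| -> w x = 0 by move=> /gB xB; rewrite /w xB mul0r.
have FB x : B <= `|x| -> F x = 0.
  move=> xB; have [x0|x0] := lerP x 0.
    rewrite /F (@eq_Rintegral _ _ _ _ _ (cst 0)); last first.
      move=> t; rewrite inE /= in_itv /= => tx; apply: wB.
      by rewrite ler0_norm in xB => //; rewrite ler0_norm; lra.
    by rewrite Rintegral_cst //= mul0r.
  rewrite -[RHS]g0 /F Rintegral_mkcond; apply: eq_Rintegral => t _.
  rewrite patchE; case: ifPn => // /negP; rewrite inE /= in_itv /= => /negP.
  rewrite -ltNge => xt; apply/esym/wB.
  by rewrite gtr0_norm in xB => //; rewrite gtr0_norm; lra.
pose f x := F x / phi x; pose f1 x := x * f x + g x.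
have df x : is_derive x 1 f (f1 x).
  have pn0 : phi x != 0 by rewrite gt_eqF // phi_gt0.
  have dV := @is_deriveV _ phi x _ 1 pn0 (is_derive_phi x).
  have H := @is_deriveM _ _ F (fun y => (phi y)^-1) x 1 _ _ (dF x) dV.
  have <- : F x *: (- phi x ^- 2 *: (- x * phi x)) + (phi x)^-1 *: w x = f1 x.
    by rewrite /f1 /f /w /GRing.scale /=; field.
  exact: H.
have cf : continuous f.
  move=> x; apply: differentiable_continuous; apply/derivable1_diffP.
  by have [] := df x.
have fB x : B <= `|x| -> f x = 0 by move=> /FB xB; rewrite /f xB mul0r.
have [Kf Kf0 HKf] := compact_support_bounded B0 cf fB.
have f1B x : B <= `|x| -> f1 x = 0.
  by move=> xB; rewrite /f1 fB // gB // mulr0 addr0.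
have Hf1 x : `|f1 x| <= B * Kf + Kg.
  apply: le_trans (ler_normD _ _) _; apply: lerD => //.
  have [xB|xB] := lerP B `|x|; last by rewrite normrM ler_pM // ltW.
  by rewrite fB // mulr0 normr0 mulr_ge0 // ltW.
have Kf1 : 0 < B * Kf + Kg by rewrite addr_gt0 // mulr_gt0.
pose xf x := x * f x.
have dxf x : is_derive x 1 xf (f x + x * f1 x).
  have H := @is_deriveM _ _ id f x 1 _ _ (is_derive_id _ _) (df x).
  have <- : x *: f1 x + f x *: 1 = f x + x * f1 x by rewrite /GRing.scale /=; ring.
  exact: H.
have Hdxf x : `|f x + x * f1 x| <= Kf + B * (B * Kf + Kg).
  apply: le_trans (ler_normD _ _) _; apply: lerD => //.
  have [xB|xB] := lerP B `|x|; last by rewrite normrM ler_pM // ltW.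
  by rewrite f1B // mulr0 normr0 mulr_ge0 // ltW.
have lxf : lip (Kf + B * (B * Kf + Kg)) xf.
  have H x y : x < y -> `|xf x - xf y| <= (Kf + B * (B * Kf + Kg)) * `|x - y|.
    move=> xy; have [|c _ E] := @MVT _ xf (fun x => f x + x * f1 x) x y xy (fun t _ => dxf t).
      apply: continuous_subspaceT => t; apply: differentiable_continuous.
      by apply/derivable1_diffP; have [] := dxf t.
    by rewrite distrC E normrM (distrC x) ler_wpM2r.
  move=> x y; have [xy|yx|->] := ltgtP x y; first exact: H.
    by rewrite distrC (distrC x); exact: H.
  by rewrite !subrr normr0 mulr0.
pose K := Kf + (B * Kf + Kg) + (Kf + B * (B * Kf + Kg)) + `|L|.
have BK : 0 < B * (B * Kf + Kg) by rewrite mulr_gt0.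
have L0 : 0 <= `|L| by [].
exists f, f1, K; split=> //.
- by rewrite /K; lra.
- by move=> x; split; [apply: le_trans (HKf x) _|apply: le_trans (Hf1 x) _]; rewrite /K; lra.
- move=> x y; rewrite /f1 opprD addrACA; apply: le_trans (ler_normD _ _) _.
  have := lerD (lxf x y) (gL x y) => H; apply: le_trans H _.
  rewrite -mulrDl ler_wpM2r //; have := ler_norm L; rewrite /K; lra.
Qed.

End Gauss.

(** * Stein's method for Bernoulli sums *)

Section Trap.
Variable R : realType.
Implicit Types (a b e x y : R).

(** For [a <= b], the function with graph a trapezoid: [1] on the segment from
    [a] to [b], [0] beyond distance [e] from it, and affine in between. *)
Definition trap a b e x : R := Num.max 0 (Num.min 1 (1 + Num.min (x - a) (b - x) / e)).

Lemma trap_ge0 a b e x : 0 <= trap a b e x.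
Proof. by rewrite /trap le_max lexx. Qed.

Lemma trap_le1 a b e x : trap a b e x <= 1.
Proof. by rewrite /trap ge_max ler01 ge_min lexx. Qed.

Lemma trap_in a b e x : 0 < e -> a <= x <= b -> trap a b e x = 1.
Proof.
move=> e0 /andP[ax xb]; apply/le_anti; rewrite trap_le1 /= /trap le_max le_min lexx /=.
by rewrite lerDl divr_ge0 ?orbT ?(ltW e0) // le_min !subr_ge0 ax.
Qed.

Lemma trap_out a b e x : 0 < e -> x <= a - e \/ b + e <= x -> trap a b e x = 0.
Proof.
move=> e0 H; apply/le_anti; rewrite trap_ge0 andbT /trap ge_max lexx ge_min /=.
apply/orP; right; have -> : 0 = 1 + (- e) / e :> R by rewrite mulNr divff ?gt_eqF // subrr.
rewrite lerD2l ler_pM2r ?invr_gt0 // ge_min; case: H => H; apply/orP; [left|right]; lra.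
Qed.

Lemma max_dist a x y : `|Num.max a x - Num.max a y| <= `|x - y|.
Proof.
have := ler_norm (x - y); have := ler_norm (y - x); rewrite distrC => h1 h2.
by rewrite ler_norml; case: (lerP a x) => ?; case: (lerP a y) => ?; apply/andP; split; lra.
Qed.

Lemma min_dist a x y : `|Num.min a x - Num.min a y| <= `|x - y|.
Proof.
have := ler_norm (x - y); have := ler_norm (y - x); rewrite distrC => h1 h2.
by rewrite ler_norml; case: (lerP a x) => ?; case: (lerP a y) => ?; apply/andP; split; lra.
Qed.

Lemma min2_dist a b x y : `|Num.min (x - a) (b - x) - Num.min (y - a) (b - y)| <= `|x - y|.
Proof.
have := ler_norm (x - y); have := ler_norm (y - x); rewrite distrC => h1 h2.
rewrite ler_norml; case: (lerP (x - a) (b - x)) => ?; case: (lerP (y - a) (b - y)) => ?;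
  apply/andP; split; lra.
Qed.

Lemma trap_lip a b e : 0 < e -> lip e^-1 (trap a b e).
Proof.
move=> e0 x y; apply: le_trans (max_dist _ _ _) _; apply: le_trans (min_dist _ _ _) _.
rewrite opprD addrACA subrr add0r -mulrBl normrM mulrC gtr0_norm ?invr_gt0 //.
by rewrite ler_pM2l ?invr_gt0 // min2_dist.
Qed.

End Trap.

Section SteinBound.
Variable R : realType.
Implicit Types (s : seq R) (f g : R -> R).

Lemma taylor1 f (f1 : R -> R) (K x h : R) : 0 < h ->
  (forall x : R, is_derive x 1 f (f1 x)) -> lip K f1 ->
  0 < K ->
  `|f (x + h) - f x - f1 x * h| <= K * h ^+ 2 /\
  `|f (x + h) - f x - f1 (x + h) * h| <= K * h ^+ 2.
Proof.
move=> h0 df lf K0.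
have xh : x < x + h by rewrite ltrDl.
have [|c + ->] := @MVT _ f f1 x (x + h) xh (fun t _ => df t).
  apply: continuous_subspaceT => t; apply: differentiable_continuous.
  by apply/derivable1_diffP; have [] := df t.
rewrite in_itv /= => /andP[xc ch]; rewrite addrAC subrr add0r -!mulrBl !normrM (gtr0_norm h0).
rewrite expr2 mulrA; split; apply: ler_wpM2r; rewrite ?(ltW h0) //;
  apply: le_trans (lf _ _) _; apply: ler_wpM2l; rewrite ?(ltW K0) //;
  rewrite ler_norml; apply/andP; split; lra.
Qed.

(** Stein's method: the mean of [g = f' - x f] at the normalized sum is small, as
    by [stein_bernoulli] the mean of [x f] is close to that of [f'] when the
    normalization is close to the true mean and variance. *)
Lemma stein_bexp s f (f1 : R -> R) g (K m sg : R) : probs s -> 0 < sg -> 0 < K ->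
  (forall x : R, is_derive x 1 f (f1 x)) -> (forall x, f1 x = x * f x + g x) ->
  (forall x, `|f x| <= K /\ `|f1 x| <= K) -> lip K f1 ->
  `|bexp s (fun j => g ((j%:R - m) / sg))| <=
     K * (`|1 - var s / sg ^+ 2| + var s / sg ^+ 3 + `|mean s - m| / sg).
Proof.
move=> ps sg0 K0 df f1E fK lf1.
pose W (j : nat) : R := (j%:R - m) / sg.
have si0 : 0 < sg^-1 by rewrite invr_gt0.
have WS j : W j.+1 = W j + sg^-1 by rewrite /W -natr1 addrAC mulrDl mul1r.
pose F j := f (W j); pose D j := f1 (W j) / sg.
have H0 j : `|F j.+1 - F j - D j| <= K * sg^-1 ^+ 2.
  by rewrite /F /D WS; have [] := taylor1 (W j) si0 df lf1 K0.
have H1 j : `|F j.+1 - F j - D j.+1| <= K * sg^-1 ^+ 2.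
  by rewrite /F /D WS; have [] := taylor1 (W j) si0 df lf1 K0.
have := stein_bernoulli ps H0 H1.
set M := mean s; set V := var s; set X := bexp s (fun j => (j%:R - M) * F j).
have V0 : 0 <= V by exact: var_ge0.
have -> : bexp s D = sg^-1 * bexp s (fun j => f1 (W j)).
  by rewrite -bexpZ; apply: eq_bexp => j; rewrite /D mulrC.
set Y := bexp s (fun j => f1 (W j)) => HX.
set Z := bexp s F.
have EZ : `|Z| <= K by apply: bexp_norm_le => // j; case: (fK (W j)).
have EY : `|Y| <= K by apply: bexp_norm_le => // j; case: (fK (W j)).
have EX : bexp s (fun j => g (W j)) = Y - sg^-1 * (X + (M - m) * Z).
  rewrite /X /Z -bexpZ -bexpD -mulNr -bexpZ -bexpD; apply: eq_bexp => j.
  have -> : g (W j) = f1 (W j) - W j * f (W j) by rewrite f1E; ring.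
  by rewrite /F /W; ring.
have -> : bexp s (fun j => g (W j)) = (1 - V / sg ^+ 2) * Y
    - sg^-1 * (X - V * (sg^-1 * Y)) - (M - m) / sg * Z.
  by rewrite EX; field; rewrite gt_eqF.
rewrite !(mulrDr K); apply: le_trans (ler_normB _ _) _; apply: lerD.
  apply: le_trans (ler_normB _ _) _; apply: lerD.
    by rewrite normrM mulrC ler_wpM2r.
  rewrite normrM (gtr0_norm si0) mulrC -ler_pdivlMr // invrK.
  apply: le_trans HX _; rewrite le_eqVlt; apply/orP; left; apply/eqP.
  by field; rewrite gt_eqF.
by rewrite normrM mulrC ler_pM // normrM (gtr0_norm si0).
Qed.

End SteinBound.

(** * The Gaussian distribution function *)

Section Normal.
Variable R : realType.
Notation mu := (@lebesgue_measure R).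
Implicit Types (g h : R -> R) (x y z a b e : R).

Definition Phi z : R := \int[mu]_(x in `]-oo, z]) phi x.

Definition gauss_mean h : R := \int[mu]_x (h x * phi x).

Definition bounded_meas h := measurable_fun setT h /\ exists K : R, forall x, `|h x| <= K.

Lemma bounded_meas_integrable h : bounded_meas h ->
  mu.-integrable setT (EFin \o (fun x => h x * phi x)).
Proof. by move=> [mh [K hK]]; exact: integrable_bounded_phi hK. Qed.

Lemma bounded_meas_trap a b e : 0 < e -> bounded_meas (trap a b e).
Proof.
move=> e0; split; first exact: continuous_measurable_fun (lip_continuous (trap_lip a b e0)).
by exists 1 => x; rewrite ger0_norm ?trap_ge0 ?trap_le1.
Qed.

Lemma bounded_meas_indic (A : set R) : measurable A -> bounded_meas \1_A.
Proof.
move=> mA; split; first exact: measurable_indic.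
by exists 1 => x; rewrite indicE; case: (x \in A); rewrite ?normr1 ?normr0.
Qed.

Lemma gauss_mean_le g h : bounded_meas g -> bounded_meas h ->
  (forall x, g x <= h x) -> gauss_mean g <= gauss_mean h.
Proof.
move=> bg bh gh; apply: le_Rintegral => //; try exact: bounded_meas_integrable.
by move=> x _; rewrite ler_wpM2r // ltW // phi_gt0.
Qed.

Lemma gauss_meanB g h c : bounded_meas g -> bounded_meas h ->
  gauss_mean (fun x => g x - c * h x) = gauss_mean g - c * gauss_mean h.
Proof.
move=> bg bh; rewrite /gauss_mean -RintegralZl //; last exact: bounded_meas_integrable.
rewrite -RintegralB //.
- by apply: eq_Rintegral => x _; ring.
- exact: bounded_meas_integrable.
- have -> : EFin \o (fun x => c * (h x * phi x)) =
      (fun x => c%:E * (EFin \o (fun x => (h x * phi x)%R)) x)%E.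
    by apply/funext => x /=; rewrite EFinM.
  apply: integrableZl => //; exact: bounded_meas_integrable.
Qed.

Lemma gauss_mean1 : gauss_mean (cst 1) = 1.
Proof.
by rewrite -[RHS](Rintegral_phi R); apply: eq_Rintegral => x _; rewrite mul1r.
Qed.

Lemma bounded_meas_cst c : bounded_meas (cst c).
Proof. by split=> //; exists `|c|. Qed.

Lemma PhiE z : Phi z = gauss_mean \1_`]-oo, z].
Proof.
rewrite /Phi Rintegral_mkcond; apply: eq_Rintegral => x _.
by rewrite patchE indicE; case: (x \in _); rewrite ?mul1r ?mul0r.
Qed.

Lemma in_itvNy z x : (x \in [set` `]-oo, z]]) = (x <= z).
Proof. by apply/idP/idP; rewrite inE /= in_itv. Qed.

Lemma Phi_le1 z : Phi z <= 1.
Proof.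
rewrite PhiE -gauss_mean1; apply: gauss_mean_le.
- exact: bounded_meas_indic.
- exact: bounded_meas_cst.
- by move=> x; rewrite indicE; case: (x \in _).
Qed.

Lemma Phi_ge0 z : 0 <= Phi z.
Proof. by apply: Rintegral_ge0 => x _; exact/ltW/phi_gt0. Qed.

Lemma gauss_trap_le a b e : 0 < e -> gauss_mean (trap a b e) <= Phi (b + e).
Proof.
move=> e0; rewrite PhiE; apply: gauss_mean_le.
- exact: bounded_meas_trap.
- exact: bounded_meas_indic.
- move=> x; rewrite indicE in_itvNy; case: (lerP x (b + e)) => [_|xb] /=; first exact: trap_le1.
  by rewrite trap_out //; right; exact: ltW.
Qed.

Lemma gauss_trap_le1 a b e : 0 < e -> gauss_mean (trap a b e) <= 1.
Proof. by move=> e0; apply: le_trans (Phi_le1 _); exact: gauss_trap_le. Qed.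

Lemma Phi_diff a b : Phi b - Phi a = gauss_mean (fun x => \1_`]-oo, b] x - 1 * \1_`]-oo, a] x).
Proof. by rewrite gauss_meanB ?mul1r ?PhiE //; exact: bounded_meas_indic. Qed.

Lemma bounded_measB g h c : bounded_meas g -> bounded_meas h ->
  bounded_meas (fun x => g x - c * h x).
Proof.
move=> [mg [K gK]] [mh [K' hK]]; split.
  by apply: measurable_funB => //; exact: measurable_funM.
exists (K + `|c| * K') => x; apply: le_trans (ler_normB _ _) _.
by rewrite lerD // normrM ler_wpM2l.
Qed.

Lemma gauss_trap_ge a b e : 0 < e -> Phi b - Phi a <= gauss_mean (trap a b e).
Proof.
move=> e0; rewrite Phi_diff; apply: gauss_mean_le.
- by apply: bounded_measB; exact: bounded_meas_indic.
- exact: bounded_meas_trap.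
- move=> x; rewrite !indicE !in_itvNy mul1r.
  case: (lerP x b) => xb; case: (lerP x a) => xa; rewrite /= ?subrr ?subr0 ?sub0r ?trap_ge0 //.
    by rewrite trap_in // (ltW xa).
  by rewrite (le_trans _ (trap_ge0 _ _ _ _)) // lerN10.
Qed.

Lemma is_derive_Phi z : is_derive z 1 Phi (phi z).
Proof.
have zz : z < z + 1 by rewrite ltrDl.
have iz : mu.-integrable [set` Interval -oo%O (BRight (z + 1))] (EFin \o @phi R).
  apply: (@integrableS _ _ _ mu setT _ _ measurableT); [exact: measurable_itv|by []|].
  exact: integrable_phi.
have [dF F'] := continuous_FTC1 zz iz (ltNyr _) (@continuous_phi R z).
by split=> //; rewrite -derive1E.
Qed.

Lemma Phi_lip x e : 0 < e -> Phi (x + e) <= Phi x + e.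
Proof.
move=> e0; have xe : x < x + e by rewrite ltrDl.
have [|c _ E] := @MVT _ Phi (@phi R) x (x + e) xe (fun t _ => is_derive_Phi t).
  apply: continuous_subspaceT => t; apply: differentiable_continuous.
  by apply/derivable1_diffP; have [] := is_derive_Phi t.
rewrite -lerBlDl E addrAC subrr add0r.
by rewrite -[leRHS]mul1r ler_wpM2r ?phi_le1 // ltW.
Qed.

(** Continuity of the Gaussian measure along growing segments. *)
Lemma Phi_tails e b : 0 < e -> exists2 A : R, b <= A & 1 - e <= Phi A - Phi (- A).
Proof.
move=> e0; pose F (n : nat) : set (measurableTypeR R) := [set` `]- n%:R, n%:R : R]].
have mF n : measurable (F n) by exact: measurable_itv.
have UF : \bigcup_n F n = setT.
  apply/seteqP; split=> // x _; exists (Num.bound `|x|) => //.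
  have := archi_boundP (normr_ge0 x); rewrite ltr_norml => /andP[h1 /ltW h2].
  by rewrite /F /= in_itv /= h1 h2.
have ndF : nondecreasing_seq F.
  move=> p q pq; apply/subsetPset => x; rewrite /F /= !in_itv /= => /andP[x1 x2].
  have : p%:R <= q%:R :> R by rewrite ler_nat.
  by move=> pq'; apply/andP; split; lra.
have H := @nondecreasing_cvg_mu _ _ _ (normal_prob (0 : R) 1) F mF
  (bigcupT_measurable F mF) ndF.
have FE (n : nat) : normal_prob (0 : R) 1 (F n) = (Phi n%:R - Phi (- n%:R))%:E.
  rewrite Phi_diff /normal_prob /gauss_mean /Rintegral fineK; last first.
    apply: integrable_fin_num => //; apply: bounded_meas_integrable.
    by apply: bounded_measB; exact: bounded_meas_indic.
  rewrite [LHS]integral_mkcond; apply: eq_integral => x _ /=.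
  rewrite patchE !indicE !in_itvNy mul1r.
  have -> : (x \in F n) = (- n%:R < x <= n%:R).
    by apply/idP/idP; rewrite /F inE /= in_itv.
  have n0 : 0 <= n%:R :> R by [].
  case: (lerP x n%:R) => xn; case: (lerP x (- n%:R)) => xn' //=; rewrite ?subrr ?subr0 ?mul1r ?mul0r //.
  exfalso; lra.
have N1 : normal_prob (0 : R) 1 setT = 1%E by rewrite /normal_prob integral_normal_pdf.
rewrite UF in H.
have {}H : (fun n : nat => (Phi n%:R - Phi (- n%:R))%:E) @ \oo --> (1 : \bar R)%E.
  by rewrite -N1; apply: cvg_trans H; apply: near_eq_cvg; apply: nearW => n /=; rewrite -FE.
have {}H : (fun n : nat => Phi n%:R - Phi (- n%:R)) @ \oo --> (1 : R).
  by move/fine_cvgP : H => [].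
have /cvgrPdist_le/(_ e e0) := H => -[N _ HN].
pose n := maxn N (Num.bound `|b|); exists n%:R.
  apply: (@le_trans _ _ (Num.bound `|b|)%:R); last by rewrite ler_nat leq_maxr.
  by apply: le_trans (ler_norm _) _; apply/ltW/archi_boundP.
have := HN n (leq_maxl _ _); rewrite /= => /(le_trans (ler_norm _)); lra.
Qed.

End Normal.

(** * A central limit theorem *)

Section CLT.
Variable R : realType.
Variables (s : nat -> seq R) (m sg : nat -> R).
Hypotheses (ps : \forall d \near \oo, probs (s d))
  (sg0 : \forall d \near \oo, 0 < sg d)
  (sgoo : (sg d)^-1 @[d --> \oo] --> (0 : R))
  (mean_cvg : (mean (s d) - m d) / sg d @[d --> \oo] --> (0 : R))
  (var_cvg : var (s d) / sg d ^+ 2 @[d --> \oo] --> (1 : R)).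

Let W d (j : nat) : R := (j%:R - m d) / sg d.

Lemma bexp_test_cvg0 (g : R -> R) (L B : R) : 0 < B -> lip L g ->
  (forall x, B <= `|x| -> g x = 0) -> gauss_mean g = 0 ->
  bexp (s d) (fun j => g (W d j)) @[d --> \oo] --> (0 : R).
Proof.
move=> B0 gL gB g0; have [f [f1 [K [K0 df f1E fK lf]]]] := stein_solution B0 gL gB g0.
pose err d := K * (`|1 - var (s d) / sg d ^+ 2| + var (s d) / sg d ^+ 2 * (sg d)^-1
   + `|(mean (s d) - m d) / sg d|).
have err0 : err d @[d --> \oo] --> (0 : R).
  have -> : (0 : R) = K * (`|(1 - 1 : R)| + 1 * 0 + `|(0 : R)|).
    by rewrite subrr normr0 mulr0 !addr0 mulr0.
  apply: cvgM; first exact: cvg_cst.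
  apply: cvgD; last exact: cvg_norm.
  apply: cvgD; last exact: cvgM.
  by apply: cvg_norm; apply: cvgB => //; exact: cvg_cst.
apply/norm_cvg0P.
apply: (@squeeze_cvgr _ _ _ _ (cst 0) err); [|exact: cvg_cst|exact: err0].
near=> d.
have sd : 0 < sg d by near: d.
rewrite normr_ge0 /= /err; apply: le_trans (stein_bexp _ _ sd K0 df f1E fK lf) _.
  by near: d.
rewrite ler_pM2l // normrM (gtr0_norm (x := (sg d)^-1)) ?invr_gt0 // lerD // lerD //.
by rewrite exprSr invfM mulrA.
Unshelve. all: by end_near. Qed.

Lemma second_moment_le2 : \forall d \near \oo,
  bexp (s d) (fun j => W d j ^+ 2) <= 2.
Proof.
have H : var (s d) / sg d ^+ 2 + ((mean (s d) - m d) / sg d) ^+ 2 @[d --> \oo] --> (1 + 0 ^+ 2 : R).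
  by apply: cvgD => //; exact: (cvgM mean_cvg mean_cvg).
rewrite expr0n addr0 in H.
near=> d.
have -> : bexp (s d) (fun j => W d j ^+ 2) =
    var (s d) / sg d ^+ 2 + ((mean (s d) - m d) / sg d) ^+ 2.
  have sd : 0 < sg d by near: d.
  rewrite expr_div_n -mulrDl -bexp_second_moment; last by near: d.
  rewrite mulrC -bexpZ; apply: eq_bexp => j; rewrite /W expr_div_n; by rewrite mulrC.
near: d; have := H => /cvgr_le; apply; lra.
Unshelve. all: by end_near. Qed.

(** The indicator of the half-line up to [z] lies between two trapezoids, up to
    the event that the normalized sum is below [- A], which is rare by Chebyshev's
    inequality.  Stein's method needs test functions of Gaussian mean zero, so a
    multiple of the wide trapezoid [h0] is subtracted; both the Gaussian mean of
    [h0] and its mean at the normalized sum are close to one. *)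
Lemma clt_eps (z e : R) : 0 < e -> e <= 1 / 4 -> \forall d \near \oo,
  `|Phi z - bexp (s d) (fun j => (W d j <= z)%R%:R)| <= 8 * e.
Proof.
move=> e0 e4.
(* [A] is so large that the normalized sum, of second moment at most [2], leaves
   the segment from [- A] to [A] with probability at most [e] *)
have [A] := Phi_tails (2 + `|z| + 2 / e) e0; set P := Phi A - Phi (- A) => Ab hP.
have z0 := normr_ge0 z.
have ze0 : 0 < 2 / e by rewrite divr_gt0.
have A2 : 2 <= A by lra.
have A0 : 0 < A by lra.
have zA : - A + 1 <= z /\ z + 1 <= A.
  by have := ler_norm z; have := ler_norm (- z); rewrite normrN; lra.
have Ae : 2 / A ^+ 2 <= e.
  rewrite ler_pdivrMr ?exprn_gt0 // -ler_pdivrMl // mulrC expr2.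
  apply: le_trans (_ : A <= _); first lra.
  by rewrite -[leLHS]mulr1 ler_pM2l //; lra.
pose h0 := trap (- A) A 1.
pose G0 := gauss_mean h0.
have G0ge : 1 - e <= G0.
  by apply: le_trans hP _; exact: gauss_trap_ge.
have G0le : G0 <= 1 by exact: gauss_trap_le1.
have G00 : 0 < G0 by lra.
have key b : - A <= b -> b + e <= A ->
    bexp (s d) (fun j => trap (- A) b e (W d j) -
       gauss_mean (trap (- A) b e) / G0 * h0 (W d j)) @[d --> \oo] --> (0 : R).
  move=> Ab' bA; pose c := gauss_mean (trap (- A) b e) / G0.
  apply: (@bexp_test_cvg0 (fun x => trap (- A) b e x - c * h0 x) (e^-1 + `|c|) (A + 1)).
  - lra.
  - move=> x y.
    have -> : trap (- A) b e x - c * h0 x - (trap (- A) b e y - c * h0 y) =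
      (trap (- A) b e x - trap (- A) b e y) - c * (h0 x - h0 y) by ring.
    apply: le_trans (ler_normB _ _) _; rewrite mulrDl; apply: lerD; first exact: trap_lip.
    rewrite normrM ler_wpM2l //; have := @trap_lip R (- A) A 1 ltr01 x y.
    by rewrite invr1 mul1r.
  - move=> x; rewrite ler_normr => xA.
    have -> : trap (- A) b e x = 0.
      by apply: trap_out => //; case/orP: xA => xA; [right|left]; lra.
    have -> : h0 x = 0.
      by apply: trap_out => //; case/orP: xA => xA; [right|left]; lra.
    by rewrite mulr0 subr0.
  - rewrite gauss_meanB; try exact: bounded_meas_trap.
    by rewrite -/G0 /c divfK ?gt_eqF // subrr.
have hp_bounds : 0 <= gauss_mean (trap (- A) z e) <= Phi z + e.
  rewrite (le_trans (gauss_trap_le _ _ e0)) ?Phi_lip // andbT.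
  by apply: Rintegral_ge0 => x _; rewrite mulr_ge0 ?trap_ge0 // ltW // phi_gt0.
have hm_bounds : Phi z - 2 * e <= gauss_mean (trap (- A) (z - e) e) <= 1.
  rewrite gauss_trap_le1 // andbT; apply: le_trans (gauss_trap_ge _ _ e0).
  have := @Phi_lip R (z - e) e e0; rewrite subrK.
  by have := Phi_le1 A; rewrite /P in hP; lra.
have hm0 : 0 <= gauss_mean (trap (- A) (z - e) e).
  by apply: Rintegral_ge0 => x _; rewrite mulr_ge0 ?trap_ge0 // ltW // phi_gt0.
have Kp := key z _ _; have Km := key (z - e) _ _.
have /cvgr0Pnorm_le/(_ e e0) Hp := Kp ltac:(lra) ltac:(lra).
have /cvgr0Pnorm_le/(_ e e0) Hm := Km ltac:(lra) ltac:(lra).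
near=> d.
have psd : probs (s d) by near: d.
have M2 : bexp (s d) (fun j => W d j ^+ 2) <= 2 by near: d; exact: second_moment_le2.
have : `|bexp (s d) (fun j => trap (- A) z e (W d j) -
       gauss_mean (trap (- A) z e) / G0 * h0 (W d j))| <= e by near: d.
have : `|bexp (s d) (fun j => trap (- A) (z - e) e (W d j) -
       gauss_mean (trap (- A) (z - e) e) / G0 * h0 (W d j))| <= e by near: d.
have split_ (b c : R) : bexp (s d) (fun j => trap (- A) b e (W d j) - c * h0 (W d j)) =
    bexp (s d) (fun j => trap (- A) b e (W d j)) - c * bexp (s d) (fun j => h0 (W d j)).
  by rewrite -mulNr -bexpZ -bexpD; apply: eq_bexp => j; rewrite mulNr.
rewrite !split_.
set Hz := bexp (s d) (fun j => trap (- A) z e _).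
set Hz' := bexp (s d) (fun j => trap (- A) (z - e) e _).
set H0 := bexp (s d) (fun j => h0 _).
set Q := bexp (s d) (fun j => W d j ^+ 2) in M2.
have A20 : 0 < A ^+ 2 by rewrite exprn_gt0.
have sqA x : A <= `|x| -> 1 <= x ^+ 2 / A ^+ 2.
  move=> Ax; rewrite ler_pdivlMr // mul1r -[leRHS]real_normK ?num_real //.
  by rewrite lerXn2r // nnegrE // ltW.
have QA : Q / A ^+ 2 <= e.
  by apply: le_trans Ae; rewrite ler_pM2r ?invr_gt0.
have H01 : H0 <= 1.
  by rewrite -[leRHS](bexp_cst (s d)); apply: le_bexp => // j; exact: trap_le1.
have H0ge : 1 - e <= H0.
  apply: (@le_trans _ _ (1 - Q / A ^+ 2)); first lra.
  rewrite -(bexp_cst (s d) 1) /Q mulrC -mulNr -bexpZ -bexpD; apply: le_bexp => // j.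
  have [AW|WA] := lerP A `|W d j|.
    have := sqA _ AW; have := trap_ge0 (- A) A 1 (W d j); rewrite mulNr mulrC /h0; lra.
  have -> : h0 (W d j) = 1.
    by apply: trap_in => //; move: WA; rewrite ltr_norml => /andP[/ltW -> /ltW ->].
  by rewrite mulNr gerBl mulr_ge0 ?invr_ge0 ?sqr_ge0 // ltW.
set Pz := bexp (s d) (fun j => (W d j <= z)%R%:R).
have up : Pz <= Q / A ^+ 2 + Hz.
  rewrite /Q /Pz /Hz mulrC -bexpZ -bexpD; apply: le_bexp => // j.
  case: (lerP (W d j) z) => Wz /=; last first.
    by rewrite addr_ge0 ?trap_ge0 // mulr_ge0 ?invr_ge0 ?sqr_ge0 // ltW.
  have [AW|WA] := lerP (- A) (W d j).
    by rewrite trap_in ?AW // lerDr mulr_ge0 ?invr_ge0 ?sqr_ge0 // ltW.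
  have AW : A <= `|W d j| by rewrite ler_normr; apply/orP; right; lra.
  by have := sqA _ AW; have := trap_ge0 (- A) z e (W d j); rewrite mulrC; lra.
have lo : Hz' <= Pz.
  apply: le_bexp => // j; case: (lerP (W d j) z) => Wz /=; first exact: trap_le1.
  by rewrite trap_out //; right; rewrite subrK ltW.
move: hp_bounds hm_bounds hm0.
set gp := gauss_mean (trap _ z e); set gm := gauss_mean (trap _ (z - e) e).
move=> /andP[gp0 gp1] /andP[gm1 gm2] gm0.
have cp : gp / G0 * H0 <= Phi z + 6 * e.
  have Pz1 := Phi_le1 z.
  apply: (@le_trans _ _ (gp / G0)).
    by rewrite ler_piMr // divr_ge0 // ltW.
  rewrite ler_pdivrMr //; apply: (@le_trans _ _ ((Phi z + 6 * e) * (1 - e))).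
    have := Phi_ge0 z; nra.
  by rewrite ler_wpM2l //; have := Phi_ge0 z; lra.
have cm : Phi z - 3 * e <= gm / G0 * H0.
  apply: (@le_trans _ _ (gm * (1 - e))); first nra.
  apply: ler_pM => //; first lra.
  by rewrite ler_pdivlMr // ler_piMr.
rewrite !ler_norml => /andP[m1 m2] /andP[p1 p2]; apply/andP; split; lra.
Unshelve. all: by end_near. Qed.

(** A central limit theorem for sums of independent trials, with normalizing
    sequences that need be correct only to first order. *)
Theorem clt z : bexp (s d) (fun j => ((j%:R - m d) / sg d <= z)%R%:R) @[d --> \oo] --> Phi z.
Proof.
apply/cvgrPdist_le => e e0; pose e' := Num.min (1 / 4) (e / 8).
have e'0 : 0 < e' by rewrite lt_min !divr_gt0.
have e'4 : e' <= 1 / 4 by rewrite ge_min lexx.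
have e'8 : 8 * e' <= e by rewrite mulrC -ler_pdivlMr // ge_min lexx orbT.
by apply: filterS (clt_eps z e'0 e'4) => d /le_trans; apply.
Qed.

End CLT.

(** * Mean, variance and coefficients for large n *)

Section Moments.
Variable R : realType.
Implicit Types (i k n : nat).

Lemma probs_success i n : (0 < i)%N -> probs (success_probs R i n).
Proof.
move=> i0; apply/allP => p /mapP[l _ ->].
have il : 0 < (i + l)%:R :> R by rewrite ltr0n; lia.
by rewrite divr_ge0 //= ler_pdivrMr // mul1r ler_nat leq_addr.
Qed.

Lemma sum_success (F : R -> R) i n :
  \sum_(p <- success_probs R i n) F p =
  \sum_(l < n | l != i :> nat) F (i%:R / (i + l)%:R).
Proof.
by rewrite /success_probs big_map big_filter big_mkcond big_iota_ord -big_mkcond.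
Qed.

Lemma ln_ratio_le (x : R) : 1 <= x -> ln ((x + 1) / x) <= x^-1.
Proof.
move=> x1; have x0 : 0 < x by lra.
have -> : (x + 1) / x = 1 + x^-1 by rewrite mulrDl divff ?gt_eqF // mul1r.
apply: le_ln1Dx; have : 0 < x^-1 by rewrite invr_gt0. 
lra.
Qed.

Lemma ln_ratio_ge (x : R) : 1 <= x -> (x + 1)^-1 <= ln ((x + 1) / x).
Proof.
move=> x1; have x0 : 0 < x by lra.
have y0 : 0 < x + 1 by lra.
have -> : (x + 1) / x = (x / (x + 1))^-1 by rewrite invfM invrK mulrC.
rewrite lnV ?posrE ?divr_gt0 // lerNr.
have -> : x / (x + 1) = 1 + - (x + 1)^-1 by field; lra.
apply: le_ln1Dx; rewrite ltrN2 invf_lt1 //; lra.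
Qed.

(** Each term is compared with an increment of the logarithm. *)
Lemma harmonic_shift_ge k n : (0 < k)%N ->
  ln (k + n)%:R - ln k%:R <= \sum_(l < n) (k + l)%:R^-1 :> R.
Proof.
move=> k0; elim: n => [|n IH]; first by rewrite addn0 subrr big_ord0.
rewrite big_ord_recr /= addnS -natr1.
have kn : 1 <= (k + n)%:R :> R by rewrite ler1n; lia.
have := ln_ratio_le kn; rewrite lnM ?posrE ?lnV ?posrE ?invr_gt0; try lra.
Qed.

Lemma harmonic_shift_le k n : (0 < k)%N ->
  \sum_(l < n.+1) (k + l)%:R^-1 <= k%:R^-1 + ln (k + n)%:R - ln k%:R :> R.
Proof.
move=> k0; elim: n => [|n IH]; first by rewrite big_ord1 addn0 addrK.
rewrite big_ord_recr /= addnS -natr1.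
have kn : 1 <= (k + n)%:R :> R by rewrite ler1n; lia.
have := ln_ratio_ge kn; rewrite lnM ?posrE ?lnV ?posrE ?invr_gt0; try lra.
Qed.

(** The mean of the number of successes with the fair coin [l = k] included. *)
Definition full_mean k n : R := \sum_(l < n) (k%:R / (k + l)%:R).

Lemma full_meanE k n : full_mean k n = k%:R * \sum_(l < n) (k + l)%:R^-1.
Proof. by rewrite mulr_sumr. Qed.

Lemma full_mean_bounds k n : (0 < k)%N -> (0 < n)%N ->
  k%:R * ln n%:R - k%:R * ln k%:R <= full_mean k n <= k%:R * ln n%:R + 1.
Proof.
move=> k0 n0; rewrite full_meanE.
have k0' : 0 < k%:R :> R by rewrite ltr0n.
have n0' : 0 < n%:R :> R by rewrite ltr0n.
apply/andP; split.
  rewrite -mulrBr ler_pM2l //; apply: le_trans (harmonic_shift_ge _ k0).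
  rewrite lerD2r ler_ln ?posrE // ?ler_nat; last by rewrite ltr0n; lia.
  lia.
case: n n0 n0' => // n _ n0'.
apply: (@le_trans _ _ (k%:R * (k%:R^-1 + ln n.+1%:R))).
  rewrite ler_pM2l //; apply: le_trans (harmonic_shift_le _ k0) _.
  rewrite -addrA lerD2l lerBlDr -lnM ?posrE // ler_ln ?posrE ?mulr_gt0 //; last first.
    by rewrite ltr0n; lia.
  by rewrite -natrM ler_nat; nia.
by rewrite mulrDr divff ?gt_eqF // addrC.
Qed.

Lemma mean_success_bounds k n : (0 < k)%N ->
  full_mean k n - 1 <= mean (success_probs R k n) <= full_mean k n.
Proof.
move=> k0; rewrite /mean (sum_success id) /full_mean.
have ge0 (l : 'I_n) : 0 <= k%:R / (k + l)%:R :> R by rewrite divr_ge0.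
rewrite [\sum_(l < n) _](bigID (fun l : 'I_n => l != k :> nat)) /=; apply/andP; split.
  rewrite lerBlDr lerD2l; have [kn|nk] := ltnP k n.
    rewrite (big_pred1 (Ordinal kn)) /=; last by move=> l; rewrite negbK.
    by rewrite ler_pdivrMr ?mul1r ?ler_nat ?leq_addr // ltr0n addn_gt0 k0.
  rewrite big_pred0 // => l; rewrite negbK; apply/negbTE; have := ltn_ord l; lia.
by rewrite lerDl sumr_ge0.
Qed.

(** Telescoping, by comparison with [1 / (k + l - 1) - 1 / (k + l)]. *)
Lemma sum_squares_le k n : (0 < k)%N ->
  \sum_(l < n) (k%:R / (k + l)%:R) ^+ 2 <= 1 + k%:R :> R.
Proof.
move=> k0; have k0' : 0 < k%:R :> R by rewrite ltr0n.
suff H : \sum_(l < n.+1) (k%:R / (k + l)%:R) ^+ 2 <= 1 + k%:R - k%:R ^+ 2 / (k + n)%:R :> R.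
  apply: le_trans (_ : \sum_(l < n.+1) (k%:R / (k + l)%:R) ^+ 2 <= _).
    by rewrite big_ord_recr /= lerDl sqr_ge0.
  by apply: le_trans H _; rewrite gerBl divr_ge0 ?sqr_ge0.
elim: n => [|n IH].
  by rewrite big_ord1 addn0 divff ?gt_eqF // expr1n expr2 mulfK ?gt_eqF //; lra.
rewrite big_ord_recr /= addnS -natr1; set x : R := (k + n)%:R in IH *.
have x0 : 0 < x by rewrite ltr0n; lia.
apply: le_trans (lerD IH (lexx _)) _; rewrite -subr_ge0.
have -> : 1 + k%:R - k%:R ^+ 2 / (x + 1) - (1 + k%:R - k%:R ^+ 2 / x + (k%:R / (x + 1)) ^+ 2)
  = k%:R ^+ 2 / (x * (x + 1) ^+ 2) :> R.
  by field; apply/andP; split; lra.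
by rewrite divr_ge0 ?sqr_ge0 // mulr_ge0 ?sqr_ge0 // ltW.
Qed.

Lemma var_success_bounds k n : (0 < k)%N ->
  mean (success_probs R k n) - (1 + k%:R) <= var (success_probs R k n)
    <= mean (success_probs R k n).
Proof.
move=> k0; rewrite /var /mean !(sum_success (fun p => p)) (sum_success (fun p => p * (1 - p))).
under [X in _ <= X <= _]eq_bigr do rewrite mulrBr mulr1 -expr2.
rewrite sumrB lerD2l lerN2 gerBl; apply/andP; split; last first.
  by apply: sumr_ge0 => l _; exact: sqr_ge0.
apply: le_trans (sum_squares_le n k0); rewrite [leRHS](bigID (fun l : 'I_n => l != k :> nat)) /=.
by rewrite lerDl sumr_ge0 // => l _; exact: sqr_ge0.
Qed.

Lemma mean_var_log k n : (0 < k)%N -> (0 < n)%N ->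
  let C := 3 + k%:R + k%:R * ln k%:R in
  [/\ `|mean (success_probs R k n) - k%:R * ln n%:R| <= C,
      `|var (success_probs R k n) - k%:R * ln n%:R| <= C &
      0 <= C].
Proof.
move=> k0 n0 C; have k0' : 1 <= k%:R :> R by rewrite ler1n.
have lk : 0 <= k%:R * ln k%:R :> R by rewrite mulr_ge0 ?ln_ge0.
have /andP[f1 f2] := full_mean_bounds k0 n0.
have /andP[m1 m2] := mean_success_bounds n k0.
have /andP[v1 v2] := var_success_bounds n k0.
rewrite /C; split; [| |lra]; rewrite ler_norml; apply/andP; split; lra.
Qed.

Definition rising_ratio i n : R := (\prod_(l < n) (i + l)%N%:R) / n`!%:R.

Lemma rising_ratio0 n : (0 < n)%N -> rising_ratio 0 n = 0.
Proof.
by case: n => // n _; rewrite /rising_ratio big_ord_recl /= add0n mul0r mul0r.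
Qed.

Lemma rising_ratio1 n : rising_ratio 1 n = 1.
Proof.
rewrite /rising_ratio -natr_prod (_ : \prod_(l < n) (1 + l) = n`!)%N.
  by rewrite divff // pnatr_eq0 -lt0n fact_gt0.
by rewrite fact_prod big_add1 /= big_mkord; apply: eq_bigr => l _; rewrite add1n.
Qed.

Lemma rising_ratio_ge0 i n : 0 <= rising_ratio i n.
Proof. by rewrite divr_ge0 // prodr_ge0. Qed.

Lemma rising_ratioS i n : rising_ratio i.+1 n * i%:R = rising_ratio i n * (i + n)%:R.
Proof.
rewrite /rising_ratio mulrAC [RHS]mulrAC; congr (_ / _).
elim: n => [|n IH]; first by rewrite !big_ord0 addn0.
by rewrite !big_ord_recr /= mulrAC IH -mulrA -mulrA; congr (_ * _);
  rewrite mulrC addnS -addSn mulrC.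
Qed.

(** The coefficient of the tail probability for [i] colours in the ratio of the
    expected number of faces to the number of sets of [k] points. *)
Definition face_coef (n k i : nat) : R := rising_ratio i n / 'C(n.-1, k.-1)%:R.

End Moments.

Section CoefLimits.
Variable R : realType.
Variable n : nat -> nat.
Hypothesis n_gt : forall d : nat, (0 < d)%N -> (d < n d)%N.

Lemma inv_n_cvg0 : (n d)%:R^-1 @[d --> \oo] --> (0 : R).
Proof.
apply: (@squeeze_cvgr _ _ _ _ (cst 0) (@harmonic R)); [|exact: cvg_cst|exact: cvg_harmonic].
exists 1%N => // d /= d0; rewrite invr_ge0 ler0n /= /harmonic.
have := n_gt d0 => dn; rewrite lef_pV2 ?posrE ?ltr0n ?ler_nat //; lia.
Qed.

Lemma shift_ratio_cvg1 (a b : nat) : ((n d + a)%N%:R / (n d - b)%N%:R) @[d --> \oo] --> (1 : R).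
Proof.
have inv0 := inv_n_cvg0.
have H : (1 + a%:R * (n d)%:R^-1) / (1 - b%:R * (n d)%:R^-1) @[d --> \oo] -->
    ((1 + a%:R * 0) / (1 - b%:R * 0) : R).
  apply: cvgM.
    by apply: cvgD; [exact: cvg_cst|apply: cvgM => //; exact: cvg_cst].
  apply: cvgV; first by rewrite mulr0 subr0 oner_neq0.
  by apply: cvgB; [exact: cvg_cst|apply: cvgM => //; exact: cvg_cst].
rewrite !mulr0 subr0 addr0 divr1 in H.
apply: cvg_trans H; apply: near_eq_cvg; exists b.+1 => // d /= bd.
have dn : (d < n d)%N by apply: n_gt; lia.
have n0 : (n d)%:R != 0 :> R by rewrite pnatr_eq0; lia.
have nb : (n d)%:R - b%:R != 0 :> R by rewrite subr_eq0 eqr_nat; lia.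
rewrite natrB; last by lia.
rewrite natrD; field.
by rewrite n0 nb.
Qed.

(** For [k] colours the coefficient is the ratio of [n (n + 1) ... (n + k - 1)] to
    [n (n - 1) ... (n - k + 1)]. *)
Lemma face_coef_main k : face_coef R (n d) k.+1 k.+1 @[d --> \oo] --> (1 : R).
Proof.
elim: k => [|k IH].
  have -> : (fun d => face_coef R (n d) 1 1) = cst 1.
    by apply/funext => d; rewrite /face_coef rising_ratio1 bin0 divr1.
  exact: cvg_cst.
have H : (fun d => face_coef R (n d) k.+1 k.+1 *
    ((n d + k.+1)%N%:R / (n d - k.+1)%N%:R)) @ \oo --> (1 * 1 : R).
  exact: cvgM IH (shift_ratio_cvg1 k.+1 k.+1).
rewrite mulr1 in H; apply: cvg_trans H; apply: near_eq_cvg; exists k.+2 => // d /= kd.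
have dn : (d < n d)%N by apply: n_gt; lia.
rewrite /face_coef /=.
have k0 : k.+1%:R != 0 :> R by rewrite pnatr_eq0.
have E1 : rising_ratio R k.+2 (n d) = rising_ratio R k.+1 (n d) * (k.+1 + n d)%:R / k.+1%:R.
  by rewrite -rising_ratioS mulfK.
have E2 : 'C((n d).-1, k.+1)%:R = 'C((n d).-1, k)%:R * (n d - k.+1)%N%:R / k.+1%:R :> R.
  rewrite -natrM (_ : 'C((n d).-1, k) * (n d - k.+1) = 'C((n d).-1, k.+1) * k.+1)%N.
    by rewrite natrM mulfK.
  by rewrite mulnC -[RHS]mulnC mul_bin_left; congr (_ * _)%N; lia.
have c0 : 'C((n d).-1, k)%:R != 0 :> R by rewrite pnatr_eq0 -lt0n bin_gt0; lia.
have nk : (n d - k.+1)%N%:R != 0 :> R by rewrite pnatr_eq0; lia.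
rewrite E1 E2 addnC; move: (k.+1%:R) (_ + _)%N%:R (_ - _)%N%:R ('C(_, _)%:R) k0 nk c0.
by move=> x y z c x0 z0 c0; field; rewrite x0 z0 c0.
Qed.

(** Fewer colours lose a factor of order [n]. *)
Lemma face_coef_small k i : (i < k)%N -> face_coef R (n d) k i @[d --> \oo] --> (0 : R).
Proof.
case: k => // k; rewrite ltnS => ik.
have H : face_coef R (n d) k.+1 k.+1 * (k%:R * (n d)%:R^-1) @[d --> \oo] --> (1 * (k%:R * 0) : R).
  apply: cvgM; first exact: face_coef_main.
  by apply: cvgM; [exact: cvg_cst|exact: inv_n_cvg0].
rewrite !mulr0 in H.
apply: (squeeze_cvgr _ (cvg_cst 0) H).
exists 1%N => // d /= d0; have dn := n_gt d0.
rewrite /= /face_coef divr_ge0 ?rising_ratio_ge0 //= [leRHS]mulrAC ler_wpM2r ?invr_ge0 //.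
have n0 : 0 < (n d)%:R :> R by rewrite ltr0n; lia.
apply: (@le_trans _ _ (rising_ratio R k (n d))).
  clear H; elim: k ik => [|k IH]; first by rewrite leqn0 => /eqP ->.
  rewrite leq_eqVlt => /orP[/eqP -> //|]; rewrite ltnS => /IH ik.
  apply: le_trans ik _; case: (posnP k) => [->|k0].
    by rewrite rising_ratio0 ?rising_ratio_ge0 //; lia.
  have k0' : 0 < k%:R :> R by rewrite ltr0n.
  rewrite -(ler_pM2r k0') rising_ratioS ler_wpM2l ?rising_ratio_ge0 //.
  by rewrite ler_nat leq_addr.
rewrite mulrA rising_ratioS ler_pdivlMr // ler_wpM2l ?rising_ratio_ge0 //.
by rewrite ler_nat leq_addl.
Qed.

End CoefLimits.

(** * Limits of the expected number of faces *)

Lemma face_denominator (n k : nat) : (0 < n)%N -> (0 < k)%N ->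
  (k * (n.-1`! * 'C(n, k)) = n`! * 'C(n.-1, k.-1))%N.
Proof.
case: n k => // n [//|k] _ _ /=.
by rewrite factS mulnCA -mul_bin_diag /= mulnCA mulnA.
Qed.

Lemma scaled_variance_le (R : realType) (v e x y c : R) : 0 < e -> 0 < y -> y <= x ->
  0 <= c -> v <= c * x -> v / (e * x) ^+ 2 <= c * e ^- 2 / y.
Proof.
move=> e0 y0 yx c0 vx; have x0 : 0 < x by exact: lt_le_trans yx.
apply: (@le_trans _ _ (c * x / (e * x) ^+ 2)).
  by rewrite ler_pM2r // invr_gt0 exprn_gt0 ?mulr_gt0.
have -> : c * x / (e * x) ^+ 2 = c * e ^- 2 / x by field; rewrite !gt_eqF.
apply: ler_wpM2l; first by rewrite mulr_ge0 // invr_ge0 exprn_ge0 // ltW.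
by rewrite lef_pV2 ?posrE.
Qed.

Section Limits.
Variables (R : realType) (n : nat -> nat) (k : nat).
Hypotheses (n_gt : forall d : nat, (0 < d)%N -> (d < n d)%N) (k0 : (0 < k)%N).

(** The exact ratio of the expected number of faces to the number of sets of [k]
    points. *)
Definition face_ratio (d : nat) : R := 1 - \sum_(A : {set 'I_k})
  (-1) ^+ (k - #|A|) * (face_coef R (n d) k #|A| * tail_prob R #|A| (n d) d).

Lemma expected_ratio (disp : measure_display) (T : measurableType disp)
    (P : probability T R) (d : nat) (xi : 'I_(n d).-1 -> T -> 'rV[R]_d) :
  random_vectors xi -> exchangeable P xi -> general_position P xi ->
  (k <= d)%N ->
  (expected_faces P xi k.-1 / ('C(n d, k)%:R)%:E)%E = (face_ratio d)%:E.
Proof.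
move=> ? ? ? kd; have d0 : (0 < d)%N by lia.
have dn := n_gt d0.
rewrite expected_faces_formula //; last by lia.
have nE : (n d).-1.+1 = n d by rewrite prednK //; lia.
have C0 : 'C(n d, k)%:R != 0 :> R by rewrite pnatr_eq0 -lt0n bin_gt0; lia.
rewrite inver (negPf C0) -EFinM; congr EFin; rewrite !nE.
have kf : k%:R * (n d).-1`!%:R != 0 :> R.
  by rewrite mulf_neq0 // pnatr_eq0 -lt0n // fact_gt0.
rewrite -mulrA -invfM mulrBl.
have -> : (k * ((n d).-1`! * 'C(n d, k)))%:R = k%:R * (n d).-1`!%:R * 'C(n d, k)%:R :> R.
  by rewrite mulnA !natrM.
rewrite divff; last by rewrite mulf_neq0.
rewrite /face_ratio; congr (1 - _).
have -> : k%:R * (n d).-1`!%:R * 'C(n d, k)%:R = (n d)`!%:R * 'C((n d).-1, k.-1)%:R :> R.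
  by rewrite -!natrM -mulnA face_denominator //; lia.
rewrite /surj_tail mulr_suml; apply: eq_bigr => A _.
rewrite -mulrA; congr (_ * _).
by rewrite /face_coef /rising_ratio invfM; ring.
Qed.

Lemma tail_prob_bounds i N d : 0 <= tail_prob R i N d <= 1.
Proof.
have ps : probs (success_probs R i N).
  case: (posnP i) => [->|]; last exact: probs_success.
  by apply/allP => p /mapP[l _ ->]; rewrite mul0r lexx ler01.
apply/andP; split; first exact: bexp_ge0.
rewrite -[leRHS](bexp_cst (success_probs R i N)); apply: le_bexp => // j.
by case: (d < j)%N.
Qed.

Lemma tail_probC i N d :
  1 - tail_prob R i N d = bexp (success_probs R i N) (fun j => (j <= d)%N%:R).
Proof.
rewrite /tail_prob -{1}(bexp_cst (success_probs R i N) 1) -mulN1r -bexpZ -bexpD.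
apply: eq_bexp => j; rewrite mulN1r [(j <= d)%N]leqNgt.
by case: (d < j)%N; rewrite /= ?subrr ?subr0.
Qed.

(** Only the full set of colours contributes in the limit. *)
Lemma face_ratio_cvg (v : R) :
  1 - tail_prob R k (n d) d @[d --> \oo] --> v -> face_ratio d @[d --> \oo] --> v.
Proof.
move=> tv.
pose u (A : {set 'I_k}) d : R :=
  ((-1) ^+ (k - #|A|) * face_coef R (n d) k #|A| - (#|A| == k)%:R) * tail_prob R #|A| (n d) d.
have u0 A : u A d @[d --> \oo] --> (0 : R).
  pose a d : R := (-1) ^+ (k - #|A|) * face_coef R (n d) k #|A| - (#|A| == k)%:R.
  have a0 : a d @[d --> \oo] --> (0 : R).
    rewrite /a; have [Ak|Ak] := eqVneq #|A| k.
      rewrite Ak subnn -[X in _ --> X](subrr 1); apply: cvgB; last exact: cvg_cst.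
      rewrite -[X in _ --> X](mulr1 1); apply: cvgM; first exact: cvg_cst.
      by case: (k) k0 => // k' _; exact: face_coef_main.
    have Alt : (#|A| < k)%N.
      by rewrite ltn_neqAle Ak -[X in (_ <= X)%N](card_ord k) max_card.
    rewrite -[X in _ --> X](subr0 0); apply: cvgB; last exact: cvg_cst.
    rewrite -[X in _ --> X](mulr0 ((-1) ^+ (k - #|A|))); apply: cvgM; first exact: cvg_cst.
    exact: face_coef_small.
  apply/norm_cvg0P; have na0 : `|a d| @[d --> \oo] --> (0 : R) by apply/norm_cvg0P.
  apply: (squeeze_cvgr _ (cvg_cst 0) na0); apply: nearW => d.
  rewrite normr_ge0 /= /u -/(a d) normrM ler_piMr //.
  by have /andP[t0 t1] := tail_prob_bounds #|A| (n d) d; rewrite ger0_norm.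
have -> : face_ratio = (fun d => 1 - tail_prob R k (n d) d - \sum_A u A d).
  apply/funext => d; rewrite /face_ratio /u; under [in RHS]eq_bigr do rewrite mulrBl -mulrA.
  rewrite sumrB [X in _ - X - _](_ : _ = \sum_(A : {set 'I_k}) (#|A| == k)%:R * tail_prob R #|A| (n d) d).
    by ring.
  rewrite (bigD1 [set: 'I_k]%SET) //= cardsT card_ord eqxx mul1r big1 ?addr0 // => A AT.
  rewrite (_ : #|A| == k = false) ?mul0r //; apply: contraNF AT => /eqP Ak.
  by rewrite finset.eqEcard finset.subsetT cardsT card_ord Ak leqnn.
rewrite -[v]subr0; apply: cvgB => //.
rewrite -[X in _ --> X](@big1_eq R 0 +%R _ (index_enum {set 'I_k}) xpredT).
apply: cvg_big => [|A _]; [exact: add_continuous | exact: u0].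
Qed.

Let mu d := mean (success_probs R k (n d)).
Let vr d := var (success_probs R k (n d)).

Lemma cvg_over_nat (c : R) : c / d%:R @[d --> \oo] --> (0 : R).
Proof.
rewrite -[X in _ --> X](mulr0 c); apply: cvgM; first exact: cvg_cst.
rewrite -(cvg_shiftS (fun d : nat => d%:R^-1 : R)); exact: cvg_harmonic.
Qed.

(** Here the mean [k ln n + O(1)] stays below [d] by a multiple of [d], while the
    variance is at most of order [d]. *)
Lemma subcritical (q : R) : q < k%:R^-1 -> (\forall d \near \oo, ln (n d)%:R < q * d%:R) ->
  1 - tail_prob R k (n d) d @[d --> \oo] --> (1 : R).
Proof.
move=> qk Hq; have k0' : 0 < k%:R :> R by rewrite ltr0n.
have kq : k%:R * q < 1 by rewrite mulrC -ltr_pdivlMr // div1r.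
pose dl := (1 - k%:R * q) / 2.
have dl0 : 0 < dl by rewrite divr_gt0 // subr_gt0.
pose C : R := 3 + k%:R + k%:R * ln k%:R.
have t0 : tail_prob R k (n d) d @[d --> \oo] --> (0 : R).
  apply: (squeeze_cvgr _ (cvg_cst 0) (cvg_over_nat (dl ^- 2))).
  near=> d.
  have d0 : (0 < d)%N by near: d; exists 1%N.
  have dn := n_gt d0.
  have n0 : (0 < n d)%N by lia.
  have [mC vC C0] := mean_var_log R k0 n0; rewrite -/C in mC vC C0.
  have lnd : ln (n d)%:R < q * d%:R by near: d.
  have dC : C / dl <= d%:R by near: d; exact: nbhs_infty_ger.
  rewrite ler_pdivrMr // mulrC in dC.
  have /andP[-> _] := tail_prob_bounds k (n d) d; rewrite /=.
  have ps := probs_success R (n d) k0.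
  have d0' : 0 < d%:R :> R by rewrite ltr0n.
  have kl : k%:R * ln (n d)%:R <= k%:R * q * d%:R by rewrite -mulrA ler_pM2l // ltW.
  have qE : k%:R * q = 1 - 2 * dl by rewrite /dl; field.
  have [mu1 vr1] : dl * d%:R <= d%:R - mu d /\ vr d <= d%:R.
    move: mC vC; rewrite !ler_norml -/(mu d) -/(vr d) => /andP[_ m2] /andP[_ v2].
    rewrite qE in kl; have dd : 0 < dl * d%:R by rewrite mulr_gt0.
    by split; nra.
  have dd : 0 < dl * d%:R by rewrite mulr_gt0.
  have := @bexp_chebyshev R (success_probs R k (n d)) (mu d) (dl * d%:R)
    (fun j => (d < j)%N) ps dd.
  rewrite subrr expr0n addr0 => /(_ _)/le_trans; apply.
    move=> j dj; have : d%:R <= j%:R :> R by rewrite ler_nat ltnW.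
    by move=> dj'; rewrite lerXn2r ?nnegrE //; lra.
  by rewrite -[dl ^- 2]mul1r; apply: scaled_variance_le; rewrite ?mul1r.
rewrite -[X in _ --> X](subr0 1); apply: cvgB => //; exact: cvg_cst.
Unshelve. all: by end_near. Qed.

(** Here the mean [k ln n + O(1)] exceeds [d] by a multiple of itself; as [n] may
    grow arbitrarily fast, [k ln n] rather than [d] is the scale of the deviation. *)
Lemma supercritical (q : R) : k%:R^-1 < q -> (\forall d \near \oo, q * d%:R < ln (n d)%:R) ->
  1 - tail_prob R k (n d) d @[d --> \oo] --> (0 : R).
Proof.
move=> qk Hq; have k0' : 0 < k%:R :> R by rewrite ltr0n.
have kq : 1 < k%:R * q by rewrite mulrC -ltr_pdivrMr // div1r.
pose dl := (1 - (k%:R * q)^-1) / 2.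
have kq1 : (k%:R * q)^-1 < 1 by rewrite invf_lt1 //; lra.
have dl0 : 0 < dl by rewrite divr_gt0 // subr_gt0.
pose C : R := 3 + k%:R + k%:R * ln k%:R.
apply: (squeeze_cvgr _ (cvg_cst 0) (cvg_over_nat (2 * dl ^- 2))).
near=> d.
have d0 : (0 < d)%N by near: d; exists 1%N.
have dn := n_gt d0.
have n0 : (0 < n d)%N by lia.
have [mC vC C0] := mean_var_log R k0 n0; rewrite -/C in mC vC C0.
have lnd : q * d%:R < ln (n d)%:R by near: d.
have dC : C / dl <= d%:R by near: d; exact: nbhs_infty_ger.
rewrite ler_pdivrMr // mulrC in dC.
have dC1 : C <= d%:R by near: d; exact: nbhs_infty_ger.
have /andP[t0 t1] := tail_prob_bounds k (n d) d; rewrite /= subr_ge0 t1 /=.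
have ps := probs_success R (n d) k0.
have d0' : 0 < d%:R :> R by rewrite ltr0n.
set x := k%:R * ln (n d)%:R in mC vC.
have xd : k%:R * q * d%:R <= x by rewrite -mulrA ler_pM2l // ltW.
have xd1 : d%:R <= x by apply: le_trans xd; rewrite ler_peMl ?ltW.
have xd2 : d%:R <= (k%:R * q)^-1 * x by rewrite mulrC ler_pdivlMr 1?mulrC //; lra.
have qE : (k%:R * q)^-1 = 1 - 2 * dl by rewrite /dl; set y := _^-1; field.
have [mu1 vr1] : dl * x <= mu d - d%:R /\ vr d <= 2 * x.
  move: mC vC; rewrite !ler_norml -/(mu d) -/(vr d) => /andP[m1 m2] /andP[_ v2].
  rewrite qE in xd2; split; last lra.
  have : C <= dl * x by apply: le_trans dC _; rewrite ler_pM2l.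
  lra.
have x0 : 0 < x by lra.
have dd : 0 < dl * x by rewrite mulr_gt0.
rewrite tail_probC.
have := @bexp_chebyshev R (success_probs R k (n d)) (mu d) (dl * x)
  (fun j => (j <= d)%N) ps dd.
rewrite subrr expr0n addr0 => /(_ _)/le_trans; apply.
  move=> j dj; have : j%:R <= d%:R :> R by rewrite ler_nat.
  move=> dj'; rewrite -[leRHS]sqrrN lerXn2r ?nnegrE //; lra.
exact: scaled_variance_le.
Unshelve. all: by end_near. Qed.

End Limits.

Lemma gauss_integralE (R : realType) (z : R) :
  ((Num.sqrt (2 * pi))^-1%:E *
    \int[lebesgue_measure]_(x in `]-oo, z]) (expR (- (x ^+ 2) / 2))%:E)%E = (Phi z)%:E.
Proof.
have mI : measurable [set` `]-oo, z]%R] by exact: measurable_itv.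
have int_phi : (@lebesgue_measure R).-integrable [set` `]-oo, z]%R] (EFin \o @phi R).
  exact: integrableS (integrable_phi R).
rewrite /Phi /Rintegral fineK; last exact: integrable_fin_num.
rewrite -ge0_integralZl //=.
- by apply: eq_integral => x _; rewrite phiE EFinM.
- apply/measurable_EFinP; have -> : (fun x : R => expR (- (x ^+ 2) / 2)) =
      (fun x => Num.sqrt (2 * pi) * phi x).
    apply/funext => x; rewrite phiE mulrA divff ?mul1r //.
    by rewrite gt_eqF // sqrtr_gt0 mulr_gt0 ?pi_gt0 ?ltr0n.
  apply: measurable_funM; first exact: measurable_cst.
  by have /integrableP[/measurable_EFinP] := int_phi.
Qed.

Section Critical.
Variables (R : realType) (n : nat -> nat) (k : nat).
Hypotheses (n_gt : forall d : nat, (0 < d)%N -> (d < n d)%N) (k0 : (0 < k)%N).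

Lemma inv_sqrt_cvg0 : (Num.sqrt d%:R)^-1 @[d --> \oo] --> (0 : R).
Proof.
apply/cvgrPdist_lt => e e0; near=> d.
rewrite sub0r normrN ger0_norm ?invr_ge0 ?sqrtr_ge0 //.
have ed : e ^- 2 < d%:R by near: d; exact: nbhs_infty_gtr.
have d0 : 0 < d%:R :> R by apply: lt_trans ed; rewrite invr_gt0 exprn_gt0.
rewrite invf_plt ?posrE ?sqrtr_gt0 //.
by rewrite -[ltLHS]ger0_norm ?invr_ge0 1?ltW // -sqrtr_sqr ltr_sqrt // exprVn.
Unshelve. all: by end_near. Qed.

(** The mean is [d + c sqrt d + o(sqrt d)] and the variance [d + o(d)], so that
    at most [d] successes means a normalized sum of at most [- c]. *)
Lemma critical (c : R) (r : nat -> R) :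
  r =o_\oo (fun d : nat => Num.sqrt (d%:R : R)) ->
  (forall d : nat, (0 < d)%N ->
    ln (n d)%:R = k%:R^-1 * (d%:R + c * Num.sqrt d%:R + r d)) ->
  1 - tail_prob R k (n d) d @[d --> \oo] --> Phi (- c).
Proof.
move=> /eqoP ro ln_n.
pose s d := success_probs R k (n d); pose sq d : R := Num.sqrt d%:R.
pose C : R := 3 + k%:R + k%:R * ln k%:R.
have k0' : k%:R != 0 :> R by rewrite pnatr_eq0 -lt0n.
have sq0 : \forall d \near \oo, 0 < sq d.
  by exists 1%N => // d /= d0; rewrite /sq sqrtr_gt0 ltr0n.
have r0 : r d / sq d @[d --> \oo] --> (0 : R).
  apply/cvgr0Pnorm_le => e e0; have := ro e e0; apply: filterS2 sq0 => d d0 rd.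
  by rewrite normrM normfV ler_pdivrMr ?normr_gt0 ?gt_eqF.
have C0 : C / sq d @[d --> \oo] --> (0 : R).
  rewrite -[X in _ --> X](mulr0 C); apply: cvgM; first exact: cvg_cst.
  exact: inv_sqrt_cvg0.
have near_pos (Q : nat -> Prop) : (forall d, (0 < d)%N -> Q d) -> \forall d \near \oo, Q d.
  by move=> H; exists 1%N.
have logE d : (0 < d)%N -> k%:R * ln (n d)%:R = d%:R + c * sq d + r d.
  by move=> d0; rewrite ln_n // mulrA divff // mul1r.
have n0 d : (0 < d)%N -> (0 < n d)%N by move=> d0; rewrite (leq_ltn_trans _ (n_gt d0)).
have sqE d : d%:R = sq d * sq d by rewrite -expr2 sqr_sqrtr.
have mean_cvg : (mean (s d) - (d%:R + c * sq d)) / sq d @[d --> \oo] --> (0 : R).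
  pose e d := (mean (s d) - k%:R * ln (n d)%:R) / sq d.
  have e0 : e d @[d --> \oo] --> (0 : R).
    apply/norm_cvg0P; apply: (squeeze_cvgr _ (cvg_cst 0) C0).
    apply: near_pos => d d0; rewrite normr_ge0 /= normrM normfV.
    have sd0 : 0 < sq d by rewrite sqrtr_gt0 ltr0n.
    rewrite (gtr0_norm sd0) ler_pM2r ?invr_gt0 //.
    by have [] := mean_var_log R k0 (n0 _ d0).
  have er : e d + r d / sq d @[d --> \oo] --> (0 : R).
    by rewrite -[X in _ --> X](addr0 0); exact: cvgD.
  apply: cvg_trans er; apply: near_eq_cvg; apply: near_pos => d d0.
  by rewrite /e logE // -mulrDl; congr (_ / _); ring.
have var_cvg : var (s d) / sq d ^+ 2 @[d --> \oo] --> (1 : R).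
  pose e d := (var (s d) - k%:R * ln (n d)%:R) / sq d ^+ 2.
  have e0 : e d @[d --> \oo] --> (0 : R).
    apply/norm_cvg0P; apply: (squeeze_cvgr _ (cvg_cst 0) (cvg_over_nat C)).
    apply: near_pos => d d0; rewrite normr_ge0 /= normrM normfV.
    rewrite /sq sqr_sqrtr // normr_nat ler_pM2r ?invr_gt0 ?ltr0n //.
    by have [] := mean_var_log R k0 (n0 _ d0).
  have H : e d + 1 + c * (sq d)^-1 + r d / sq d * (sq d)^-1 @[d --> \oo] --> (1 : R).
    rewrite [X in _ --> X](_ : (1 : R) = 0 + 1 + c * 0 + 0 * 0); last first.
      by rewrite !mulr0 !addr0 add0r.
    apply: cvgD; last by apply: cvgM; [exact: r0 | exact: inv_sqrt_cvg0].
    apply: cvgD; last by apply: cvgM; [exact: cvg_cst | exact: inv_sqrt_cvg0].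
    by apply: cvgD; [exact: e0 | exact: cvg_cst].
  apply: cvg_trans H; apply: near_eq_cvg; apply: near_pos => d d0.
  have sd0 : sq d != 0 by rewrite gt_eqF // sqrtr_gt0 ltr0n.
  by rewrite /e logE // sqE; field.
have ps : \forall d \near \oo, probs (s d).
  by apply: nearW => d; exact: probs_success.
have := clt ps sq0 inv_sqrt_cvg0 mean_cvg var_cvg (z := - c).
apply: cvg_trans; apply: near_eq_cvg; apply: near_pos => d d0.
have sd0 : 0 < sq d by rewrite sqrtr_gt0 ltr0n.
rewrite tail_probC; apply: eq_bexp => j; congr (nat_of_bool _)%:R.
rewrite ler_pdivrMr // -(ler_nat R).
by apply/idP/idP => H; lra.
Qed.

End Critical.

Lemma expected_ratio_cvg (R : realType) (n : nat -> nat)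
    (disp : nat -> measure_display)
    (T : forall d : nat, measurableType (disp d))
    (P : forall d : nat, probability (T d) R)
    (xi : forall d : nat, 'I_(n d).-1 -> T d -> 'rV[R]_d)
    (n_gt : forall d : nat, (0 < d)%N -> (d < n d)%N)
    (xi_meas : forall d : nat, (0 < d)%N -> random_vectors (xi d))
    (xi_exch : forall d : nat, (0 < d)%N -> exchangeable (P d) (xi d))
    (xi_gp : forall d : nat, (0 < d)%N -> general_position (P d) (xi d))
    (k : nat) (v : R) : (0 < k)%N ->
  1 - tail_prob R k (n d) d @[d --> \oo] --> v ->
  (expected_faces (P d) (xi d) k.-1 / ('C(n d, k)%:R)%:E)%E @[d --> \oo] --> v%:E.
Proof.
move=> k0 /(face_ratio_cvg n_gt k0) fv.
have : (face_ratio R n k d)%:E @[d --> \oo] --> v%:E by apply: cvg_EFin => //; exact: nearW.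
apply: cvg_trans; apply: near_eq_cvg; exists k => // d /= kd.
have d0 := leq_trans k0 kd.
by rewrite (expected_ratio n_gt k0 (xi_meas d d0) (xi_exch d d0) (xi_gp d d0) kd).
Qed.

Theorem theorem6p2 (R : realType) (n : nat -> nat)
    (disp : nat -> measure_display)
    (T : forall d : nat, measurableType (disp d))
    (P : forall d : nat, probability (T d) R)
    (xi : forall d : nat, 'I_(n d).-1 -> T d -> 'rV[R]_d)
    (n_gt : forall d : nat, (0 < d)%N -> (d < n d)%N)
    (xi_meas : forall d : nat, (0 < d)%N -> random_vectors (xi d))
    (xi_exch : forall d : nat, (0 < d)%N -> exchangeable (P d) (xi d))
    (xi_gp : forall d : nat, (0 < d)%N -> general_position (P d) (xi d)) :
  (forall gamma : \bar R, (0 <= gamma)%E ->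
     (ln (n d)%:R / d%:R)%:E @[d --> \oo] --> gamma ->
     forall k : nat, (0 < k)%N ->
       ((gamma < (k%:R^-1)%:E)%E ->
          (expected_faces (P d) (xi d) k.-1 / ('C(n d, k)%:R)%:E)%E
            @[d --> \oo] --> 1%E) /\
       (((k%:R^-1)%:E < gamma)%E ->
          (expected_faces (P d) (xi d) k.-1 / ('C(n d, k)%:R)%:E)%E
            @[d --> \oo] --> 0%E)) /\
  (forall (k : nat) (c : R) (r : nat -> R), (0 < k)%N ->
     r =o_\oo (fun d : nat => Num.sqrt (d%:R : R)) ->
     (forall d : nat, (0 < d)%N ->
        ln (n d)%:R = k%:R^-1 * (d%:R + c * Num.sqrt d%:R + r d)) ->
     (expected_faces (P d) (xi d) k.-1 / ('C(n d, k)%:R)%:E)%E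
       @[d --> \oo] -->
     ((Num.sqrt (2 * pi))^-1%:E *
      \int[lebesgue_measure]_(x in `]-oo, (- c)%R])
         (expR (- (x ^+ 2) / 2))%:E)%E).
Proof.
split=> [gamma gamma0 ln_cvg k k0 | k c r k0 ro ln_n].
- have near_nbhs (A : set (\bar R)) : nbhs gamma A ->
      \forall d \near \oo, (0 < d)%N /\ A (ln (n d)%:R / d%:R)%:E.
    move=> /ln_cvg lnA; near=> d; split; near: d; [by exists 1%N | exact: lnA].
  split=> gk; apply: expected_ratio_cvg => //.
  + have [q gq qk] : exists2 q : R, (gamma < q%:E)%E & q < k%:R^-1.
      case: gamma gamma0 gk {ln_cvg near_nbhs} => // g _; rewrite lte_fin => gk.
      by exists ((g + k%:R^-1) / 2); rewrite ?lte_fin; lra.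
    apply: subcritical qk _ => //.
    have /near_nbhs : nbhs gamma [set y | (y < q%:E)%E].
      by apply: open_nbhs_nbhs; split => //; exact: open_ereal_lt_ereal.
    apply: filterS => d [d0]; rewrite /= lte_fin ltr_pdivrMr ?ltr0n //.
  + have [q qg kq] : exists2 q : R, (q%:E < gamma)%E & k%:R^-1 < q.
      case: gamma gamma0 gk {ln_cvg near_nbhs} => // [g _|_ _].
        rewrite lte_fin => kg.
        by exists ((g + k%:R^-1) / 2); rewrite ?lte_fin; lra.
      by exists (k%:R^-1 + 1); rewrite ?ltry ?ltrDl.
    apply: supercritical kq _ => //.
    have /near_nbhs : nbhs gamma [set y | (q%:E < y)%E].
      by apply: open_nbhs_nbhs; split => //; exact: open_ereal_gt_ereal.
    apply: filterS => d [d0]; rewrite /= lte_fin ltr_pdivlMr ?ltr0n //.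
- by rewrite gauss_integralE; apply: expected_ratio_cvg => //; exact: critical ro ln_n.
Unshelve. all: by end_near. Qed.
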